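(* Let $0<\alpha\le1$, let $\{\mathcal{S}^\alpha(t)\}_{t\ge0}$ be the generalized fractional Skellam process with probability mass function $p^\alpha(n,x)=\Pr\{\mathcal{S}^\alpha(x)=n\}$, let $\{Z(t)\}_{t\ge0}$ be an independent gamma subordinator with parameters $a,b>0$ and density $g(x,t)$, and let $\mathcal{Z}_{f_1}^\alpha(t)=\mathcal{S}^\alpha(Z(t))$. Let $\gamma\ge1$ and let $\kappa(x)=\Gamma'(x)/\Gamma(x)$ be the digamma function. Then the probability mass function $p_{f_1}^\alpha(n,t)=\Pr\{\mathcal{Z}_{f_1}^\alpha(t)=n\}$, $n\in\mathbb{Z}$, solves $$\mathbb{D}_t^{\gamma}p_{f_1}^\alpha(n,t)=b\,\mathbb{D}_t^{\gamma-1}\Big(\big(\log(a)-\kappa(bt)\big)p_{f_1}^\alpha(n,t)\Big)+b\int_0^\infty p^\alpha(n,x)\log(x)\,\mathbb{D}_t^{\gamma-1}g(x,t)\,\mathrm{d}x.$$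
   Context: Fix an integer $k\ge1$ and positive rates $\lambda_1,\dots,\lambda_k,\mu_1,\dots,\mu_k$. The generalized counting process (GCP) with rates $\lambda_1,\dots,\lambda_k$ is a Lévy process started at $0$ performing jumps of size $j\in\{1,\dots,k\}$ at rate $\lambda_j$. The generalized Skellam process (GSP) is $\mathcal{S}(t)=M_1(t)-M_2(t)$, with $M_1,M_2$ independent GCPs with rates $\lambda_j$ and $\mu_j$, respectively. For $0<\alpha<1$, the inverse stable subordinator is $Y_\alpha(t)=\inf\{x\ge0: D_\alpha(x)>t\}$, where $D_\alpha$ is the stable subordinator, $\mathbb{E}(e^{-sD_\alpha(t)})=e^{-ts^\alpha}$. The generalized fractional Skellam process (GFSP) is $\mathcal{S}^\alpha(t)=\mathcal{S}(Y_\alpha(t))$ for $0<\alpha<1$ with $\mathcal{S}$ and $Y_\alpha$ independent, and $\mathcal{S}^1(t)=\mathcal{S}(t)$. The gamma subordinator $\{Z(t)\}_{t\ge0}$ is the Lévy subordinator with $\mathbb{E}(e^{-sZ(t)})=e^{-tf_1(s)}$, $f_1(s)=b\log(1+s/a)$; its density is $g(x,t)=\frac{a^{bt}}{\Gamma(bt)}x^{bt-1}e^{-ax}$, $x>0$. For $\gamma\ge0$, $\mathbb{D}_t^\gamma$ is the Riemann–Liouville fractional derivative: $\mathbb{D}_t^\gamma w(t)=\frac{1}{\Gamma(m-\gamma)}\frac{\mathrm{d}^m}{\mathrm{d}t^m}\int_0^t\frac{w(s)}{(t-s)^{\gamma+1-m}}\mathrm{d}s$ for $m-1<\gamma<m$,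 and $\mathbb{D}_t^\gamma w(t)=\frac{\mathrm{d}^m}{\mathrm{d}t^m}w(t)$ for $\gamma=m$, with $m$ a positive integer ($\mathbb{D}_t^0$ is the identity).
   Formalization: For n = 0 and non-integer γ nothing is claimed: (log a − κ(bs)) p(0,s) ~ 1/(bs) is not integrable at s = 0, so the right-hand side is undefined; in all other cases existence and the equation (t > 0) are proved. Lévy paths are taken càdlàg for every outcome. *)

(* Defs.v *)
From HB Require Import structures.
From mathcomp Require Import all_boot all_order all_algebra.
From mathcomp Require Import all_classical all_reals all_analysis.
Import Order.TTheory GRing.Theory Num.Theory.
Import numFieldNormedType.Exports.

Set Implicit Arguments.
Unset Strict Implicit.
Unset Printing Implicit Defensive.

Local Open Scope classical_set_scope.
Local Open Scope ring_scope.

Section SpecialFunctions.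
Context {R : realType}.
Implicit Types (a b x t u gam : R) (w : R -> R).

(* Only meaningful for x > 0: the integral diverges for x <= 0, where its real
   value is 0 by convention. *)
Definition Gamma x : R :=
  \int[@lebesgue_measure R]_(y in `]0, +oo[) (y `^ (x - 1) * expR (- y)).

Definition digamma x : R := derive1 Gamma x / Gamma x.

Definition gamma_density a b x t : R :=
  a `^ (b * t) / Gamma (b * t) * x `^ (b * t - 1) * expR (- (a * x)).

(* For gam >= 0 not an integer, the m with m - 1 < gam < m is RL_ceil gam. *)
Definition RL_ceil gam : nat := (Num.truncn gam).+1.

Definition RL_kernel gam w u (s : R) : R :=
  w s / (u - s) `^ (gam + 1 - (RL_ceil gam)%:R).

Definition RL_integral gam w u : R :=
  \int[@lebesgue_measure R]_(s in `[0, u]) RL_kernel gam w u s.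

(* Riemann-Liouville derivative of order gam >= 0. *)
Definition RL_derive gam w t : R :=
  if gam \is a Num.nat then derive1n (Num.truncn gam) w t
  else (Gamma ((RL_ceil gam)%:R - gam))^-1
       * derive1n (RL_ceil gam) (RL_integral gam w) t.

Definition n_derivable_pos (m : nat) w : Prop :=
  forall (i : nat) x, (i < m)%N -> 0 < x -> derivable (derive1n i w) x 1.

(* [derive1n] and the real-valued integral are total: this says that the
   derivatives and integrals in [RL_derive gam w t] exist for all t > 0. *)
Definition RL_derivable gam w : Prop :=
  if gam \is a Num.nat then n_derivable_pos (Num.truncn gam) w
  else (forall u, 0 < u ->
          (@lebesgue_measure R).-integrable `[0, u]
            (EFin \o RL_kernel gam w u)) /\
       n_derivable_pos (RL_ceil gam) (RL_integral gam w).

End SpecialFunctions.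

Section Processes.
Context {d : measure_display} {T : measurableType d} {R : realType}.
Variable P : probability T R.

(* A process is a function of time and outcome, relevant for times t >= 0. *)
Implicit Types X Y Z S M D : R -> T -> R.

Definition mutually_independent (n : nat) (F : 'I_n -> T -> R) : Prop :=
  forall B : 'I_n -> set R, (forall i, measurable (B i)) ->
    P (\bigcap_(i in [set: 'I_n]) (F i @^-1` B i)) =
    (\prod_(i < n) P (F i @^-1` B i))%E.

Definition independent_processes X Y : Prop :=
  forall (m n : nat) (s : 'I_m -> R) (t : 'I_n -> R)
         (A : 'I_m -> set R) (B : 'I_n -> set R),
    (forall i, 0 <= s i) -> (forall j, 0 <= t j) ->
    (forall i, measurable (A i)) -> (forall j, measurable (B j)) ->
    P ((\bigcap_(i in [set: 'I_m]) (X (s i) @^-1` A i)) `&`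
       (\bigcap_(j in [set: 'I_n]) (Y (t j) @^-1` B j))) =
    (P (\bigcap_(i in [set: 'I_m]) (X (s i) @^-1` A i)) *
     P (\bigcap_(j in [set: 'I_n]) (Y (t j) @^-1` B j)))%E.

(* Path properties hold for every outcome, so that compositions of processes
   such as X (Z t w) w are random variables. *)
Record levy_process X : Prop := LevyProcess {
  levy_measurable : forall t, 0 <= t -> measurable_fun [set: T] (X t);
  levy_start : forall w, X 0 w = 0;
  levy_indep_increments : forall (n : nat) (t : nat -> R), 0 <= t 0%N ->
    (forall i, (i < n)%N -> t i <= t i.+1) ->
    mutually_independent (fun (i : 'I_n) w => X (t i.+1) w - X (t i) w);
  levy_stationary_increments : forall s h, 0 <= s -> 0 <= h ->
    forall B : set R, measurable B ->
    P [set w | B (X (s + h) w - X s w)] = P [set w | B (X h w)];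
  levy_right_continuous : forall t w, 0 <= t ->
    X s w @[s --> t^'+] --> X t w;
  levy_left_limits : forall t w, 0 < t -> cvg (X s w @[s --> t^'-])
}.

Definition subordinator X : Prop :=
  levy_process X /\ (forall s t w, 0 <= s -> s <= t -> X s w <= X t w).

Definition has_laplace_exponent X (f : R -> R) : Prop :=
  forall s t, 0 <= s -> 0 <= t ->
    ('E_P[fun w => expR (- (s * X t w))] = (expR (- (t * f s)))%:E)%E.

Definition stable_subordinator (alpha : R) D : Prop :=
  subordinator D /\ has_laplace_exponent D (fun s => s `^ alpha).

Definition gamma_subordinator (a b : R) Z : Prop :=
  subordinator Z /\ has_laplace_exponent Z (fun s => b * ln (1 + s / a)).

Definition inverse_subordinator D : R -> T -> R :=
  fun t w => inf [set x : R | 0 <= x /\ t < D x w].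

Definition subordinated X Y : R -> T -> R := fun t w => X (Y t w) w.

(* Jumps of size j at rate lam_j, in infinitesimal form: as h -> 0+,
   P(M h = j) = lam_j h + o(h) for 1 <= j <= k and
   P(M h not in {0, ..., k}) = o(h).  The index i : 'I_k encodes j = i + 1. *)
Definition gcp (k : nat) (lam : 'I_k -> R) M : Prop :=
  [/\ levy_process M,
      forall i : 'I_k,
        fine (P [set w | M h w = (i.+1)%:R]) / h @[h --> 0^'+] --> lam i &
      fine (P [set w | forall j : nat, (j <= k)%N -> M h w <> j%:R]) / h
        @[h --> 0^'+] --> (0 : R)].

Definition gsp (k : nat) (lam mu : 'I_k -> R) S : Prop :=
  exists M1 M2, [/\ gcp lam M1, gcp mu M2, independent_processes M1 M2 &
    forall t w, 0 <= t -> S t w = M1 t w - M2 t w].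

Definition gfsp (k : nat) (lam mu : 'I_k -> R) (alpha : R) X : Prop :=
  exists2 S, gsp lam mu S &
    if alpha == 1 then forall t w, 0 <= t -> X t w = S t w
    else exists D, [/\ stable_subordinator alpha D,
           independent_processes S (inverse_subordinator D) &
           forall t w, 0 <= t ->
             X t w = subordinated S (inverse_subordinator D) t w].

Definition state_prob X (n : int) (t : R) : R := fine (P [set w | X t w = n%:~R]).

End Processes.

Section Equation.
Context {R : realType}.
Variables (a b gam : R).
(* p is p^alpha(n, .) and q is p_{f_1}^alpha(n, .), at a fixed n. *)
Variables (p q : R -> R).

Definition drift_term (t : R) : R := (ln a - digamma (b * t)) * q t.

Definition density_integrand (t x : R) : R :=
  p x * ln x * RL_derive (gam - 1) (gamma_density a b x) t.

Definition solves_equation : Prop := forall t, 0 < t ->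
  RL_derive gam q t =
    b * RL_derive (gam - 1) drift_term t
    + b * \int[@lebesgue_measure R]_(x in `]0, +oo[) density_integrand t x.

(* All derivatives and integrals occurring in the equation exist. *)
Definition equation_well_defined : Prop :=
  [/\ RL_derivable gam q,
      RL_derivable (gam - 1) drift_term,
      forall x, 0 < x -> RL_derivable (gam - 1) (gamma_density a b x) &
      forall t, 0 < t -> (@lebesgue_measure R).-integrable `]0, +oo[
        (EFin \o density_integrand t)].

End Equation.

(* Main.v *)
(* The density [g x t = a^(bt) x^(bt-1) e^(-ax) / Gamma(bt)] satisfies
   [dg/dt = b (ln a - digamma (bt) + ln x) g], and [q t] is the integral of
   [p x * g x t] over [x > 0].  Every derivative in [t] of the moments
   [\int p(x) (ln x)^j x^(bt-1) e^(-ax) dx] may be taken under the integral, so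
   differentiating [q] gives the equation for integer orders.

   For a non-integer order the substitution [s = t v] turns the fractional
   integral of [f] into a power of [t] times an average of [f (t v)] over
   [0 < v < 1].  If [n <> 0] then [p x = O(x^eps)] at [0], by a Chernoff bound
   for the stable subordinator; hence [q] and the drift term, whose factor
   [digamma (bt)] is of order [1/t], extend smoothly enough to [0], [q]
   vanishes there, and Fubini's theorem applies.  If [n = 0] then [q >= 1/2]
   near [0], the drift term is not integrable at [0], and the equation has no
   meaning.

   The law of [Z t] is identified with the gamma law through its Laplace
   transform at the integers, that is, through the moments of [e^(-Z t)], using
   Bernstein polynomials.  Since only finite-dimensional independence of [X] and
   [Z] is given, [X (Z t)] is obtained as the limit of [X] at the next point of
   a grid, where right continuity and integrality of the paths make the events
   [X = n] converge. *)
Require Import Defs.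
From HB Require Import structures.
From mathcomp Require Import all_boot all_order all_algebra.
From mathcomp Require Import all_classical all_reals all_analysis.
From mathcomp Require Import measurable_realfun ring lra.
Import Order.TTheory GRing.Theory Num.Theory.
Import numFieldNormedType.Exports.
Local Open Scope classical_set_scope.
Local Open Scope ring_scope.
Set Implicit Arguments.
Unset Strict Implicit.
Unset Printing Implicit Defensive.

(** * Integrals and improper integrals *)

(** A Riemann-Liouville integral at u sees all of (0, u), so behaviour at t = 0 decides what can be
    proved. Smoothness therefore comes in two strengths, chosen by a boolean: derivatives bounded on
    compact parts of the open half-line, or bounded down to 0. Integer orders need only the first,
    and the trivial bound p <= 1 suffices. Non-integer orders need the second, and this is where
    p(x) = O(x^eps) with eps > 0 enters: it keeps the moments finite as x^(bt-1) approaches x^(-1).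

    The identity Gamma(bt+1) = bt Gamma(bt) writes the normalising constant a^(bt)/Gamma(bt) as bt
    times a function regular at 0. That factor t makes q vanish linearly at 0, which removes the
    boundary term when a derivative is moved inside the fractional integral. It also cancels the
    pole -1/(bt) of digamma(bt) in the drift term.

    High derivatives are exchanged with the integral in x by finite expansions: derivatives of g are
    combinations of kernels, and those of its mixtures combine the corresponding moments with the
    same coefficients in t. What remains is linearity of the integral. *)

Section IntegralTools.
Context {d} {Y : measurableType d} {R : realType}.
Variable mu : {measure set Y -> \bar R}.
Implicit Types (D : set Y) (f g : Y -> R).

Lemma le_Rintegrable D f g : measurable D -> measurable_fun D f ->
  (forall x, D x -> `|f x| <= g x) ->
  mu.-integrable D (EFin \o g) -> mu.-integrable D (EFin \o f).
Proof.
move=> mD mf fg ig; apply: (le_integrable mD _ _ ig); first exact/measurable_EFinP.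
by move=> x Dx; rewrite /= lee_fin (le_trans (fg _ Dx))// ler_norm.
Qed.

Lemma RintegrableZl D f (r : R) : measurable D ->
  mu.-integrable D (EFin \o f) -> mu.-integrable D (EFin \o (fun x => r * f x)).
Proof.
move=> mD fi.
rewrite (_ : _ \o _ = (fun x => r%:E * (EFin \o f) x)%E); first exact: integrableZl.
by apply/funext => x /=; rewrite EFinM.
Qed.

Lemma RintegrableD D f g : measurable D ->
  mu.-integrable D (EFin \o f) -> mu.-integrable D (EFin \o g) ->
  mu.-integrable D (EFin \o (fun x => f x + g x)).
Proof.
move=> mD fi gi.
rewrite (_ : _ \o _ = (EFin \o f) \+ (EFin \o g))%E; first exact: integrableD.
by apply/funext => x /=; rewrite EFinD.
Qed.

Lemma Rintegrable_sum D (I : Type) (s : seq I) (h : I -> Y -> R) : measurable D ->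
  (forall i, mu.-integrable D (EFin \o h i)) ->
  mu.-integrable D (EFin \o (fun x => \sum_(i <- s) h i x)).
Proof.
move=> mD hi.
rewrite (_ : _ \o _ = (fun x => \sum_(i <- s) (EFin \o h i) x)%E).
  by apply: integrable_sum => // i _; exact: hi.
by apply/funext => x /=; rewrite -sumEFin.
Qed.

Lemma Rintegral_sum D (I : Type) (s : seq I) (h : I -> Y -> R) : measurable D ->
  (forall i, mu.-integrable D (EFin \o h i)) ->
  \int[mu]_(x in D) (\sum_(i <- s) h i x) = \sum_(i <- s) \int[mu]_(x in D) h i x.
Proof.
move=> mD hi; elim: s => [|i s IH].
  rewrite big_nil (_ : (fun _ => _) = cst 0) ?Rintegral_cst ?mul0r//.
  by apply/funext => x; rewrite big_nil.
under eq_Rintegral do rewrite big_cons.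
by rewrite RintegralD ?big_cons ?IH//; exact: Rintegrable_sum.
Qed.

Lemma Rdominated_cvg D (f_ : nat -> Y -> R) f g : measurable D ->
  (forall n, measurable_fun D (f_ n)) ->
  (forall x, D x -> f_ ^~ x @ \oo --> f x) ->
  mu.-integrable D (EFin \o g) ->
  (forall n x, D x -> `|f_ n x| <= g x) ->
  mu.-integrable D (EFin \o f) /\
  \int[mu]_(x in D) f_ n x @[n --> \oo] --> \int[mu]_(x in D) f x.
Proof.
move=> mD mf_ f_f ig fg.
have mf_E n : measurable_fun D (EFin \o f_ n) by exact/measurable_EFinP.
have cE x : D x -> (fun n => (EFin \o f_ n) x) @ \oo --> (EFin \o f) x.
  by move=> Dx; apply: cvg_EFin; [exact: nearW|exact: f_f].
have fgE : {ae mu, forall x n, D x -> (`|(EFin \o f_ n) x| <= (EFin \o g) x)%E}.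
  by apply: aeW => x n Dx; rewrite /= lee_fin fg.
have mf : measurable_fun D (EFin \o f) by apply: emeasurable_fun_cvg mf_E cE.
have [fi _ cf] := dominated_convergence mD mf_E mf (aeW _ cE) ig fgE.
split=> //; apply: fine_cvg; rewrite fineK//.
exact: integrable_fin_num.
Qed.

End IntegralTools.

(** * Fundamental theorem of calculus along an exhaustion by compact intervals *)

Section ImproperFTC.
Context {R : realType}.
Local Notation mu := (@lebesgue_measure R).
Variables (D : set R) (c d : R^nat).
Hypothesis cd : forall n, c n < d n.
Hypothesis ndcd : nondecreasing_seq (fun n => `[c n, d n]%classic).
Hypothesis DE : D = \bigcup_n `[c n, d n]%classic.
Variables (F f : R -> R).
Hypothesis dF : forall x, D x -> is_derive x 1 F (f x).
Hypothesis cf : forall x, D x -> {for x, continuous f}.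

Let subD n x : `[c n, d n]%classic x -> D x.
Proof. by rewrite DE => cdx; exists n. Qed.

Let mD : measurable D.
Proof. by rewrite DE; apply: bigcup_measurable. Qed.

Let cFx x : D x -> {for x, continuous F}.
Proof. by move=> Dx; apply/differentiable_continuous/derivable1_diffP; have [] := dF Dx. Qed.

Lemma compact_FTC n :
  (\int[mu]_(x in `[c n, d n]) (f x)%:E = (F (d n))%:E - (F (c n))%:E)%E.
Proof.
apply: continuous_FTC2 => //.
- apply: continuous_in_subspaceT => x; rewrite inE => xcd.
  exact: (cf (subD xcd)).
- split.
  + move=> x xcd; apply: ex_derive; apply: dF; apply: (@subD n) => /=.
    exact: subset_itv_oo_cc.
  + apply: cvg_at_right_filter; apply: cFx; apply: (@subD n).
    by rewrite /= in_itv/= lexx ltW.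
  + apply: cvg_at_left_filter; apply: cFx; apply: (@subD n).
    by rewrite /= in_itv/= lexx ltW.
- move=> x xcd; rewrite derive1E; apply: derive_val; apply: dF; apply: (@subD n) => /=.
  exact: subset_itv_oo_cc.
Qed.

Lemma improper_measurable : measurable_fun D f.
Proof.
rewrite DE; apply/measurable_fun_bigcup => // n.
apply: subspace_continuous_measurable_fun => //.
apply: continuous_in_subspaceT => x; rewrite inE => xcd.
exact: (cf (subD xcd)).
Qed.

(** Monotone convergence along the exhaustion: the integral over each compact piece is an increment
    of the antiderivative, so a bound on increments bounds the whole integral. *)
Lemma ge0_improper_integrable (K : R) : (forall x, D x -> 0 <= f x) ->
  (forall n, F (d n) - F (c n) <= K) -> mu.-integrable D (EFin \o f).
Proof.
move=> f0 FK; apply/integrableP; split.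
  by apply/measurable_EFinP; exact: improper_measurable.
rewrite (@le_lt_trans _ _ K%:E) ?ltry//.
rewrite (@eq_integral _ _ _ mu D (EFin \o f)); last first.
  by move=> x /set_mem Dx; rewrite /= ger0_norm// f0.
have mfn n : measurable_fun `[c n, d n] (EFin \o f).
  apply/measurable_EFinP; apply: measurable_funS improper_measurable => //.
  exact: subD.
have f0n i x : `[c i, d i]%classic x -> (0 <= (EFin \o f) x)%E.
  by move=> /subD Dx; rewrite lee_fin f0.
have := ge0_nondecreasing_set_cvg_integral (mu := mu) ndcd (fun=> measurable_itv _) mfn f0n.
rewrite -DE => H; rewrite -(cvg_lim _ H)//; apply: lime_le.
  by apply/cvg_ex; eexists; exact: H.
by apply: nearW => n; rewrite compact_FTC lee_fin.
Qed.

(** Truncations of f to the compact pieces are dominated by |f|, so their integrals, which are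
    increments of F, converge to the integral over D. *)
Lemma improper_FTC (A B : R) : mu.-integrable D (EFin \o f) ->
  F (c n) @[n --> \oo] --> A -> F (d n) @[n --> \oo] --> B ->
  \int[mu]_(x in D) f x = B - A.
Proof.
move=> fi FA FB.
pose f_ n := f \_ `[c n, d n]%classic.
have [_] : mu.-integrable D (EFin \o f) /\
   \int[mu]_(x in D) f_ n x @[n --> \oo] --> \int[mu]_(x in D) f x.
  apply: (@Rdominated_cvg _ _ _ mu D f_ f (fun x => `|f x|)) => //.
  - move=> n; apply/measurable_restrict => //.
    apply: measurable_funS improper_measurable => //; exact: subIsetl.
  - move=> x Dx; apply: cvg_near_cst.
    have [N _ cdx] : (\bigcup_n `[c n, d n]%classic) x by rewrite -DE.
    exists N => // n /= Nn; apply/eqP; rewrite /f_ patchE mem_set//.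
    by move: cdx; apply: subsetPset; exact: ndcd.
  - by have := integrable_norm fi; apply: eq_integrable.
  - move=> n x Dx; rewrite /f_ patchE; case: ifP => //.
    by rewrite normr0.
have -> : (fun n => \int[mu]_(x in D) f_ n x) = (fun n => F (d n) - F (c n)).
  apply/funext => n; rewrite /f_ -Rintegral_mkcondr setIidr; last exact: subD.
  by rewrite /Rintegral compact_FTC.
move=> H1; have H2 : F (d n) - F (c n) @[n --> \oo] --> B - A by exact: cvgB.
exact: (cvg_unique _ H1 H2).
Qed.

End ImproperFTC.

(** * Linear change of variables for Lebesgue measure *)

Section Scaling.
Context {R : realType}.
Local Notation mu := (@lebesgue_measure R).
Variable c : R.
Hypothesis c0 : 0 < c.

Let mulc : measurableTypeR R -> measurableTypeR R := fun x => c * x.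

Let mulc_measurable : measurable_fun [set: measurableTypeR R] mulc.
Proof. exact: measurable_funM. Qed.

Let pushed : {measure set (measurableTypeR R) -> \bar R} :=
  measure_function_pushforward__canonical__measure_function_Measure
    lebesgue_measure mulc_measurable.

Let scaled_measure : {measure set (measurableTypeR R) -> \bar R} :=
  mscale (NngNum (ltW c0)) pushed.

(** By uniqueness of Lebesgue measure it is enough to compare both sides on half-open intervals. *)
Lemma scaled_lebesgue (A : set (measurableTypeR R)) : measurable A ->
  mu A = (c%:E * mu (mulc @^-1` A))%E.
Proof.
move=> mA; rewrite (@lebesgue_measure_unique R scaled_measure)// => _ [[a b] _ <-] /=.
rewrite /scaled_measure/= /mscale/= /pushforward.
have -> : mulc @^-1` `]a, b]%classic = `](a / c), (b / c)]%classic.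
  apply/seteqP; split=> x /=; rewrite !in_itv/= /mulc.
    by rewrite ltr_pdivrMr// ler_pdivlMr// !(mulrC x).
  by rewrite ltr_pdivrMr// ler_pdivlMr// !(mulrC x).
rewrite !lebesgue_measure_itv/= !lte_fin ltr_pM2r ?invr_gt0//.
case: ifPn => _; last by rewrite mule0.
by rewrite -!EFinB -EFinM; congr (_%:E); field; rewrite gt_eqF.
Qed.

Lemma ge0_integral_scale (D : set (measurableTypeR R)) (f : R -> \bar R) : measurable D ->
  measurable_fun D f -> (forall x, D x -> (0 <= f x)%E) ->
  (\int[mu]_(x in D) f x = c%:E * \int[mu]_(x in mulc @^-1` D) f (c * x)%R)%E.
Proof.
move=> mD mf f0.
rewrite (@eq_measure_integral _ _ _ D scaled_measure); last first.
  by move=> A mA _; rewrite [LHS]scaled_lebesgue.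
rewrite ge0_integral_mscale//=; congr (_ * _)%E.
rewrite ge0_integral_pushforward// => x; rewrite inE; exact: f0.
Qed.

Lemma integrable_scale (D : set (measurableTypeR R)) (f : R -> R) : measurable D ->
  measurable_fun D f ->
  mu.-integrable (mulc @^-1` D) (EFin \o (fun x => f (c * x))) ->
  mu.-integrable D (EFin \o f).
Proof.
move=> mD mf /integrableP[_ fi]; apply/integrableP.
have mEf : measurable_fun D (EFin \o f) by exact/measurable_EFinP.
split=> //; rewrite ge0_integral_scale//; last exact: measurableT_comp.
by rewrite lte_mul_pinfty// lee_fin ltW.
Qed.

Lemma integrable_unscale (D : set (measurableTypeR R)) (f : R -> R) : measurable D ->
  mu.-integrable D (EFin \o f) ->
  mu.-integrable (mulc @^-1` D) (EFin \o (fun x => f (c * x))).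
Proof.
move=> mD /integrableP[mEf fi]; apply/integrableP; split.
  apply/measurable_EFinP; apply: (measurable_comp mD) => //.
  - by move=> _ [x /= Dx <-].
  - exact/measurable_EFinP.
move: fi; rewrite ge0_integral_scale//; last exact: measurableT_comp.
rewrite muleC; apply: contraTT; rewrite -!leNgt !leye_eq => /eqP ->; rewrite gt0_mulye// lte_fin.
Qed.

(** The nonnegative case is applied to the positive and negative parts; integrability makes both
    finite, so the factor c can be pulled out of their difference. *)
Lemma Rintegral_scale (D : set (measurableTypeR R)) (f : R -> R) : measurable D ->
  mu.-integrable D (EFin \o f) ->
  \int[mu]_(x in D) f x = c * \int[mu]_(x in mulc @^-1` D) f (c * x).
Proof.
move=> mD fi; have fi' := integrable_unscale mD fi.
have mf := measurable_int _ fi.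
have mD' : measurable (mulc @^-1` D).
  by rewrite -[X in measurable X]setTI; exact: mulc_measurable.
have ip := integrable_pos_fin_num mD' fi'.
have im := integrable_neg_fin_num mD' fi'.
rewrite /Rintegral integralE ge0_integral_scale//; last exact: measurable_funepos.
rewrite [X in (_ - X)%E]ge0_integral_scale//; last exact: measurable_funeneg.
rewrite [in RHS]integralE.
have -> : (\int[mu]_(x in mulc @^-1` D) (EFin \o f)^\+ (c * x)%R =
    \int[mu]_(x in mulc @^-1` D) (EFin \o (fun x => f (c * x)%R))^\+ x)%E.
  by apply: eq_integral => x _; rewrite !funeposE.
have -> : (\int[mu]_(x in mulc @^-1` D) (EFin \o f)^\- (c * x)%R =
    \int[mu]_(x in mulc @^-1` D) (EFin \o (fun x => f (c * x)%R))^\- x)%E.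
  by apply: eq_integral => x _; rewrite !funenegE.
rewrite -muleBr//; last exact: fin_num_adde_defr.
by rewrite fineM// fin_numB; apply/andP.
Qed.

End Scaling.

(** * Improper integrals over (0, oo) and over (0, 1) *)

Section OpenIntervalFTC.
Context {R : realType}.
Local Notation mu := (@lebesgue_measure R).
Variables F f : R -> R.

Lemma nondecreasing_itvcc (c d : R^nat) :
  (forall n, c n.+1 <= c n) -> (forall n, d n <= d n.+1) ->
  nondecreasing_seq (fun n => `[c n, d n]%classic).
Proof.
move=> c_dec d_inc; apply/nondecreasing_seqP => n; apply/subsetPset => x /=.
rewrite !in_itv/= => /andP[cx xd].
by rewrite (le_trans (c_dec n) cx) (le_trans xd (d_inc n)).
Qed.

Section Pos.
Let c (n : nat) : R := n.+1%:R^-1.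
Let d (n : nat) : R := n.+2%:R.

Let cd n : c n < d n.
Proof.
by rewrite (@le_lt_trans _ _ 1) ?ltr1n// invf_le1 ?ltr0n// ler1n.
Qed.

Let ndcd : nondecreasing_seq (fun n => `[c n, d n]%classic).
Proof.
apply: nondecreasing_itvcc => n; last by rewrite ler_nat.
by rewrite lef_pV2 ?posrE ?ltr0n// ler_nat.
Qed.

Let DE : `]0, +oo[%classic = \bigcup_n `[c n, d n]%classic.
Proof.
apply/seteqP; split=> x /=; rewrite in_itv/= ?andbT.
  move=> x0; pose N := Num.bound (x + x^-1).
  have NP : x + x^-1 < N%:R.
    by rewrite archi_boundP// addr_ge0 ?invr_ge0// ltW.
  have xV : 0 < x^-1 by rewrite invr_gt0.
  exists N => //=; rewrite in_itv/= /c /d; apply/andP; split.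
    rewrite -[leRHS]invrK lef_pV2 ?posrE//.
    have : N%:R <= N.+1%:R :> R by rewrite ler_nat.
    by lra.
  have : N%:R <= N.+2%:R :> R by rewrite ler_nat (leq_trans (leqnSn _)).
  by lra.
move=> [n _ /=]; rewrite in_itv/= => /andP[+ _]; apply: lt_le_trans.
by rewrite invr_gt0 ltr0n.
Qed.

Hypothesis dF : forall x : R, 0 < x -> is_derive x 1 F (f x).
Hypothesis df : forall x : R, 0 < x -> derivable f x 1.

Let dF' (x : R) : `]0, +oo[%classic x -> is_derive x 1 F (f x).
Proof. by rewrite /= in_itv/= andbT; exact: dF. Qed.

Let cf' (x : R) : `]0, +oo[%classic x -> {for x, continuous f}.
Proof.
rewrite /= in_itv/= andbT => x0.
exact/differentiable_continuous/derivable1_diffP/df.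
Qed.

Lemma ge0_integrable_pos (K : R) : (forall x : R, 0 < x -> 0 <= f x) ->
  (forall x y : R, 0 < x -> 0 < y -> F y - F x <= K) ->
  mu.-integrable `]0, +oo[ (EFin \o f).
Proof.
move=> f0 FK; apply: (ge0_improper_integrable cd ndcd DE dF' cf' (K := K)).
  by move=> x; rewrite /= in_itv/= andbT; exact: f0.
by move=> n; apply: FK; rewrite /c /d ?invr_gt0 ltr0n.
Qed.

Lemma FTC_pos (A B : R) : mu.-integrable `]0, +oo[ (EFin \o f) ->
  F x @[x --> 0^'+] --> A -> F x @[x --> +oo] --> B ->
  \int[mu]_(x in `]0, +oo[) f x = B - A.
Proof.
move=> fi FA FB; apply: (improper_FTC cd ndcd DE dF' cf' fi).
  apply: ((cvg_at_rightP _ _ _).1 FA); split; first by move=> n; rewrite invr_gt0 ltr0n.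
  exact: cvg_harmonic.
apply: ((cvg_pinftyP _ _).1 FB); apply/cvgryPge => M.
near=> n; apply: (@le_trans _ _ n%:R); last by rewrite ler_nat ltnW// ltnW.
near: n; exact: nbhs_infty_ger.
Unshelve. all: end_near. Qed.

End Pos.

Section Unit.
(** The offset 3 keeps [c n] at most 1/3, hence [c n < d n] already for n = 0. *)
Let c (n : nat) : R := n.+3%:R^-1.
Let d (n : nat) : R := 1 - n.+3%:R^-1.

Let c0 n : 0 < c n. Proof. by rewrite invr_gt0 ltr0n. Qed.

Let c3 n : c n <= 3^-1.
Proof. by rewrite lef_pV2 ?posrE ?ltr0n// ler_nat. Qed.

Let cd n : c n < d n.
Proof. by have := c3 n; rewrite /d -/(c n); lra. Qed.

Let ndcd : nondecreasing_seq (fun n => `[c n, d n]%classic).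
Proof.
have cS n : c n.+1 <= c n by rewrite lef_pV2 ?posrE ?ltr0n// ler_nat.
by apply: nondecreasing_itvcc => n //; have := cS n; rewrite /d -/(c n) -/(c n.+1); lra.
Qed.

Let DE : `]0, 1[%classic = \bigcup_n `[c n, d n]%classic.
Proof.
apply/seteqP; split=> x /=; rewrite in_itv/=.
  move=> /andP[x0 x1]; pose N := Num.bound (x^-1 + (1 - x)^-1).
  have xV : 0 < x^-1 by rewrite invr_gt0.
  have xV1 : 0 < (1 - x)^-1 by rewrite invr_gt0 subr_gt0.
  have NP : x^-1 + (1 - x)^-1 < N%:R by rewrite archi_boundP// addr_ge0// ltW.
  exists N => //=; rewrite in_itv/=; apply/andP; split.
    by rewrite /c -[leRHS]invrK lef_pV2 ?posrE// ?ltr0n//; lra.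
  rewrite /d lerBrDl -lerBrDr -[leRHS]invrK lef_pV2 ?posrE// ?ltr0n//; lra.
move=> [n _ /=]; rewrite in_itv/= => /andP[cx xd]; apply/andP; split.
  by rewrite (lt_le_trans (c0 n)).
by rewrite (le_lt_trans xd)// /d -/(c n) ltrBlDr ltrDl.
Qed.

Hypothesis dF : forall x : R, 0 < x -> x < 1 -> is_derive x 1 F (f x).
Hypothesis df : forall x : R, 0 < x -> x < 1 -> derivable f x 1.

Let dF' (x : R) : `]0, 1[%classic x -> is_derive x 1 F (f x).
Proof. by rewrite /= in_itv/= => /andP[]; exact: dF. Qed.

Let cf' (x : R) : `]0, 1[%classic x -> {for x, continuous f}.
Proof.
rewrite /= in_itv/= => /andP[x0 x1].
exact/differentiable_continuous/derivable1_diffP/df.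
Qed.

Lemma ge0_integrable_unit (K : R) : (forall x : R, 0 < x -> x < 1 -> 0 <= f x) ->
  (forall x y : R, 0 < x -> x < 1 -> 0 < y -> y < 1 -> F y - F x <= K) ->
  mu.-integrable `]0, 1[ (EFin \o f).
Proof.
move=> f0 FK; apply: (ge0_improper_integrable cd ndcd DE dF' cf' (K := K)).
  by move=> x; rewrite /= in_itv/= => /andP[]; exact: f0.
by move=> n; apply: FK => //; have := c3 n; have := c0 n; rewrite /d -/(c n); lra.
Qed.

Lemma FTC_unit (A B : R) : mu.-integrable `]0, 1[ (EFin \o f) ->
  F x @[x --> 0^'+] --> A -> F x @[x --> 1^'-] --> B ->
  \int[mu]_(x in `]0, 1[) f x = B - A.
Proof.
have cvgc : c @ \oo --> 0.
  have := @cvg_harmonic R; rewrite -(cvg_shiftn 2); apply: cvg_trans.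
  by apply: near_eq_cvg; near=> n; rewrite /= addn2.
move=> fi FA FB; apply: (improper_FTC cd ndcd DE dF' cf' fi).
  by apply: ((cvg_at_rightP _ _ _).1 FA); split.
apply: ((cvg_at_leftP _ _ _).1 FB); split.
  by move=> n; rewrite /d -/(c n) ltrBlDr ltrDl.
by rewrite -[X in _ --> X]subr0; apply: cvgB => //; exact: cvg_cst.
Unshelve. all: end_near. Qed.

End Unit.
End OpenIntervalFTC.

(** * Powers and exponentials *)

Section DerivativeRules.
Context {R : realType}.
Implicit Types (f g : R -> R) (x df dg : R).

Lemma is_derive_as f x df df' : is_derive x 1 f df -> df = df' -> is_derive x 1 f df'.
Proof. by move=> ? <-. Qed.

Lemma is_derive_derivable f x df : is_derive x 1 f df -> derivable f x 1.
Proof. by move=> ?; exact: ex_derive. Qed.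

Lemma is_derive_fcst (c : R) x : is_derive x 1 (fun=> c) 0.
Proof. exact: is_derive_cst. Qed.

Lemma is_derive_fD f g x df dg : is_derive x 1 f df -> is_derive x 1 g dg ->
  is_derive x 1 (fun y => f y + g y) (df + dg).
Proof. by move=> hf hg; exact: is_deriveD. Qed.

Lemma is_derive_fM f g x df dg : is_derive x 1 f df -> is_derive x 1 g dg ->
  is_derive x 1 (fun y => f y * g y) (df * g x + f x * dg).
Proof.
move=> hf hg; apply: (is_derive_as (@is_deriveM _ _ f g x 1 df dg hf hg)).
by rewrite addrC /GRing.scale/= (mulrC df).
Qed.

Lemma is_derive_fZ (c : R) f x df : is_derive x 1 f df ->
  is_derive x 1 (fun y => c * f y) (c * df).
Proof.
move=> hf; apply: (is_derive_as (is_derive_fM (is_derive_cst c x 1) hf)).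
by rewrite mul0r add0r.
Qed.

Lemma is_derive_fcomp f g x df dg : is_derive (g x) 1 f df -> is_derive x 1 g dg ->
  is_derive x 1 (fun y => f (g y)) (df * dg).
Proof. by move=> hf hg; exact: is_derive1_comp. Qed.

Lemma is_derive_affine (c e : R) x : is_derive x 1 (fun y => c * y + e) c.
Proof.
apply: (is_derive_as (is_derive_fD (is_derive_fZ c (is_derive_id x 1)) (is_derive_cst e x 1))).
by rewrite addr0 mulr1.
Qed.

End DerivativeRules.

Section PowerBounds.
Context {R : realType}.
Local Notation mu := (@lebesgue_measure R).
Implicit Types (x r s a : R).

Lemma powR_expRE x r : 0 < x -> x `^ r = expR (r * ln x).
Proof. by move=> x0; rewrite /powR gt_eqF. Qed.

Lemma expR_exprn (y : R) (j : nat) : 0 <= y -> y ^+ j <= j`!%:R * expR y.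
Proof.
move=> y0; case: j => [|j].
  by rewrite expr0 fact0 mul1r -expR0 ler_expR.
rewrite mulrC -ler_pdivrMr ?ltr0n ?fact_gt0//.
by apply: le_trans (expR_ge1Dxn j y0); rewrite lerDr.
Qed.

(** Apply y^j <= j! e^y to y = s |ln x|, and note that e^(s |ln x|) is either x^s or x^(-s). *)
Lemma norm_ln_expr_bound (s : R) (j : nat) : 0 < s -> exists2 K, 0 <= K &
  forall x, 0 < x -> `|ln x| ^+ j <= K * (x `^ s + x `^ (- s)).
Proof.
move=> s0; exists (j`!%:R / s ^+ j); first by rewrite divr_ge0// exprn_ge0// ltW.
move=> x x0; rewrite mulrAC ler_pdivlMr ?exprn_gt0// -exprMn mulrC.
apply: le_trans (expR_exprn _ _) _; first by rewrite mulr_ge0// ltW.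
rewrite ler_pM2l ?ltr0n ?fact_gt0// !powR_expRE//.
have [l0|l0] := leP 0 (ln x); first by rewrite ger0_norm// lerDl expR_ge0.
by rewrite ltr0_norm// mulrN mulNr lerDr expR_ge0.
Qed.

(** For x <= 1 both factors are at most 1; for x > 1 the exponent r is rounded up to an integer N
    and (a x)^N <= N! e^(a x). *)
Lemma powR_expR_bound (r a : R) : 0 <= r -> 0 < a -> exists2 K, 0 <= K &
  forall x, 0 < x -> x `^ r * expR (- (a * x)) <= K.
Proof.
move=> r0 a0; pose N := Num.bound r.
have fa : 0 <= N`!%:R / a ^+ N by rewrite divr_ge0// exprn_ge0// ltW.
exists (1 + N`!%:R / a ^+ N); first by rewrite addr_ge0.
move=> x x0; have ax0 : 0 <= a * x by rewrite mulr_ge0// ltW.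
have e1 : expR (- (a * x)) <= 1 by rewrite expR_le1 oppr_le0.
have [x1|x1] := leP x 1.
  rewrite -[leLHS]addr0; apply: lerD => //.
  rewrite -[leRHS]mulr1; apply: ler_pM => //; rewrite ?powR_ge0 ?expR_ge0//.
  by rewrite -[leRHS](powRr0 x) ger_powR// x0 x1.
rewrite -[leLHS]add0r; apply: lerD => //.
rewrite expRN ler_pdivrMr ?expR_gt0//.
apply: (@le_trans _ _ (x ^+ N)).
  by rewrite -powR_mulrn ?(ltW x0)// ler_powR ?(ltW x1)// ltW// archi_boundP.
have := expR_exprn N ax0; rewrite exprMn mulrAC ler_pdivlMr ?exprn_gt0//.
by rewrite mulrC.
Qed.

Lemma powR_between (x s t u : R) : 0 < x -> s <= t -> t <= u ->
  x `^ t <= x `^ s + x `^ u.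
Proof.
move=> x0 st tu; have [x1|x1] := leP x 1.
  by rewrite -[leLHS]addr0 lerD ?powR_ge0// ger_powR// x0.
by rewrite -[leLHS]add0r lerD ?powR_ge0// ler_powR// ltW.
Qed.

Lemma is_derive_powR_1B (s x : R) : x < 1 ->
  is_derive x 1 (fun v => (1 - v) `^ s) (- (s * (1 - x) `^ (s - 1))).
Proof.
move=> x1; have /(is_derive1_powR s) h : 0 < -1 * x + 1 by lra.
have H := is_derive_fcomp (f := fun z : R => z `^ s) (g := fun y : R => -1 * y + 1) h
  (@is_derive_affine R (-1) 1 x).
have -> : (fun v : R => (1 - v) `^ s) = (fun v => (-1 * v + 1) `^ s).
  by apply/funext => v; congr (_ `^ _); ring.
apply: (is_derive_as H).
by rewrite (_ : 1 - x = -1 * x + 1); ring.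
Qed.

Lemma powR_1B_integrable s : 0 < s ->
  mu.-integrable `]0, 1[ (EFin \o (fun v => (1 - v) `^ (s - 1))).
Proof.
move=> s0; apply: (@ge0_integrable_unit R (fun v => - s^-1 * (1 - v) `^ s)
  (fun v => (1 - v) `^ (s - 1)) _ _ s^-1).
- move=> x x0 x1; apply: (is_derive_as (is_derive_fZ _ (is_derive_powR_1B s x1))).
  by rewrite mulrNN mulrA mulVf ?mul1r// gt_eqF.
- by move=> x x0 x1; exact: (is_derive_derivable (is_derive_powR_1B (s - 1) x1)).
- by move=> x x0 x1; rewrite powR_ge0.
- move=> x y x0 x1 y0 y1; rewrite !mulNr opprK.
  have h1 : 0 <= s^-1 * (1 - y) `^ s by rewrite mulr_ge0 ?powR_ge0// invr_ge0 ltW.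
  have h2 : s^-1 * (1 - x) `^ s <= s^-1.
    rewrite -[leRHS]mulr1 ler_pM2l ?invr_gt0//.
    by rewrite -[leRHS](powRr0 (1 - x)) ger_powR ?(ltW s0)//; lra.
  lra.
Qed.

Lemma is_derive_powRx (s x : R) : 0 < x ->
  is_derive x 1 (fun y => y `^ s) (s * x `^ (s - 1)).
Proof. by move=> x0; exact: is_derive1_powR. Qed.

(** One majorant serves both ends: x^(s-1) / (1 + x^s)^2 has the bounded antiderivative -1 / (s (1 +
    x^s)), and (1 + x^s)^2 e^(-a x) <= 2 (1 + K), where K bounds x^(2s) e^(-a x). *)
Lemma gamma_integrable (s a : R) : 0 < s -> 0 < a ->
  mu.-integrable `]0, +oo[ (EFin \o (fun x => x `^ (s - 1) * expR (- (a * x)))).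
Proof.
move=> s0 a0.
have s2 : 0 <= s * 2 by rewrite mulr_ge0// ltW.
have [K K0 HK] := powR_expR_bound s2 a0.
pose h x : R := 1 + x `^ s.
have h0 x : 0 < h x by rewrite ltr_pwDl// powR_ge0.
have dh (x : R) : 0 < x -> is_derive x 1 h (s * x `^ (s - 1)).
  move=> x0; have H := is_derive_fD (is_derive_fcst 1 x) (is_derive_powRx s x0).
  apply: (is_derive_as H).
  by rewrite add0r.
have dVh (x : R) : 0 < x -> is_derive x 1 (fun y => (h y)^-1) (- (h x) ^- 2 * (s * x `^ (s - 1))).
  by move=> x0; apply: is_deriveV; [rewrite gt_eqF|exact: dh].
pose f x := x `^ (s - 1) * ((h x)^-1 * (h x)^-1).
have fi : mu.-integrable `]0, +oo[ (EFin \o f).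
  apply: (@ge0_integrable_pos R (fun x => - s^-1 * (h x)^-1) f _ _ s^-1).
  - move=> x x0; apply: (is_derive_as (is_derive_fZ _ (dVh x x0))).
    rewrite /f; move: (h x) (h0 x) (x `^ (s - 1)) => y y0 z.
    by field; rewrite !gt_eqF.
  - move=> x x0.
    exact: (is_derive_derivable (is_derive_fM (is_derive_powRx _ x0) (is_derive_fM (dVh x x0)
      (dVh x x0)))).
  - by move=> x x0; rewrite /f !mulr_ge0 ?powR_ge0// invr_ge0 ltW.
  - move=> x y x0 y0; rewrite !mulNr opprK.
    have h1 : 0 <= s^-1 / h y by rewrite mulr_ge0// invr_ge0 ltW.
    have h2 : s^-1 / h x <= s^-1.
      rewrite -[leRHS]mulr1 ler_pM2l ?invr_gt0// invf_le1//.
      by rewrite /h lerDl powR_ge0.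
    lra.
apply: (@le_Rintegrable _ _ R mu _ _ (fun x => 2 * (1 + K) * f x)) => //.
- apply: measurable_funM; first exact: (measurable_funTS (measurable_powR _)).
  by apply: measurableT_comp => //; apply: measurableT_comp => //; exact: measurable_funM.
- move=> x /=; rewrite in_itv/= andbT => x0.
  rewrite ger0_norm ?mulr_ge0 ?powR_ge0 ?expR_ge0//.
  rewrite /f mulrCA ler_pM2l ?powR_gt0//.
  rewrite -expr2 exprVn ler_pdivlMr ?exprn_gt0//.
  have := HK x x0; rewrite powRrM powR_mulrn ?powR_ge0// /h.
  have : expR (- (a * x)) <= 1 by rewrite expR_le1 oppr_le0 mulr_ge0// ltW.
  have := expR_ge0 (- (a * x)).
  move: (expR _) (x `^ s) => e y e0 e1 yK.
  have : (1 + y) ^+ 2 <= 2 * (1 + y ^+ 2) by rewrite -subr_ge0 (_ : _ - _ =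
    (1 - y) ^+ 2) ?sqr_ge0//; ring.
  move=> hy; apply: (@le_trans _ _ (e * (2 * (1 + y ^+ 2)))); first exact: ler_wpM2l.
  lra.
- exact: RintegrableZl.
Qed.

End PowerBounds.

(** * Moments and smooth functions on the positive half-line *)

Section Moments.
Context {R : realType}.
Local Notation mu := (@lebesgue_measure R).
Variables (a b C eps : R) (p : R -> R).
Hypotheses (a0 : 0 < a) (b0 : 0 < b) (C0 : 0 <= C).
Hypothesis mp : measurable_fun (`]0, +oo[%classic : set R) p.
Hypothesis pC : forall x : R, 0 < x -> `|p x| <= C * x `^ eps.

(** Up to the factor b^j, the j-th derivative in t of x^(bt-1) e^(-a x): each differentiation raises
    the power of the logarithm by one. *)
Definition moment_kernel (j : nat) (t x : R) : R :=
  ln x ^+ j * x `^ (b * t - 1) * expR (- (a * x)).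

Definition moment (j : nat) (t : R) : R :=
  \int[mu]_(x in `]0, +oo[) (p x * moment_kernel j t x).

Lemma measurable_moment_kernel j t (D : set R) : measurable_fun D (moment_kernel j t).
Proof.
apply: measurable_funM; first apply: measurable_funM.
- by apply: (measurable_funX j); exact: (measurable_funTS (@measurable_ln R)).
- exact: (measurable_funTS (@measurable_powR R _)).
- apply: (measurableT_comp (@measurable_expR R)) => //.
  by apply: (measurableT_comp (@oppr_measurable R _)) => //; exact: measurable_funM.
Qed.

(** For t in [L, U] the power x^(bt-1) lies below the sum of its two extreme values, and the
    logarithms cost x^eta + x^(-eta). Taking eta as half of eps + b L leaves the smallest gamma
    exponent, eps - eta + b L = eta, positive. When eps > 0 the choice L = 0 is allowed. *)
Lemma moment_dominated j (L U : R) : 0 < eps + b * L -> L <= U ->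
  exists D : R -> R, [/\ mu.-integrable `]0, +oo[ (EFin \o D), forall x, 0 <= D x &
    forall t x : R, L <= t -> t <= U -> 0 < x -> `|p x * moment_kernel j t x| <= D x].
Proof.
move=> L0 LU; pose eta := (eps + b * L) / 2.
have eta0 : 0 < eta by rewrite divr_gt0.
have [K K0 HK] := norm_ln_expr_bound j eta0.
pose w s x := x `^ (s - 1) * expR (- (a * x)).
have w0 s x : 0 <= w s x by rewrite mulr_ge0 ?powR_ge0 ?expR_ge0.
have bLU : b * L <= b * U by rewrite ler_wpM2l// ltW.
have etaE : eps + b * L = 2 * eta by rewrite /eta; lra.
have wi s : eta <= s -> mu.-integrable `]0, +oo[ (EFin \o w s).
  by move=> s_eta; apply: gamma_integrable => //; exact: lt_le_trans s_eta.
pose D x := C * K * (w (eps + eta + b * L) x + w (eps + eta + b * U) x +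
  (w (eps - eta + b * L) x + w (eps - eta + b * U) x)).
exists D; split.
- by apply: RintegrableZl => //; do !apply: RintegrableD => //; apply: wi; lra.
- by move=> x; rewrite /D !mulr_ge0// !addr_ge0.
- move=> t x Lt tU x0.
  have bLt : b * L <= b * t by rewrite ler_wpM2l// ltW.
  have btU : b * t <= b * U by rewrite ler_wpM2l// ltW.
  have px := pC x0; have lnx := HK x x0.
  have xt : x `^ (b * t - 1) <= x `^ (b * L - 1) + x `^ (b * U - 1).
    by apply: powR_between => //; lra.
  have wE s r : x `^ eps * x `^ s * x `^ (r - 1) * expR (- (a * x)) = w (eps + s + r) x.
    rewrite /w -!powRD; last 2 first.
    + by rewrite (gt_eqF x0) implybT.
    + by rewrite (gt_eqF x0) implybT.
    by congr (_ `^ _ * _); ring.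
  have -> : D x = (C * x `^ eps) * ((K * (x `^ eta + x `^ (- eta))) *
      (x `^ (b * L - 1) + x `^ (b * U - 1)) * expR (- (a * x))).
    by rewrite /D -!wE; ring.
  rewrite normrM; apply: ler_pM => //.
  rewrite /moment_kernel !normrM normrX (ger0_norm (expR_ge0 _)) (ger0_norm (powR_ge0 _ _)).
  by rewrite ler_pM2r ?expR_gt0//; apply: ler_pM => //; rewrite ?exprn_ge0 ?powR_ge0.
Qed.

Lemma moment_integrable j t : 0 < eps + b * t ->
  mu.-integrable `]0, +oo[ (EFin \o (fun x => p x * moment_kernel j t x)).
Proof.
move=> t0; have [D [Di D0 HD]] := moment_dominated j t0 (lexx t).
apply: (@le_Rintegrable _ _ R mu _ _ D) => //.
  by apply: measurable_funM => //; exact: measurable_moment_kernel.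
by move=> x /=; rewrite in_itv/= andbT => x0; exact: HD.
Qed.

Lemma is_derive_moment_kernel j (t x : R) : 0 < x ->
  is_derive t 1 (fun s => moment_kernel j s x) (b * moment_kernel j.+1 t x).
Proof.
move=> x0.
have d1 : is_derive t 1 (fun s : R => ln x * b * s + - ln x) (ln x * b) by exact: is_derive_affine.
have d2 := is_derive_fcomp (f := @expR R) (g := fun s : R => ln x * b * s + - ln x)
  (is_derive_expR _) d1.
have d3 := is_derive_fZ (ln x ^+ j * expR (- (a * x))) d2.
have -> : (fun s => moment_kernel j s x) =
    (fun s => ln x ^+ j * expR (- (a * x)) * expR (ln x * b * s + - ln x)).
  apply/funext => s; rewrite /moment_kernel powR_expRE// mulrAC.
  by congr (_ * expR _); ring.
apply: (is_derive_as d3); rewrite /moment_kernel powR_expRE//.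
by rewrite (_ : ln x * b * t + - ln x = (b * t - 1) * ln x); [rewrite exprS|]; ring.
Qed.

Lemma is_derive_moment j t : 0 < eps + b * t ->
  is_derive t 1 (moment j) (b * moment j.+1 t).
Proof.
(* Half of the margin is given up: eps + b L = (eps + b t) / 2 is still positive and t is interior
   to the interval from L to t + 1. *)
move=> t0; pose L := t - (eps + b * t) / (2 * b).
have L0 : 0 < eps + b * L.
  rewrite (_ : _ + _ = (eps + b * t) / 2); first by rewrite divr_gt0.
  by rewrite /L; field; rewrite gt_eqF.
have Lt : L < t by rewrite /L ltrBlDr ltrDl divr_gt0// mulr_gt0.
have LU : L <= t + 1 by lra.
have [D [Di D0 HD]] := moment_dominated j.+1 L0 LU.
pose f s x := p x * moment_kernel j s x.
have mD : measurable (`]0, +oo[%classic : set (measurableTypeR R)) by [].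
have tI : `]L, (t + 1)[%classic t by rewrite /= in_itv/= Lt ltrDl ltr01.
have df (s x : R) : 0 < x -> is_derive s 1 (f ^~ x) (b * (p x * moment_kernel j.+1 s x)).
  move=> x0; apply: (is_derive_as (is_derive_fZ (p x) (is_derive_moment_kernel j s x0))).
  by rewrite mulrCA.
have d1f (s x : R) : 0 < x -> partial1of2 f s x = b * (p x * moment_kernel j.+1 s x).
  by move=> x0; rewrite partial1of2E; have [_ ->] := df s x x0.
have intf (s : R) : `]L, (t + 1)[%classic s -> mu.-integrable `]0, +oo[ (EFin \o f s).
  rewrite /= in_itv/= => /andP[Ls _]; apply: moment_integrable.
  by rewrite (lt_trans L0)// ltrD2l ltr_pM2l.
have der (s x : R) : `]L, (t + 1)[%classic s -> `]0, +oo[%classic x -> derivable (f ^~ x) s 1.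
  by rewrite /= !in_itv/= andbT => _ x0; exact: (is_derive_derivable (df s x x0)).
pose G x := b * D x.
have G0 x : 0 <= G x by rewrite mulr_ge0// ltW.
have iG : mu.-integrable `]0, +oo[ (EFin \o G) by exact: RintegrableZl.
have Gub (s x : R) : `]L, (t + 1)[%classic s -> `]0, +oo[%classic x -> `|partial1of2 f s x| <= G x.
  rewrite /= !in_itv/= andbT => /andP[Ls sU] x0.
  by rewrite d1f// normrM gtr0_norm// ler_pM2l// HD// ltW.
apply: DeriveDef.
  exact: (derivable_under_integral mD tI intf der G0 iG Gub).
rewrite -derive1E (differentiation_under_integral mD tI intf der G0 iG Gub).
rewrite -RintegralZl//; last exact: moment_integrable.
by apply: eq_Rintegral => x; rewrite inE/= in_itv/= andbT => x0; exact: d1f.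
Qed.

Lemma moment_bounded j (L U : R) : 0 < eps + b * L ->
  exists K, forall t, L <= t -> t <= U -> `|moment j t| <= K.
Proof.
move=> L0; have [LU|LU] := leP L U; last first.
  by exists 0 => t Lt tU; have := lt_le_trans LU (le_trans Lt tU); rewrite ltxx.
have [D [Di D0 HD]] := moment_dominated j L0 LU.
exists (\int[mu]_(x in `]0, +oo[) D x) => t Lt tU.
have t0 : 0 < eps + b * t by rewrite (lt_le_trans L0)// lerD2l ler_pM2l.
apply: (le_trans (le_normr_Rintegral _ (moment_integrable _ t0))) => //.
apply: le_Rintegral => //; first exact: (integrable_norm (moment_integrable j t0)).
by move=> x /=; rewrite in_itv/= andbT => x0; exact: HD.
Qed.

End Moments.

(** * Functions smooth on (0, oo), with or without control at 0 *)

Section SmoothClass.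
Context {R : realType}.
Implicit Types (str : bool) (f g : R -> R) (c : R).

Definition bounded_on str f : Prop := forall L U : R,
  (if str then 0 <= L else 0 < L) ->
  exists K, forall t, 0 < t -> L <= t -> t <= U -> `|f t| <= K.

(* With [str] the derivatives up to order n are moreover bounded near 0. *)
Fixpoint Sm str (n : nat) f : Prop :=
  bounded_on str f /\
  if n is m.+1 then exists2 f', (forall x : R, 0 < x -> is_derive x 1 f (f' x)) & Sm str m f'
  else True.

Definition smooth str f := forall n, Sm str n f.

Lemma bounded_on_eq str f g : (forall x, 0 < x -> f x = g x) ->
  bounded_on str f -> bounded_on str g.
Proof.
move=> fg bf L U HL; have [K HK] := bf L U HL.
by exists K => t t0 Lt tU; rewrite -fg//; exact: HK.
Qed.

Lemma is_derive_eq_pos f g (x df : R) : (forall y, 0 < y -> f y = g y) -> 0 < x ->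
  is_derive x 1 f df -> is_derive x 1 g df.
Proof.
move=> fg x0; apply: near_eq_is_derive; near=> y; apply: fg.
near: y; exact: lt_nbhsr.
Unshelve. all: end_near. Qed.

Lemma Sm_eq str n f g : (forall x, 0 < x -> f x = g x) -> Sm str n f -> Sm str n g.
Proof.
case: n => [|n] fg /= [bf H]; (split; first exact: bounded_on_eq bf) => //.
by case: H => f' df Sf'; exists f' => // x x0; apply: (is_derive_eq_pos fg) => //; exact: df.
Qed.

Lemma SmS str n f : Sm str n.+1 f -> Sm str n f.
Proof.
elim: n f => [|n IH] f; first by case.
move=> [bf [f' df Sf']]; split=> //; exists f' => //; exact: IH.
Qed.

Lemma bounded_onD str f g : bounded_on str f -> bounded_on str g ->
  bounded_on str (fun x => f x + g x).
Proof.
move=> bf bg L U HL; have [K HK] := bf L U HL; have [M HM] := bg L U HL.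
by exists (K + M) => t t0 Lt tU; rewrite (le_trans (ler_normD _ _))// lerD// ?HK ?HM.
Qed.

Lemma bounded_onM str f g : bounded_on str f -> bounded_on str g ->
  bounded_on str (fun x => f x * g x).
Proof.
move=> bf bg L U HL; have [K HK] := bf L U HL; have [M HM] := bg L U HL.
by exists (K * M) => t t0 Lt tU; rewrite normrM ler_pM// ?HK ?HM.
Qed.

Lemma SmD str n f g : Sm str n f -> Sm str n g -> Sm str n (fun x => f x + g x).
Proof.
elim: n f g => [|n IH] f g [bf Hf] [bg Hg]; (split; first exact: bounded_onD) => //.
case: Hf => f' df Sf'; case: Hg => g' dg Sg'.
by exists (fun x => f' x + g' x); [move=> x x0; apply: is_derive_fD;
  [exact: df|exact: dg]|exact: IH].
Qed.

Lemma SmM str n f g : Sm str n f -> Sm str n g -> Sm str n (fun x => f x * g x).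
Proof.
elim: n f g => [|n IH] f g Sf Sg; move: (Sf) (Sg) => [bf Hf] [bg Hg];
  (split; first exact: bounded_onM) => //.
case: Hf => f' df Sf'; case: Hg => g' dg Sg'.
exists (fun x => f' x * g x + f x * g' x).
  by move=> x x0; apply: is_derive_fM; [exact: df|exact: dg].
by apply: SmD; apply: IH => //; exact: SmS.
Qed.

Lemma Sm_cst str n c : Sm str n (fun=> c).
Proof.
elim: n c => [|n IH] c; (split; first by move=> L U _; exists `|c|) => //.
by exists (fun=> 0) => // x x0; exact: is_derive_fcst.
Qed.

Lemma SmZ str n c f : Sm str n f -> Sm str n (fun x => c * f x).
Proof. by move=> Sf; apply: SmM => //; exact: Sm_cst. Qed.

Lemma bounded_on_id str : bounded_on str id.
Proof. by move=> L U _; exists U => t t0 _ tU; rewrite /= gtr0_norm. Qed.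

Lemma Sm_id str n : Sm str n id.
Proof.
case: n => [|n]; (split; first exact: bounded_on_id) => //.
by exists (fun=> 1); [move=> x _; exact: is_derive_id|exact: Sm_cst].
Qed.

(** The bound on 1/f is a separate hypothesis because f, though nonzero for x > 0, could tend to 0
    at the origin. The derivative -(1/f)^2 f' involves 1/f only to a lower order, which closes the
    induction. *)
Lemma SmV str n f : (forall x : R, 0 < x -> f x != 0) -> bounded_on str (fun x => (f x)^-1) ->
  Sm str n f -> Sm str n (fun x => (f x)^-1).
Proof.
move=> f0 bV; elim: n => [|n IH] Sf; split=> //.
case: (Sf) => _ [f' df Sf'].
exists (fun x => -1 * ((f x)^-1 * (f x)^-1) * f' x).
  move=> x x0; apply: (is_derive_as (is_deriveV (f0 x x0) (df x x0))).
  by rewrite /GRing.scale/= -exprVn expr2 mulN1r.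
by apply: SmM => //; apply: SmZ; have Sn := IH (SmS Sf); exact: SmM.
Qed.

Lemma smooth_eq str f g : (forall x, 0 < x -> f x = g x) -> smooth str f -> smooth str g.
Proof. by move=> fg Sf n; apply: Sm_eq fg _. Qed.

Lemma smoothD str f g : smooth str f -> smooth str g -> smooth str (fun x => f x + g x).
Proof. by move=> Sf Sg n; exact: SmD. Qed.

Lemma smoothM str f g : smooth str f -> smooth str g -> smooth str (fun x => f x * g x).
Proof. by move=> Sf Sg n; exact: SmM. Qed.

Lemma smoothZ str c f : smooth str f -> smooth str (fun x => c * f x).
Proof. by move=> Sf n; exact: SmZ. Qed.

Lemma smooth_cst str c : smooth str (fun=> c).
Proof. by move=> n; exact: Sm_cst. Qed.

Lemma smooth_id str : smooth str id.
Proof. by move=> n; exact: Sm_id. Qed.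

Lemma smoothV str f : (forall x : R, 0 < x -> f x != 0) -> bounded_on str (fun x => (f x)^-1) ->
  smooth str f -> smooth str (fun x => (f x)^-1).
Proof. by move=> f0 bV Sf n; exact: SmV. Qed.

Lemma smooth_bounded str f : smooth str f -> bounded_on str f.
Proof. by move=> /(_ 0%N) []. Qed.

Lemma smooth_derivable str f (x : R) : smooth str f -> 0 < x -> derivable f x 1.
Proof. by move=> /(_ 1%N) [_ [f' df _]] x0; exact: (is_derive_derivable (df x x0)). Qed.

Lemma smooth_is_derive str f (x : R) : smooth str f -> 0 < x -> is_derive x 1 f (derive1 f x).
Proof.
by move=> Sf x0; apply: DeriveDef; [exact: smooth_derivable x0|rewrite derive1E].
Qed.

Lemma smooth_derive1 str f : smooth str f -> smooth str (derive1 f).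
Proof.
move=> Sf n; have [_ [f' df Sf']] := Sf n.+1.
apply: Sm_eq Sf' => x x0; rewrite derive1E.
by have [_ ->] := df x x0.
Qed.

Lemma smooth_derive1n str f i : smooth str f -> smooth str (derive1n i f).
Proof. by move=> Sf; elim: i => [//|i IH]; exact: smooth_derive1. Qed.

Lemma smooth_weaken str f : smooth true f -> smooth str f.
Proof.
case: str => // Sf n; elim: n f Sf => [|n IH] f Sf.
  split=> // L U L0; apply: (smooth_bounded Sf); exact: ltW.
split; first by move=> L U L0; apply: (smooth_bounded Sf); exact: ltW.
exists (derive1 f); first by move=> x; exact: smooth_is_derive.
exact/IH/smooth_derive1.
Qed.

(** Moments, kernels, exponentials and beta averages all form chains in which each member
    differentiates to a multiple of the next, so that mere bounds on the members give smoothness. *)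
Lemma smooth_family str (F : nat -> R -> R) c :
  (forall i, bounded_on str (F i)) ->
  (forall i (x : R), 0 < x -> is_derive x 1 (F i) (c * F i.+1 x)) ->
  forall i, smooth str (F i).
Proof.
move=> bF dF i n; elim: n i => [|n IH] i; split=> //.
by exists (fun x => c * F i.+1 x); [exact: dF|exact: SmZ].
Qed.

Lemma derive1_eq_pos f g (x : R) : (forall y, 0 < y -> f y = g y) -> 0 < x ->
  derive1 f x = derive1 g x.
Proof.
move=> fg x0; rewrite !derive1E; apply: near_eq_derive; near=> y; apply: fg.
near: y; exact: lt_nbhsr.
Unshelve. all: end_near. Qed.

Lemma derive1n_eq_pos i f g (x : R) : (forall y, 0 < y -> f y = g y) -> 0 < x ->
  derive1n i f x = derive1n i g x.
Proof.
by move=> fg; elim: i x => [|i IH] x x0; [exact: fg|exact: derive1_eq_pos].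
Qed.

Lemma smooth_derive1nD str i f g (x : R) : smooth str f -> smooth str g -> 0 < x ->
  derive1n i (fun y => f y + g y) x = derive1n i f x + derive1n i g x.
Proof.
move=> Sf Sg; elim: i x => [//|i IH] x x0.
rewrite !derive1nS (derive1_eq_pos IH)// derive1E.
by have [_ ->] := is_derive_fD (smooth_is_derive (smooth_derive1n i Sf) x0)
  (smooth_is_derive (smooth_derive1n i Sg) x0).
Qed.

Lemma smooth_derive1nZ str i c f (x : R) : smooth str f -> 0 < x ->
  derive1n i (fun y => c * f y) x = c * derive1n i f x.
Proof.
move=> Sf; elim: i x => [//|i IH] x x0.
rewrite !derive1nS (derive1_eq_pos IH)// derive1E.
by have [_ ->] := is_derive_fZ c (smooth_is_derive (smooth_derive1n i Sf) x0).
Qed.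

Lemma smooth_derive1M str f g (x : R) : smooth str f -> smooth str g -> 0 < x ->
  derive1 (fun y => f y * g y) x = derive1 f x * g x + f x * derive1 g x.
Proof.
move=> Sf Sg x0; rewrite derive1E.
by have [_ ->] := is_derive_fM (smooth_is_derive Sf x0) (smooth_is_derive Sg x0).
Qed.

Lemma smooth_n_derivable str m f : smooth str f -> n_derivable_pos m f.
Proof. by move=> Sf i x _ x0; apply: smooth_derivable x0; exact: smooth_derive1n. Qed.

Lemma smooth_continuous str f (x : R) : smooth str f -> 0 < x -> {for x, continuous f}.
Proof.
by move=> Sf x0; exact/differentiable_continuous/derivable1_diffP/(smooth_derivable Sf).
Qed.

Lemma smooth_measurable str f : smooth str f ->
  measurable_fun (`]0, +oo[%classic : set R) f.
Proof.
move=> Sf; apply: open_continuous_measurable_fun => // x.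
by rewrite inE/= in_itv/= andbT; exact: smooth_continuous.
Qed.

End SmoothClass.

(** * The gamma function *)

Section GammaFunction.
Context {R : realType}.
Local Notation mu := (@lebesgue_measure R).
Implicit Types (a b s t x y : R).

(** Domination on [L, U] requires eps + b L > 0. Bounds down to L = 0 thus force eps > 0, which is
    the condition attached to [str]. *)
Lemma smooth_moment a b C eps (p : R -> R) (str : bool) j :
  0 < a -> 0 < b -> 0 <= C -> 0 <= eps -> (str -> 0 < eps) ->
  measurable_fun (`]0, +oo[%classic : set R) p ->
  (forall x : R, 0 < x -> `|p x| <= C * x `^ eps) ->
  smooth str (moment a b p j).
Proof.
move=> a0 b0 C0 e0 se mp pC.
apply: (smooth_family (F := moment a b p) (c := b)) => [i L U HL|i x x0].
  have L0 : 0 < eps + b * L.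
    case: str se HL => [/(_ isT) e1|_] HL; first by rewrite ltr_pwDl// mulr_ge0// ltW.
    by rewrite ltr_wpDl// mulr_gt0.
  have [K HK] := moment_bounded a0 b0 C0 mp pC i U L0.
  by exists K => t _; exact: HK.
by apply: (is_derive_moment a0 b0 C0 mp pC); rewrite ltr_wpDl// mulr_gt0.
Qed.

Lemma Gamma_moment b t : Gamma (b * t) = moment 1 b (fun=> 1) 0 t.
Proof.
apply: eq_Rintegral => x _; rewrite /moment_kernel expr0 !mul1r.
by [].
Qed.

Lemma GammaS_moment b t : Gamma (b * t + 1) = moment 1 b id 0 t.
Proof.
apply: eq_Rintegral => x; rewrite inE/= in_itv/= andbT => x0.
rewrite /moment_kernel expr0 !mul1r mulrA; congr (_ * _).
by rewrite addrK powRB ?powRr1 ?ltW// ?(gt_eqF x0) ?implybT// mulrCA divff ?mulr1// gt_eqF.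
Qed.

Lemma smooth_Gamma b : 0 < b -> smooth false (fun t => Gamma (b * t)).
Proof.
move=> b0; rewrite (_ : (fun _ => _) = moment 1 b (fun=> 1) 0); last first.
  by apply/funext => t; exact: Gamma_moment.
apply: (@smooth_moment _ _ 1 0) => // x x0.
by rewrite powRr0 mulr1 normr1.
Qed.

(** The extra factor x in the integrand acts as a weight with eps = 1, which gives control down to t
    = 0; Gamma (b t) itself blows up there. *)
Lemma smooth_GammaS b : 0 < b -> smooth true (fun t => Gamma (b * t + 1)).
Proof.
move=> b0; rewrite (_ : (fun _ => _) = moment 1 b id 0); last first.
  by apply/funext => t; exact: GammaS_moment.
apply: (@smooth_moment _ _ 1 1) => // x x0.
by rewrite powRr1 ?(ltW x0)// mul1r /= gtr0_norm.
Qed.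

Lemma derivable_Gamma x : 0 < x -> derivable (@Gamma R) x 1.
Proof.
move=> x0; have -> : @Gamma R = (fun t => Gamma (1 * t)) by apply/funext => t; rewrite mul1r.
exact: (smooth_derivable (smooth_Gamma ltr01)).
Qed.

Lemma gamma_integrand_integrable s : 0 < s ->
  mu.-integrable `]0, +oo[ (EFin \o (fun x => x `^ (s - 1) * expR (- x))).
Proof.
move=> s0; have := gamma_integrable s0 (@ltr01 R).
rewrite (_ : (fun x => _ * expR (- (1 * x))) = (fun x => x `^ (s - 1) * expR (- x)))//.
by apply/funext => x; rewrite mul1r.
Qed.

Lemma powR_expR_cvg0 y : 0 <= y -> x `^ y * expR (- x) @[x --> +oo] --> 0.
Proof.
move=> y0; have h2 : 0 < (2^-1 : R) by rewrite invr_gt0.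
have [K K0 HK] := powR_expR_bound y0 h2.
have : K * expR (- (2^-1 * x)) @[x --> +oo] --> K * 0.
  apply: cvgM; first exact: cvg_cst.
  apply: (@cvg_comp _ _ _ (fun x : R => 2^-1 * x) (fun z => expR (- z)) _ (+oo%R));
    last exact: cvgr_expR.
  by apply: (gt0_cvgMry (f := fun x : R => x)) => //; exact: cvg_id.
rewrite mulr0; apply: squeeze_cvgr; last exact: cvg_cst.
near=> x; rewrite mulr_ge0 ?powR_ge0 ?expR_ge0//=.
have -> : expR (- x) = expR (- (2^-1 * x)) * expR (- (2^-1 * x)).
  by rewrite -expRD; congr expR; lra.
by rewrite mulrA ler_wpM2r ?expR_ge0// HK.
Unshelve. all: end_near. Qed.

(** Integration by parts in the form: the derivative of -x^s e^(-x) integrates to zero over (0, oo),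
    since this function vanishes at both ends. *)
Lemma GammaS s : 0 < s -> Gamma (s + 1) = s * Gamma s.
Proof.
move=> s0; pose F x := - (x `^ s * expR (- x)).
pose f x := x `^ (s + 1 - 1) * expR (- x) + - s * (x `^ (s - 1) * expR (- x)).
have s10 : 0 < s + 1 by rewrite addr_gt0.
have dexp x : is_derive x 1 (fun z : R => expR (- z)) (- expR (- x)).
  apply: (is_derive_as (is_derive_fcomp (f := @expR R) (g := fun z : R => - z)
    (is_derive_expR _) (is_deriveNid x 1))).
  by rewrite mulrN1.
have dpe r x : 0 < x -> is_derive x 1 (fun z : R => z `^ r * expR (- z))
    (r * x `^ (r - 1) * expR (- x) + x `^ r * - expR (- x)).
  by move=> x0; exact: (is_derive_fM (is_derive_powRx r x0) (dexp x)).
have i1 := gamma_integrand_integrable s10.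
have i2 := gamma_integrand_integrable s0.
have fi : mu.-integrable `]0, +oo[ (EFin \o f).
  by apply: RintegrableD => //; exact: RintegrableZl.
have dF x : 0 < x -> is_derive x 1 F (f x).
  move=> x0; have H := is_derive_fZ (-1) (dpe s x x0).
  have -> : F = (fun z => -1 * (z `^ s * expR (- z))) by apply/funext => z; rewrite mulN1r.
  by apply: (is_derive_as H); rewrite /f addrK; ring.
have df x : 0 < x -> derivable f x 1.
  move=> x0; have H := is_derive_fD (dpe (s + 1 - 1) x x0) (is_derive_fZ (- s) (dpe (s - 1) x x0)).
  exact: (is_derive_derivable H).
have F0 : F x @[x --> 0^'+] --> 0.
  have e0 : expR (- x) @[x --> (0 : R)^'+] --> expR (- (0 : R)).
    have c0 : {for (0 : R), continuous (fun x : R => expR (- x))}.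
      exact/differentiable_continuous/derivable1_diffP/(is_derive_derivable (dexp 0)).
    exact: cvg_at_right_filter c0.
  have := cvgN (cvgM (powR_cvg0 s0) e0).
  by rewrite mul0r oppr0 => H; exact: H.
have Foo : F x @[x --> +oo] --> 0.
  by rewrite -oppr0; apply: cvgN; apply: powR_expR_cvg0; exact: ltW.
have := FTC_pos dF df fi F0 Foo; rewrite subrr.
rewrite RintegralD//; last exact: RintegrableZl.
rewrite RintegralZl// => /eqP; rewrite mulNr subr_eq0 => /eqP.
by [].
Qed.

(** On [1, 2] the integrand is at least e^(-2) whatever s >= 0. Being uniform in s, the bound keeps
    1 / Gamma (b t + 1) bounded near t = 0. *)
Lemma GammaS_lb s : 0 <= s -> expR (- 2) <= Gamma (s + 1).
Proof.
move=> s0; have s10 : 0 < s + 1 by rewrite ltr_wpDl.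
have gi := gamma_integrand_integrable s10.
have sub : `[1, 2]%classic `<=` (`]0, +oo[%classic : set R).
  by move=> x /=; rewrite !in_itv/= andbT => /andP[x1 _]; exact: lt_le_trans x1.
have <- : \int[mu]_(x in `[1, 2]) (cst (expR (- 2)) x) = expR (- 2) :> R.
  rewrite Rintegral_cst//= lebesgue_measure_itv/= lte_fin ltr1n/=.
  by rewrite (_ : 2 - 1 = 1) ?mulr1//; lra.
have gi12 : mu.-integrable `[1, 2] (EFin \o (fun x => x `^ (s + 1 - 1) * expR (- x))).
  by apply: integrableS gi.
have lb x : `[1, 2]%classic x -> expR (- 2) <= x `^ (s + 1 - 1) * expR (- x).
  rewrite /= in_itv/= => /andP[x1 x2].
  rewrite -[leLHS]mul1r; apply: ler_pM => //; rewrite ?expR_ge0//.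
    by rewrite addrK -(powRr0 x) ler_powR.
  by rewrite ler_expR lerN2.
apply: (@le_trans _ _ (\int[mu]_(x in `[1, 2]) (x `^ (s + 1 - 1) * expR (- x)))).
  apply: le_Rintegral => //; apply: le_Rintegrable gi12 => // x x12.
  by rewrite /= ger0_norm ?expR_ge0//; exact: lb.
rewrite /Gamma /Rintegral fine_le//; try exact: integrable_fin_num.
apply: ge0_subset_integral => //.
- by have /integrableP[] := gi.
- by move=> x _; rewrite lee_fin mulr_ge0 ?powR_ge0 ?expR_ge0.
Qed.

Lemma Gamma_gt0 s : 0 < s -> 0 < Gamma s.
Proof.
move=> s0; have := lt_le_trans (expR_gt0 _) (GammaS_lb (ltW s0)).
by rewrite GammaS// pmulr_rgt0.
Qed.

(** Logarithmic derivative of the functional equation; it isolates the pole of digamma at 0. *)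
Lemma digammaS s : 0 < s -> digamma (s + 1) = digamma s + s^-1.
Proof.
move=> s0; rewrite /digamma.
have s10 : 0 < s + 1 by rewrite addr_gt0.
have dG := derivable_Gamma s10.
have H1 : is_derive s 1 (fun t => Gamma (1 * t + 1)) (derive1 Gamma (s + 1) * 1).
  have dGs : is_derive (1 * s + 1) 1 (@Gamma R) (derive1 Gamma (s + 1)).
    by rewrite mul1r derive1E; exact: derivableP.
  exact: (is_derive_fcomp (g := fun t : R => 1 * t + 1) dGs (is_derive_affine 1 1 s)).
have H2 : is_derive s 1 (fun t : R => t * Gamma t) (1 * Gamma s + s * derive1 Gamma s).
  have dGs : is_derive s 1 (@Gamma R) (derive1 Gamma s).
    by rewrite derive1E; apply: derivableP; exact: derivable_Gamma.
  exact: (is_derive_fM (is_derive_id s 1) dGs).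
have H3 : is_derive s 1 (fun t => Gamma (1 * t + 1)) (1 * Gamma s + s * derive1 Gamma s).
  by apply: (is_derive_eq_pos _ s0 H2) => y y0; rewrite mul1r GammaS.
have E : derive1 Gamma (s + 1) = Gamma s + s * derive1 Gamma s.
  have [_] := H1; have [_ ->] := H3; rewrite mulr1 mul1r => <-//.
rewrite E GammaS//; field.
by rewrite !gt_eqF ?Gamma_gt0.
Qed.

End GammaFunction.

Lemma is_derive_derive1 {R : realType} (f : R -> R) (x df : R) :
  is_derive x 1 f df -> derive1 f x = df.
Proof. by move=> [_ <-]; rewrite derive1E. Qed.

Section Leibniz.
Context {R : realType}.

(* A Leibniz expansion whose coefficients do not depend on the family [h]:
   applied with the same coefficients to a kernel and to its integrals, it
   lets the derivatives of order N pass under the integral sign. *)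
Lemma leibniz_expansion (str : bool) (beta : R) (N : nat) (Psi : R -> R) :
  smooth str Psi -> exists c : nat -> R -> R, (forall i, smooth str (c i)) /\
  forall h : nat -> R -> R, (forall i, smooth false (h i)) ->
    (forall i (x : R), 0 < x -> derive1 (h i) x = beta * h i.+1 x) ->
    forall t : R, 0 < t ->
    derive1n N (fun y => Psi y * h 0%N y) t = \sum_(i < N.+1) c i t * h i t.
Proof.
have weak (f : R -> R) : smooth str f -> smooth false f by case: (str) => //; exact: smooth_weaken.
elim: N Psi => [|N IH] Psi SP.
  by exists (fun=> Psi); split => // h _ _ t _; rewrite big_ord1.
have [c [Sc Hc]] := IH (derive1 Psi) (smooth_derive1 SP).
have [c' [Sc' Hc']] := IH Psi SP.
(* The first derivative is Psi' h_0 + beta Psi h_1. The first term uses the expansion for Psi', the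
   second the expansion for Psi along the shifted family, which moves its coefficients up by one
   index. *)
pose d i : R -> R := fun t =>
  (if (i < N.+1)%N then c i t else 0) + (if i is j.+1 then beta * c' j t else 0).
exists d; split.
  move=> i; apply: smoothD; first by case: ltnP => _ //; exact: smooth_cst.
  by case: i => [|j]; [exact: smooth_cst|exact: smoothZ].
move=> h Sh dh t t0; rewrite derive1Sn.
have E y : 0 < y -> derive1 (fun y => Psi y * h 0%N y) y =
    derive1 Psi y * h 0%N y + beta * (Psi y * h 1%N y).
  by move=> y0; rewrite (smooth_derive1M (weak _ SP) (Sh 0%N) y0) dh// mulrCA.
rewrite (derive1n_eq_pos N E t0).
have SP' : smooth false (derive1 Psi) by exact/weak/smooth_derive1.
have S1 : smooth false (fun y => Psi y * h 1%N y) by apply: smoothM => //; exact: weak.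
rewrite (smooth_derive1nD N (smoothM SP' (Sh 0%N)) (smoothZ beta S1) t0).
rewrite (smooth_derive1nZ N beta S1 t0) Hc//.
rewrite (Hc' (fun i => h i.+1) (fun i => Sh i.+1) (fun i => dh i.+1) t t0).
under [RHS]eq_bigr do rewrite mulrDl.
rewrite big_split/=; congr (_ + _).
  rewrite [in RHS]big_ord_recr ifF ?ltnn// mul0r /= addr0; apply: eq_bigr => i _.
  by rewrite ifT.
rewrite [in RHS]big_ord_recl/= mul0r add0r mulr_sumr.
by apply: eq_bigr => i _; rewrite mulrA.
Qed.

End Leibniz.

(** * The gamma density as a function of time *)

Section GammaDensity.
Context {R : realType}.
Local Notation mu := (@lebesgue_measure R).
Variables (a b : R).
Hypotheses (a0 : 0 < a) (b0 : 0 < b).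

Definition norm_const (t : R) : R := a `^ (b * t) / Gamma (b * t).
Definition norm_constS (t : R) : R := a `^ (b * t) / Gamma (b * t + 1).

Lemma gamma_densityE x t :
  gamma_density a b x t = norm_const t * moment_kernel a b 0 t x.
Proof. by rewrite /gamma_density /moment_kernel expr0 mul1r mulrA. Qed.

(** [norm_constS] is regular at 0, so all the singular behaviour is in the explicit factor t. *)
Lemma norm_constE t : 0 < t -> norm_const t = b * (t * norm_constS t).
Proof.
move=> t0; have bt : 0 < b * t by rewrite mulr_gt0.
rewrite /norm_const /norm_constS GammaS//.
by field; rewrite !gt_eqF// Gamma_gt0.
Qed.

Lemma smooth_norm_constS : smooth true norm_constS.
Proof.
apply: smoothM.
  have -> : (fun t => a `^ (b * t)) = (fun t => expR (b * ln a * t + 0)).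
    by apply/funext => t; rewrite powR_expRE// addr0 mulrAC.
  pose c := b * ln a.
  apply: (smooth_family (F := fun=> fun t => expR (c * t + 0)) (c := c) _ _ 0%N).
    move=> _ L U L0; exists (expR (`|c| * U)) => t t0 _ tU.
    rewrite ger0_norm ?expR_ge0// ler_expR addr0.
    apply: (le_trans (ler_norm _)); rewrite normrM (gtr0_norm t0).
    exact: ler_wpM2l.
  move=> _ x x0; rewrite mulrC.
  exact: (is_derive_fcomp (f := @expR R) (g := fun t => c * t + 0)
    (is_derive_expR _) (is_derive_affine c 0 x)).
have G0 (x : R) : 0 < x -> 0 < Gamma (b * x + 1).
  by move=> x0; rewrite Gamma_gt0// ltr_wpDl// mulr_ge0// ltW.
apply: smoothV; last exact: smooth_GammaS.
  by move=> x x0; rewrite gt_eqF// G0.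
move=> L U L0; exists (expR (- 2))^-1 => t t0 _ _.
rewrite gtr0_norm ?invr_gt0 ?G0// lef_pV2 ?posrE ?expR_gt0 ?G0//.
by rewrite GammaS_lb// mulr_ge0// ltW.
Qed.

Lemma smooth_norm_const : smooth true norm_const.
Proof.
apply: (@smooth_eq _ _ (fun t => b * (t * norm_constS t))).
  by move=> t t0; rewrite norm_constE.
apply: smoothZ; apply: smoothM; first exact: smooth_id.
exact: smooth_norm_constS.
Qed.

(** Up to the factor 1/b this is the logarithmic derivative of t |-> Gamma (b t + 1), which is
    smooth down to 0 and bounded away from zero. *)
Lemma smooth_digammaS : smooth true (fun t => digamma (b * t + 1)).
Proof.
have G0 (x : R) : 0 < x -> 0 < Gamma (b * x + 1).
  by move=> x0; rewrite Gamma_gt0// ltr_wpDl// mulr_ge0// ltW.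
pose G t := Gamma (b * t + 1).
apply: (@smooth_eq _ _ (fun t => b^-1 * (derive1 G t * (G t)^-1))).
  move=> t t0; rewrite /digamma.
  have bt : 0 < b * t + 1 by rewrite ltr_wpDl// mulr_ge0// ltW.
  have dG : is_derive (b * t + 1) 1 (@Gamma R) (derive1 Gamma (b * t + 1)).
    by rewrite derive1E; apply: derivableP; exact: derivable_Gamma.
  have H : is_derive t 1 G _ := is_derive_fcomp (g := fun t => b * t + 1) dG
    (is_derive_affine b 1 t).
  have -> : derive1 G t = derive1 Gamma (b * t + 1) * b by exact: (is_derive_derive1 H).
  by rewrite /G; field; rewrite !gt_eqF// G0.
apply: smoothZ; apply: smoothM; first exact/smooth_derive1/smooth_GammaS.
apply: smoothV; last exact: smooth_GammaS.
  by move=> x x0; rewrite gt_eqF// G0.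
move=> L U L0; exists (expR (- 2))^-1 => t t0 _ _.
rewrite gtr0_norm ?invr_gt0 ?G0// lef_pV2 ?posrE ?expR_gt0 ?G0//.
by rewrite GammaS_lb// mulr_ge0// ltW.
Qed.

Lemma derive1_norm_const t : 0 < t ->
  derive1 norm_const t = b * (ln a - digamma (b * t)) * norm_const t.
Proof.
move=> t0; have bt : 0 < b * t by rewrite mulr_gt0.
have bt0 : 0 < b * t + 0 by rewrite addr0.
have Gn : Gamma (b * t + 0) != 0 by rewrite gt_eqF// Gamma_gt0.
have dG : is_derive (b * t + 0) 1 (@Gamma R) (derive1 Gamma (b * t + 0)).
  by rewrite derive1E; apply: derivableP; exact: derivable_Gamma.
have H1 := is_derive_fcomp (g := fun t => b * t + 0) dG (is_derive_affine b 0 t).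
have H2 := is_deriveV (f := fun t => Gamma (b * t + 0)) Gn H1.
have H3 := is_derive_fcomp (f := @expR R) (g := fun t => b * ln a * t + 0)
    (is_derive_expR _) (is_derive_affine (b * ln a) 0 t).
have H4 := is_derive_fM H3 H2.
have E (y : R) : 0 < y -> expR (b * ln a * y + 0) * (Gamma (b * y + 0))^-1 = norm_const y.
  by move=> y0; rewrite /norm_const !addr0 powR_expRE// [b * y * _]mulrAC.
rewrite -(derive1_eq_pos E t0) (is_derive_derive1 H4).
rewrite /norm_const powR_expRE// /digamma /GRing.scale/= !addr0 (mulrAC b).
have G0 := Gamma_gt0 bt; field.
by rewrite gt_eqF.
Qed.

Lemma smooth_moment_kernel j x : 0 < x -> smooth true (fun t => moment_kernel a b j t x).
Proof.
move=> x0; apply: (smooth_family (F := fun j t => moment_kernel a b j t x) (c := b)).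
  move=> i L U L0.
  exists (`|ln x| ^+ i * (x `^ (b * 0 - 1) + x `^ (b * U - 1)) * expR (- (a * x))).
  move=> t t0 _ tU; rewrite /moment_kernel !normrM normrX.
  rewrite (ger0_norm (expR_ge0 _)) (ger0_norm (powR_ge0 _ _)).
  rewrite ler_pM2r ?expR_gt0// ler_wpM2l// ?exprn_ge0//.
  by apply: powR_between => //; rewrite lerB// ler_wpM2l// ltW.
by move=> i t _; exact: is_derive_moment_kernel.
Qed.

Lemma derive1_moment_kernel j x t : 0 < x ->
  derive1 (fun s => moment_kernel a b j s x) t = b * moment_kernel a b j.+1 t x.
Proof. by move=> x0; rewrite derive1E; have [_ ->] := is_derive_moment_kernel a b j t x0. Qed.

Lemma smooth_gamma_density x : 0 < x -> smooth true (gamma_density a b x).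
Proof.
move=> x0; rewrite (_ : gamma_density a b x = fun t => norm_const t * moment_kernel a b 0 t x).
  by apply: smoothM; [exact: smooth_norm_const|exact: smooth_moment_kernel].
by apply/funext => t; exact: gamma_densityE.
Qed.

End GammaDensity.

(** * Riemann-Liouville integrals *)

Section BetaAverage.
Context {R : realType}.
Local Notation mu := (@lebesgue_measure R).
Variable th : R.
Implicit Types (f : R -> R) (s t u v x K : R).
Hypothesis th1 : th < 1.

(** The power of 1 - v is the fractional kernel after s = t v; v^i is what the chain rule produces
    in i derivatives of f (t v) in t. *)
Definition beta_weight (i : nat) (v : R) : R := v ^+ i * (1 - v) `^ (- th).

(* [beta_avg i f] is the i-th derivative of [beta_avg 0 f]. *)
Definition beta_avg (i : nat) (f : R -> R) (t : R) : R :=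
  \int[mu]_(v in `]0, 1[) (derive1n i f (t * v) * beta_weight i v).

Lemma one_sub_powR_integrable :
  mu.-integrable `]0, 1[ (EFin \o (fun v => (1 - v) `^ (- th))).
Proof.
have s0 : 0 < 1 - th by rewrite subr_gt0.
have := powR_1B_integrable s0.
rewrite (_ : (fun v => (1 - v) `^ (1 - th - 1)) = (fun v => (1 - v) `^ (- th)))//.
by apply/funext => v; congr (_ `^ _); ring.
Qed.

Lemma measurable_one_sub_powR (r : R) (D : set R) : measurable_fun D (fun v => (1 - v) `^ r).
Proof.
apply: (measurableT_comp (@measurable_powR R _)); exact: measurable_funB.
Qed.

Lemma measurable_beta_weight i (D : set R) : measurable_fun D (beta_weight i).
Proof.
apply: measurable_funM; first exact: measurable_funX.
exact: measurable_one_sub_powR.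
Qed.

Lemma beta_weight_ge0 i v : 0 <= v -> 0 <= beta_weight i v.
Proof. by move=> v0; rewrite mulr_ge0 ?exprn_ge0 ?powR_ge0. Qed.

Lemma beta_weight_le i v : 0 <= v -> v <= 1 -> beta_weight i v <= (1 - v) `^ (- th).
Proof.
move=> v0 v1; rewrite -[leRHS]mul1r ler_wpM2r ?powR_ge0//.
by rewrite exprn_ile1.
Qed.

Lemma measurable_scaled (f : R -> R) t : 0 < t ->
  measurable_fun (`]0, +oo[%classic : set R) f ->
  measurable_fun (`]0, 1[%classic : set R) (fun v => f (t * v)).
Proof.
move=> t0 mf.
have mD : measurable (`]0, +oo[%classic : set R) by [].
apply: (measurable_comp mD _ mf) => //.
by move=> _ [v /= + <-]; rewrite !in_itv/= andbT => /andP[v0 _]; rewrite mulr_gt0.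
Qed.

Lemma weighted_integrable (f w : R -> R) (t K : R) : 0 < t ->
  measurable_fun (`]0, +oo[%classic : set R) f ->
  measurable_fun (`]0, 1[%classic : set R) w ->
  (forall s, 0 < s -> s <= t -> `|f s| <= K) ->
  (forall v, 0 < v -> v < 1 -> `|w v| <= (1 - v) `^ (- th)) ->
  mu.-integrable `]0, 1[ (EFin \o (fun v => f (t * v) * w v)).
Proof.
move=> t0 mf mw fK wb.
apply: (@le_Rintegrable _ _ R mu _ _ (fun v => K * (1 - v) `^ (- th))) => //.
- by apply: measurable_funM => //; exact: measurable_scaled.
- move=> v /=; rewrite in_itv/= => /andP[v0 v1].
  rewrite normrM; apply: ler_pM => //; last exact: wb.
  by apply: fK; rewrite ?mulr_gt0// ler_piMr// ltW.
- by apply: RintegrableZl => //; exact: one_sub_powR_integrable.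
Qed.

Lemma beta_weight_bound i v : 0 < v -> v < 1 -> `|beta_weight i v| <= (1 - v) `^ (- th).
Proof.
move=> v0 v1; rewrite ger0_norm; first by rewrite beta_weight_le// ltW.
by rewrite beta_weight_ge0// ltW.
Qed.

Lemma smooth_bound (f : R -> R) t : smooth true f ->
  exists K, forall s, 0 < s -> s <= t -> `|f s| <= K.
Proof.
move=> Sf; have [K HK] := smooth_bounded Sf t (lexx 0).
by exists K => s s0 st; apply: HK => //; exact: ltW.
Qed.

Lemma beta_integrable i j f t : smooth true f -> 0 < t ->
  mu.-integrable `]0, 1[ (EFin \o (fun v => derive1n i f (t * v) * beta_weight j v)).
Proof.
move=> Sf t0; have Sfi := smooth_derive1n i Sf.
have [K HK] := smooth_bound t Sfi.
apply: (weighted_integrable (K := K)) => //.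
- exact: smooth_measurable Sfi.
- exact: measurable_beta_weight.
- exact: beta_weight_bound.
Qed.

(** The argument t v comes arbitrarily close to 0, so the majorant K (1 - v)^(-th) uses a bound on
    the next derivative of f over all of (0, t + 1]: this is what [smooth true] supplies. *)
Lemma is_derive_beta_avg i f t : smooth true f -> 0 < t ->
  is_derive t 1 (beta_avg i f) (beta_avg i.+1 f t).
Proof.
move=> Sf t0.
have [K HK] := smooth_bound (t + 1) (smooth_derive1n i.+1 Sf).
have K0 : 0 <= K by apply: le_trans (HK t t0 _); rewrite ?normr_ge0 ?lerDl.
pose g s v := derive1n i f (s * v) * beta_weight i v.
have mD : measurable (`]0, 1[%classic : set (measurableTypeR R)) by [].
have tI : `]0, (t + 1)[%classic t by rewrite /= in_itv/= t0 ltrDl ltr01.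
have dg (s v : R) : 0 < s -> 0 < v ->
    is_derive s 1 (g ^~ v) (derive1n i.+1 f (s * v) * beta_weight i.+1 v).
  move=> s0 v0; have sv0 : 0 < v * s + 0 by rewrite addr0 mulr_gt0.
  have H := is_derive_fZ (beta_weight i v) (is_derive_fcomp (g := fun s => v * s + 0)
    (smooth_is_derive (smooth_derive1n i Sf) sv0) (is_derive_affine v 0 s)).
  have -> : g ^~ v = fun s => beta_weight i v * derive1n i f (v * s + 0).
    by apply/funext => z; rewrite /g addr0 mulrC (mulrC v).
  apply: (is_derive_as H); rewrite addr0 /beta_weight exprS derive1nS (mulrC v s).
  by ring.
have d1g (s v : R) : 0 < s -> 0 < v ->
    partial1of2 g s v = derive1n i.+1 f (s * v) * beta_weight i.+1 v.
  by move=> s0 v0; exact: (is_derive_derive1 (dg s v s0 v0)).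
have intg (s : R) : `]0, (t + 1)[%classic s -> mu.-integrable `]0, 1[ (EFin \o g s).
  by rewrite /= in_itv/= => /andP[s0 _]; exact: beta_integrable.
have der (s v : R) : `]0, (t + 1)[%classic s -> `]0, 1[%classic v -> derivable (g ^~ v) s 1.
  rewrite /= !in_itv/= => /andP[s0 _] /andP[v0 _].
  exact: (is_derive_derivable (dg s v s0 v0)).
pose G v := K * (1 - v) `^ (- th).
have G0 v : 0 <= G v by rewrite mulr_ge0 ?powR_ge0.
have iG : mu.-integrable `]0, 1[ (EFin \o G).
  by apply: RintegrableZl => //; exact: one_sub_powR_integrable.
have Gub (s v : R) : `]0, (t + 1)[%classic s -> `]0, 1[%classic v -> `|partial1of2 g s v| <= G v.
  rewrite /= !in_itv/= => /andP[s0 sU] /andP[v0 v1].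
  rewrite d1g// normrM; apply: ler_pM => //; last exact: beta_weight_bound.
  apply: HK; first by rewrite mulr_gt0.
  by rewrite (le_trans _ (ltW sU))// ler_piMr// ltW.
apply: DeriveDef; first exact: (derivable_under_integral mD tI intg der G0 iG Gub).
rewrite -derive1E (differentiation_under_integral mD tI intg der G0 iG Gub).
by apply: eq_Rintegral => v; rewrite inE/= in_itv/= => /andP[v0 v1]; exact: d1g.
Qed.

Lemma smooth_beta_avg f i : smooth true f -> smooth true (beta_avg i f).
Proof.
move=> Sf; apply: (smooth_family (F := fun i => beta_avg i f) (c := 1)).
  move=> j L U L0; have [K HK] := smooth_bound U (smooth_derive1n j Sf).
  exists (\int[mu]_(v in `]0, 1[) (K * (1 - v) `^ (- th))) => t t0 _ tU.
  have bi := beta_integrable j j Sf t0.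
  apply: (le_trans (le_normr_Rintegral _ bi)) => //.
  apply: le_Rintegral => //; first exact: (integrable_norm bi).
    by apply: RintegrableZl => //; exact: one_sub_powR_integrable.
  move=> v /=; rewrite in_itv/= => /andP[v0 v1].
  rewrite normrM; apply: ler_pM => //; last exact: beta_weight_bound.
  apply: HK; first by rewrite mulr_gt0.
  by rewrite (le_trans _ tU)// ler_piMr// ltW.
by move=> j x x0; rewrite mul1r; exact: is_derive_beta_avg.
Qed.

Lemma beta_integrable_parts f t : smooth true f -> 0 < t ->
  mu.-integrable `]0, 1[ (EFin \o (fun v => f (t * v) * (1 - v) `^ (1 - th))).
Proof.
move=> Sf t0; have [M HM] := smooth_bound t Sf.
apply: (weighted_integrable (K := M)) => //.
- exact: smooth_measurable Sf.
- exact: measurable_one_sub_powR.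
- move=> v v0 v1; rewrite ger0_norm ?powR_ge0// ger_powR//; last by lra.
  by rewrite subr_gt0 v1 gerBl ltW.
Qed.

(** The function f (t v) (1 - v)^(1 - th) vanishes at v = 1 because th < 1 and at v = 0 because |f
    s| <= K s, so its derivative in v integrates to zero. *)
Lemma beta_avg_by_parts f t : smooth true f -> 0 < t ->
  (exists K, forall s, 0 < s -> s <= t -> `|f s| <= K * s) ->
  (1 - th) * beta_avg 0 f t =
  t * \int[mu]_(v in `]0, 1[) (derive1 f (t * v) * (1 - v) `^ (1 - th)).
Proof.
move=> Sf t0 [K HK].
have s0 : 0 < 1 - th by rewrite subr_gt0.
pose F v := f (t * v) * (1 - v) `^ (1 - th).
pose G v := t * (derive1 f (t * v) * (1 - v) `^ (1 - th)) +
  - (1 - th) * (derive1n 0 f (t * v) * beta_weight 0 v).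
have dscaled h v : smooth true h -> 0 < v ->
    is_derive v 1 (fun z => h (t * z)) (t * derive1 h (t * v)).
  move=> Sh v0; have tv0 : 0 < t * v + 0 by rewrite addr0 mulr_gt0.
  have H := is_derive_fcomp (g := fun z => t * z + 0) (smooth_is_derive Sh tv0)
    (is_derive_affine t 0 v).
  have -> : (fun z => h (t * z)) = fun z => h (t * z + 0).
    by apply/funext => z; rewrite addr0.
  by apply: (is_derive_as H); rewrite addr0 mulrC.
have dF (v : R) : 0 < v -> v < 1 -> is_derive v 1 F (G v).
  move=> v0 v1; apply: (is_derive_as (is_derive_fM (dscaled f v Sf v0) (is_derive_powR_1B
    (1 - th) v1))).
  rewrite /G /beta_weight expr0 mul1r derive1n0.
  by rewrite (_ : 1 - th - 1 = - th); ring.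
have dG (v : R) : 0 < v -> v < 1 -> derivable G v 1.
  move=> v0 v1.
  have H1 := is_derive_fM (dscaled _ v (smooth_derive1 Sf) v0) (is_derive_powR_1B (1 - th) v1).
  have H2 := is_derive_fM (dscaled _ v Sf v0) (is_derive_powR_1B (- th) v1).
  have -> : G = fun v => t * (derive1 f (t * v) * (1 - v) `^ (1 - th)) +
      - (1 - th) * (f (t * v) * (1 - v) `^ (- th)).
    by apply/funext => z; rewrite /G /beta_weight expr0 mul1r.
  exact: (is_derive_derivable (is_derive_fD (is_derive_fZ t H1) (is_derive_fZ (- (1 - th)) H2))).
have iA := beta_integrable_parts (smooth_derive1 Sf) t0.
have iB := beta_integrable 0 0 Sf t0.
have iG : mu.-integrable `]0, 1[ (EFin \o G).
  by apply: RintegrableD => //; exact: RintegrableZl.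
have F0 : F v @[v --> 0^'+] --> 0.
  apply/norm_cvg0P.
  have c0 : K * t * v @[v --> (0 : R)^'+] --> K * t * 0.
    apply: cvgM; first exact: cvg_cst.
    by apply: cvg_at_right_filter; exact: cvg_id.
  rewrite mulr0 in c0; apply: (squeeze_cvgr _ (cvg_cst _) c0).
  near=> v; have v0 : 0 < v by near: v; exact: nbhs_right_gt.
  have v1 : v < 1 by near: v; exact: nbhs_right_lt.
  rewrite normr_ge0/= /F normrM -[leRHS]mulr1.
  apply: ler_pM => //.
    by rewrite -mulrA; apply: HK; rewrite ?mulr_gt0// ler_piMr// ltW.
  rewrite ger0_norm ?powR_ge0// -[leRHS](powRr0 (1 - v)) ger_powR ?(ltW s0)//.
  by rewrite subr_gt0 v1 gerBl ltW.
have F1 : F v @[v --> 1^'-] --> 0.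
  have [M HM] := smooth_bound t Sf.
  apply/norm_cvg0P.
  have c1 : M * (1 - v) `^ (1 - th) @[v --> (1 : R)^'-] --> M * 0.
    apply: cvgM; first exact: cvg_cst.
    apply/cvg_at_leftP => u [u1 uc].
    apply: ((cvg_at_rightP _ _ _).1 (powR_cvg0 s0) (fun n => 1 - u n)); split.
      by move=> n; rewrite subr_gt0.
    by rewrite -[X in _ --> X](subrr 1); apply: cvgB => //; exact: cvg_cst.
  rewrite mulr0 in c1; apply: (squeeze_cvgr _ (cvg_cst _) c1).
  near=> v; have v0 : 0 < v by near: v; exact: nbhs_left_gt.
  rewrite normr_ge0/= /F normrM.
  apply: ler_pM => //; first by apply: HM; rewrite ?mulr_gt0// ler_piMr// ltW.
  by rewrite ger0_norm ?powR_ge0.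
have := FTC_unit dF dG iG F0 F1; rewrite subrr.
rewrite RintegralD//; [|exact: RintegrableZl|exact: RintegrableZl].
rewrite !RintegralZl// => /eqP; rewrite mulNr subr_eq0 => /eqP ->.
by [].
Unshelve. all: end_near. Qed.

End BetaAverage.

Section RiemannLiouville.
Context {R : realType}.
Local Notation mu := (@lebesgue_measure R).
Implicit Types (gam u s t v : R) (f : R -> R).

Lemma powR_1B (x r : R) : 0 < x -> x `^ (1 - r) = x * x `^ (- r).
Proof. by move=> x0; rewrite powRD ?(gt_eqF x0) ?implybT// powRr1 ?ltW. Qed.

(** The fractional part of gam; orders gam and gam - 1 share it, hence share the same kernel. *)
Definition RL_exponent gam : R := gam + 1 - (RL_ceil gam)%:R.

Lemma RL_exponentE gam : RL_exponent gam = gam - (Num.truncn gam)%:R.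
Proof. by rewrite /RL_exponent /RL_ceil -natr1; ring. Qed.

Lemma RL_exponent_itv gam : 0 <= gam -> gam \isn't a Num.nat -> 0 < RL_exponent gam < 1.
Proof.
move=> g0 gN; have /andP[g1 g2] := truncn_itv g0.
rewrite -natr1 addrC in g2.
rewrite RL_exponentE subr_gt0 ltrBlDl addrC g2 andbT lt_neqAle g1 andbT.
by apply: contraNN gN => /eqP <-; exact: natr_nat.
Qed.

Lemma natB1 gam : 1 <= gam -> (gam - 1 \is a Num.nat) = (gam \is a Num.nat).
Proof.
move=> g1; apply/idP/idP => /natrP[n gn].
  by apply/natrP; exists n.+1; rewrite -natr1 -gn subrK.
case: n gn => [gE|n gE]; first by move: g1; rewrite gE ler10.
by apply/natrP; exists n; rewrite gE -natr1 addrK.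
Qed.

Lemma truncnB1 gam : 1 <= gam -> Num.truncn gam = (Num.truncn (gam - 1)).+1.
Proof.
move=> g1; apply: truncn_def.
have h0 : 0 <= gam - 1 by rewrite subr_ge0.
have /andP[h1 h2] := truncn_itv h0.
rewrite -natr1 in h2; rewrite -(natr1 _.+1) -natr1.
by apply/andP; split; lra.
Qed.

Lemma RL_exponentB1 gam : 1 <= gam -> RL_exponent (gam - 1) = RL_exponent gam.
Proof. by move=> g1; rewrite !RL_exponentE (truncnB1 g1) -natr1; ring. Qed.

Lemma RL_kernelE gam f u v : 0 < u -> v < 1 ->
  RL_kernel gam f u (u * v) = u `^ (- RL_exponent gam) * (f (u * v) * beta_weight
    (RL_exponent gam) 0 v).
Proof.
move=> u0 v1; rewrite /RL_kernel -/(RL_exponent gam) /beta_weight expr0 mul1r.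
rewrite (_ : u - u * v = u * (1 - v)); last by ring.
rewrite powRM ?(ltW u0) ?subr_ge0 ?(ltW v1)//.
by rewrite !powRN invfM mulrCA.
Qed.

Lemma measurable_RL_kernel gam f u : measurable_fun (`]0, +oo[%classic : set R) f ->
  measurable_fun (`]0, u[%classic : set R) (RL_kernel gam f u).
Proof.
move=> mf; rewrite (_ : RL_kernel gam f u = fun s => f s * (u - s) `^ (- RL_exponent gam)).
  apply: measurable_funM.
    by apply: measurable_funS mf => // s /=; rewrite !in_itv/= andbT => /andP[].
  by apply: (measurableT_comp (@measurable_powR R _)); exact: measurable_funB.
by apply/funext => s; rewrite /RL_kernel powRN.
Qed.

Lemma preimage_mul_itv u : 0 < u ->
  (fun v => u * v) @^-1` `]0, u[%classic = (`]0, 1[%classic : set R).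
Proof.
move=> u0; apply/seteqP; split=> v /=; rewrite !in_itv/= pmulr_rgt0//.
  by rewrite gtr_pMr.
by rewrite gtr_pMr.
Qed.

Section NonIntegerOrder.
Variable gam : R.
Hypotheses (g0 : 0 <= gam) (gN : gam \isn't a Num.nat).
Local Notation th := (RL_exponent gam).

Let th0 : 0 < th. Proof. by have /andP[] := RL_exponent_itv g0 gN. Qed.
Let th1 : th < 1. Proof. by have /andP[] := RL_exponent_itv g0 gN. Qed.

Lemma RL_kernel_integrable_oo f u : smooth true f -> 0 < u ->
  mu.-integrable `]0, u[ (EFin \o RL_kernel gam f u).
Proof.
move=> Sf u0; apply: (integrable_scale u0) => //.
  by apply: measurable_RL_kernel; exact: (smooth_measurable Sf).
rewrite preimage_mul_itv//.
have : mu.-integrable `]0, 1[ (EFin \o (fun v =>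
    u `^ (- th) * (f (u * v) * beta_weight th 0 v))).
  by apply: RintegrableZl => //; exact: (beta_integrable th1 0 0 Sf u0).
apply: eq_integrable => // v; rewrite inE/= in_itv/= => /andP[v0 v1].
by rewrite RL_kernelE.
Qed.

Lemma RL_kernel_integrable f u : smooth true f -> 0 < u ->
  mu.-integrable `[0, u] (EFin \o RL_kernel gam f u).
Proof.
move=> Sf u0; have /integrableP[mK iK] := RL_kernel_integrable_oo Sf u0.
apply/integrableP; split.
  by apply/measurable_EFinP; apply: measurable_fun_itv_cc; apply/measurable_EFinP; exact: mK.
by rewrite integral_itv_bndoo//; exact: measurableT_comp.
Qed.

Lemma RL_integralE f u : smooth true f -> 0 < u ->
  RL_integral gam f u = u `^ (1 - th) * beta_avg th 0 f u.
Proof.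
move=> Sf u0; have iK := RL_kernel_integrable_oo Sf u0.
have -> : RL_integral gam f u = \int[mu]_(s in `]0, u[) RL_kernel gam f u s.
  by rewrite /RL_integral /Rintegral integral_itv_bndoo//; have /integrableP[] := iK.
rewrite (Rintegral_scale u0 _ iK)// preimage_mul_itv//.
rewrite powR_1B// -mulrA; congr (_ * _).
rewrite /beta_avg -RintegralZl//; last exact: beta_integrable.
by apply: eq_Rintegral => v; rewrite inE/= in_itv/= => /andP[v0 v1]; exact: RL_kernelE.
Qed.

Lemma smooth_powRx r : smooth false (fun u => u `^ r).
Proof.
move=> n; elim: n r => [|n IH] r.
  split=> // L U L0; exists (L `^ r + U `^ r) => t t0 Lt tU.
  rewrite ger0_norm ?powR_ge0//.
  have [r0|r0] := leP 0 r.
    rewrite -[leLHS]add0r lerD ?powR_ge0//.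
    by apply: ge0_ler_powR; rewrite // nnegrE ltW// (lt_le_trans t0).
  rewrite -[leLHS]addr0 lerD ?powR_ge0//.
  rewrite -[r]opprK !(powRN _ (- r)) lef_pV2 ?posrE ?powR_gt0//.
  by apply: ge0_ler_powR; rewrite // ?nnegrE ?oppr_ge0 ltW.
split; first by have := IH r; case: n {IH} => [|n] [].
exists (fun x => r * x `^ (r - 1)); first by move=> x x0; exact: is_derive_powRx.
exact: SmZ.
Qed.

Lemma smooth_RL_integral f : smooth true f -> smooth false (RL_integral gam f).
Proof.
move=> Sf; apply: (@smooth_eq _ _ (fun u => u `^ (1 - th) * beta_avg th 0 f u)).
  by move=> u u0; rewrite RL_integralE.
by apply: smoothM; [exact: smooth_powRx|exact/smooth_weaken/smooth_beta_avg].
Qed.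

(* The boundary term of the integration by parts vanishes because [f] does at 0. *)
Lemma derive1_RL_integral f u : smooth true f -> 0 < u ->
  (exists K, forall s, 0 < s -> s <= u -> `|f s| <= K * s) ->
  derive1 (RL_integral gam f) u = RL_integral gam (derive1 f) u.
Proof.
move=> Sf u0 fK; have Sf' := smooth_derive1 Sf.
rewrite RL_integralE// (derive1_eq_pos (fun y => RL_integralE Sf (u := y)) u0).
have H := is_derive_fM (is_derive_powRx (1 - th) u0) (is_derive_beta_avg th1 0 Sf u0).
rewrite (is_derive_derive1 H).
have -> : 1 - th - 1 = - th by ring.
rewrite mulrAC (beta_avg_by_parts th1 Sf u0 fK) mulrAC.
have -> : u * u `^ (- th) = u `^ (1 - th) by rewrite powR_1B.
have i1 := beta_integrable_parts th1 Sf' u0.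
have i2 := beta_integrable th1 1 1 Sf u0.
rewrite -mulrDr; congr (_ * _).
rewrite /beta_avg -RintegralD//.
apply: eq_Rintegral => v; rewrite inE/= in_itv/= => /andP[v0 v1].
(* (1 - v)^(1 - th) + v (1 - v)^(-th) = (1 - v)^(-th): the term from integration by parts and the
   one from the derivative of the average recombine into the original weight. *)
rewrite /beta_weight expr1 expr0 mul1r -mulrDr; congr (_ * _).
by rewrite powR_1B ?subr_gt0//; ring.
Qed.

End NonIntegerOrder.
End RiemannLiouville.

(** * Fubini under a product majorant *)

Section DominatedFubini.
Context {d1 d2} {T1 : measurableType d1} {T2 : measurableType d2} {R : realType}.
Variables (m1 : {sigma_finite_measure set T1 -> \bar R})
  (m2 : {sigma_finite_measure set T2 -> \bar R}).
Variables (D1 : set T1) (D2 : set T2) (f : T1 * T2 -> R) (B : T1 -> R) (W : T2 -> R).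
Hypotheses (mD1 : measurable D1) (mD2 : measurable D2).
Hypothesis mf : measurable_fun (D1 `*` D2) f.
Hypotheses (iB : m1.-integrable D1 (EFin \o B)) (iW : m2.-integrable D2 (EFin \o W)).
Hypotheses (B0 : forall x, D1 x -> 0 <= B x) (W0 : forall y, D2 y -> 0 <= W y).
Hypothesis fBW : forall x y, D1 x -> D2 y -> `|f (x, y)| <= B x * W y.

Let D := D1 `*` D2.
Let mD : measurable D. Proof. exact: measurableX. Qed.
Let F : T1 * T2 -> \bar R := EFin \o (f \_ D).

Let mF : measurable_fun setT F.
Proof. by apply/measurable_EFinP; apply/(measurable_restrictT f). Qed.

Let msec1 x : D1 x -> measurable_fun D2 (fun y => f (x, y)).
Proof.
move=> D1x; apply: (measurable_comp mD _ mf) => //.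
  by move=> _ [y D2y <-].
exact: (measurable_funTS (pair1_measurable x)).
Qed.

Let msec2 y : D2 y -> measurable_fun D1 (fun x => f (x, y)).
Proof.
move=> D2y; apply: (measurable_comp mD _ mf) => //.
  by move=> _ [x D1x <-].
exact: (measurable_funTS (pair2_measurable y)).
Qed.

Lemma section1_integrable x : D1 x -> m2.-integrable D2 (EFin \o (fun y => f (x, y))).
Proof.
move=> D1x; apply: (@le_Rintegrable _ _ R m2 _ _ (fun y => B x * W y)) => //.
- exact: msec1.
- by move=> y D2y; exact: fBW.
- exact: RintegrableZl.
Qed.

Lemma section2_integrable y : D2 y -> m1.-integrable D1 (EFin \o (fun x => f (x, y))).
Proof.
move=> D2y; apply: (@le_Rintegrable _ _ R m1 _ _ (fun x => W y * B x)) => //.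
- exact: msec2.
- by move=> x D1x; rewrite mulrC; exact: fBW.
- exact: RintegrableZl.
Qed.

Let F1E x : (\int[m2]_y F (x, y))%E =
  ((EFin \o (fun x => \int[m2]_(y in D2) f (x, y))) \_ D1) x.
Proof.
rewrite patchE; case: ifPn => [|/negP]; rewrite inE => D1x.
  rewrite /= /Rintegral fineK; last exact: integrable_fin_num (section1_integrable D1x).
  rewrite [RHS]integral_mkcond; apply: eq_integral => y _.
  rewrite /F /= !patchE in_setX (mem_set D1x)/=; by case: ifP.
rewrite integral0_eq// => y _; rewrite /F/= patchE ifF//.
by apply/negP; rewrite inE => -[].
Qed.

Let F2E y : (\int[m1]_x F (x, y))%E =
  ((EFin \o (fun y => \int[m1]_(x in D1) f (x, y))) \_ D2) y.
Proof.
rewrite patchE; case: ifPn => [|/negP]; rewrite inE => D2y.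
  rewrite /= /Rintegral fineK; last exact: integrable_fin_num (section2_integrable D2y).
  rewrite [RHS]integral_mkcond; apply: eq_integral => x _.
  by rewrite /F /= !patchE in_setX andbC (mem_set D2y)/=; case: ifP.
rewrite integral0_eq// => x _; rewrite /F/= patchE ifF//.
by apply/negP; rewrite inE => -[].
Qed.

Let iF : (m1 \x m2)%E.-integrable setT F.
Proof.
apply/(integrable12ltyP m1 m2 mF).
pose c := (\int[m2]_(y in D2) (W y)%:E)%E.
have c0 : (0 <= c)%E by apply: integral_ge0 => y /W0; rewrite lee_fin.
have mW := measurable_int _ iW; have mB := measurable_int _ iB.
apply: (@le_lt_trans _ _ (\int[m1]_x ((EFin \o B) \_ D1 x * c))%E).
  apply: ge0_le_integral => //.
  - by move=> x _; exact: integral_ge0.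
  - apply: (measurable_fun_fubini_tonelli_F (abse \o F)) => //.
      exact: measurableT_comp.
    by move=> x; rewrite lee_fin.
  - apply: emeasurable_funM => //; exact/(measurable_restrictT _ mD1).
  - move=> x _; rewrite patchE; case: ifPn => [|/negP]; rewrite inE => D1x.
      rewrite -ge0_integralZl//; last by rewrite lee_fin B0.
      rewrite [leRHS]integral_mkcond; apply: ge0_le_integral => //.
      + by apply: measurableT_comp => //; apply: measurableT_comp mF _.
      + by apply/(measurable_restrictT _ mD2); exact: measurable_funeM.
      + move=> y _; rewrite /F/= !patchE in_setX (mem_set D1x)/=.
        case: ifPn => [|_]; last by rewrite normr0.
        by rewrite inE => D2y; rewrite -EFinM lee_fin; exact: fBW.
    rewrite integral0_eq ?mul0e// => y _; rewrite /F/= patchE ifF ?normr0//.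
    by apply/negP; rewrite inE => -[].
rewrite ge0_integralZr//; last 2 first.
- exact/(measurable_restrictT _ mD1).
- move=> x _; rewrite patchE; case: ifPn => //; rewrite inE => D1x.
  by rewrite lee_fin B0.
rewrite -integral_mkcond.
apply: lte_mul_pinfty.
- by apply: integral_ge0 => x /B0; rewrite lee_fin.
- exact: integrable_fin_num.
- by have /(integrable_fin_num mD2) := iW; rewrite -/c ltey_eq => ->.
Qed.

(** The extension of f by zero is integrable on the product space, since its iterated absolute
    integral is at most the integral of B times that of W. Integrability of the inner integral is
    kept, as the equation requires its last integrand to be integrable. *)
Lemma dominated_Fubini : m1.-integrable D1 (EFin \o (fun x => \int[m2]_(y in D2) f (x, y))) /\
  \int[m1]_(x in D1) (\int[m2]_(y in D2) f (x, y)) =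
  \int[m2]_(y in D2) (\int[m1]_(x in D1) f (x, y)).
Proof.
split.
  apply/(integrable_mkcond _ mD1).
  have := integrable_fubini_F iF; apply: eq_integrable => // x _.
  by rewrite /fubini_F F1E.
have := Fubini iF.
under eq_integral do rewrite F1E.
under [in X in _ = X -> _]eq_integral do rewrite F2E.
by rewrite -!integral_mkcond /Rintegral => ->.
Qed.

End DominatedFubini.

(** * The equation for mixtures of gamma densities *)

Section Mixture.
Context {R : realType}.
Local Notation mu := (@lebesgue_measure R).
Variables (a b C eps : R) (p q : R -> R) (str : bool).
Hypotheses (a0 : 0 < a) (b0 : 0 < b) (C0 : 0 <= C) (e0 : 0 <= eps) (se : str -> 0 < eps).
Hypothesis mp : measurable_fun (`]0, +oo[%classic : set R) p.
Hypothesis pC : forall x : R, 0 < x -> `|p x| <= C * x `^ eps.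
Implicit Types (t u v x : R).

Local Notation g := (gamma_density a b).
Local Notation M := (moment a b p).
Local Notation kappa := (moment_kernel a b).

Let mpos : measurable (`]0, +oo[%classic : set (measurableTypeR R)).
Proof. by []. Qed.

(** The integral of p(x) (ln x)^j g(x, t) over x > 0: j = 0 is q, and j = 1 is the last integral of
    the equation for gam = 1. *)
Definition mix (j : nat) (t : R) : R := norm_const a b t * M j t.

Hypothesis qE : forall t, 0 < t -> q t = mix 0 t.

Let smooth_M j : smooth str (M j).
Proof. exact: smooth_moment pC. Qed.

Let derive1_M j t : 0 < t -> derive1 (M j) t = b * M j.+1 t.
Proof.
move=> t0; apply: is_derive_derive1; apply: (is_derive_moment a0 b0 C0 mp pC).
by rewrite ltr_wpDl// mulr_gt0.
Qed.

Lemma smooth_mix j : smooth str (mix j).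
Proof. by apply: smoothM => //; exact/smooth_weaken/smooth_norm_const. Qed.

Lemma smooth_q : smooth str q.
Proof. by apply: (smooth_eq _ (smooth_mix 0)) => t t0; rewrite qE. Qed.

(** Replacing digamma (b t) by digamma (b t + 1) - 1 / (b t) and using [norm_constE], the pole
    cancels against the factor b t of [mix 0], and no summand is singular at 0. *)
Lemma drift_termE t : 0 < t -> drift_term a b q t =
  ln a * mix 0 t + (-1 * (digamma (b * t + 1) * mix 0 t) + norm_constS a b t * M 0 t).
Proof.
move=> t0; have bt : 0 < b * t by rewrite mulr_gt0.
rewrite /drift_term qE// digammaS// /mix (norm_constE a b0 t0).
by field; rewrite !gt_eqF.
Qed.

Lemma smooth_drift : smooth str (drift_term a b q).
Proof.
pose f t := ln a * mix 0 t +
  (-1 * (digamma (b * t + 1) * mix 0 t) + norm_constS a b t * M 0 t).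
apply: (@smooth_eq _ _ f) => [t t0|]; first by rewrite drift_termE.
apply: smoothD; first by apply: smoothZ; exact: smooth_mix.
apply: smoothD; first apply: smoothZ; apply: smoothM => //.
- exact/smooth_weaken/smooth_digammaS.
- exact: smooth_mix.
- exact/smooth_weaken/smooth_norm_constS.
Qed.

(** The equation for gam = 1. Higher orders result from applying an operator in t to this
    identity. *)
Lemma derive1_q t : 0 < t -> derive1 q t = b * drift_term a b q t + b * mix 1 t.
Proof.
move=> t0; rewrite (derive1_eq_pos qE t0) (smooth_derive1M _ (smooth_M 0) t0); last first.
  exact/smooth_weaken/smooth_norm_const.
rewrite derive1_norm_const// derive1_M// /drift_term qE// /mix.
by ring.
Qed.

(** The coefficients come from [norm_const] alone and so are common to g and to every mixture;
    integrating the expansion of g against p (ln x)^j gives that of [mix j] term by term. *)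
Lemma density_expansion i : exists c : nat -> R -> R, [/\ forall l, smooth true (c l),
  forall t x, 0 < t -> 0 < x ->
    derive1n i (g x) t = \sum_(l < i.+1) c l t * kappa l t x &
  forall j t, 0 < t -> derive1n i (mix j) t = \sum_(l < i.+1) c l t * M (j + l) t].
Proof.
have weak f : smooth str f -> smooth false f by case: (str) => //; exact: smooth_weaken.
have [c [Sc Hc]] := leibniz_expansion b i (smooth_norm_const a0 b0).
exists c; split => //.
- move=> t x t0 x0; rewrite -(Hc (fun l t => kappa l t x))//.
  + by congr (derive1n i _ t); apply/funext => s; exact: gamma_densityE.
  + by move=> l; exact/smooth_weaken/smooth_moment_kernel.
  + by move=> l s s0; exact: derive1_moment_kernel.
- move=> j t t0; rewrite -(Hc (fun l => M (j + l)%N))//.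
  + by rewrite addn0.
  + by move=> l; exact: weak.
  + by move=> l s s0; rewrite addnS derive1_M.
Qed.

Lemma density_derive1n_integral i t : 0 < t ->
  mu.-integrable `]0, +oo[ (EFin \o (fun x => p x * ln x * derive1n i (g x) t)) /\
  \int[mu]_(x in `]0, +oo[) (p x * ln x * derive1n i (g x) t) = derive1n i (mix 1) t.
Proof.
move=> t0; have [c [Sc Hg HM]] := density_expansion i.
have et0 : 0 < eps + b * t by rewrite ltr_wpDl// mulr_gt0.
have E : {in `]0, +oo[%classic, (fun x => p x * ln x * derive1n i (g x) t) =1
    (fun x => \sum_(l < i.+1) c l t * (p x * kappa l.+1 t x))}.
  move=> x; rewrite inE/= in_itv/= andbT => x0; rewrite Hg// mulr_sumr.
  by apply: eq_bigr => l _; rewrite /moment_kernel exprS; ring.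
have mi l : mu.-integrable `]0, +oo[ (EFin \o (fun x => c l t * (p x * kappa l.+1 t x))).
  by apply: RintegrableZl => //; exact: (moment_integrable a0 b0 C0 mp pC _ et0).
split.
  have := Rintegrable_sum (index_enum 'I_i.+1) mpos (fun l => mi (nat_of_ord l)).
  by apply: eq_integrable => // x xD /=; rewrite E.
transitivity (\int[mu]_(x in `]0, +oo[) (\sum_(l < i.+1) c l t * (p x * kappa l.+1 t x))).
  exact: eq_Rintegral.
rewrite Rintegral_sum//.
rewrite HM//; apply: eq_bigr => l _; rewrite RintegralZl// ?add1n//.
exact: (moment_integrable a0 b0 C0 mp pC _ et0).
Qed.

(** The derivative of order N = gam - 1 is applied to [derive1_q], and [density_derive1n_integral]
    moves it inside the last integral. Nothing is asked at t = 0, so [str] may be either value. *)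
Lemma equation_nat (gam : R) : 1 <= gam -> gam \is a Num.nat ->
  equation_well_defined a b gam p q /\ solves_equation a b gam p q.
Proof.
move=> g1 gN; have gN1 : gam - 1 \is a Num.nat by rewrite natB1.
have tE := truncnB1 g1; set N := Num.truncn (gam - 1) in tE.
split.
  split.
  - by rewrite /RL_derivable gN; apply: smooth_n_derivable; exact: smooth_q.
  - by rewrite /RL_derivable gN1; apply: smooth_n_derivable; exact: smooth_drift.
  - by move=> x x0; rewrite /RL_derivable gN1; apply: smooth_n_derivable;
    exact: (smooth_gamma_density a0 b0 x0).
  - move=> t t0; rewrite /density_integrand /RL_derive gN1.
    by have [] := density_derive1n_integral N t0.
move=> t t0; rewrite /density_integrand /RL_derive gN gN1 tE.
have [_ ->] := density_derive1n_integral N t0.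
rewrite derive1Sn (derive1n_eq_pos N derive1_q t0).
rewrite (smooth_derive1nD N (smoothZ b smooth_drift) (smoothZ b (smooth_mix 1)) t0).
by rewrite (smooth_derive1nZ N b smooth_drift t0) (smooth_derive1nZ N b (smooth_mix 1) t0).
Qed.

End Mixture.

(** * Mixtures under fractional derivatives of non-integer order *)

Section FractionalMixture.
Context {R : realType}.
Local Notation mu := (@lebesgue_measure R).
Variables (a b C eps : R) (p q : R -> R).
Hypotheses (a0 : 0 < a) (b0 : 0 < b) (C0 : 0 <= C) (e0 : 0 < eps).
Hypothesis mp : measurable_fun (`]0, +oo[%classic : set R) p.
Hypothesis pC : forall x : R, 0 < x -> `|p x| <= C * x `^ eps.
Implicit Types (t u v x : R).

Local Notation g := (gamma_density a b).
Local Notation M := (moment a b p).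
Local Notation kappa := (moment_kernel a b).
Local Notation mix := (mix a b p).

Hypothesis qE : forall t, 0 < t -> q t = mix 0 t.

Let mpos : measurable (`]0, +oo[%classic : set (measurableTypeR R)).
Proof. by []. Qed.

Let munit : measurable (`]0, 1[%classic : set (measurableTypeR R)).
Proof. by []. Qed.

Let se : true -> 0 < eps. Proof. by []. Qed.

Let Smix j : smooth true (mix j).
Proof. exact: (smooth_mix a0 b0 C0 (ltW e0) se mp pC). Qed.

Let Sq : smooth true q.
Proof. exact: (smooth_q a0 b0 C0 (ltW e0) se mp pC qE). Qed.

Let Sdrift : smooth true (drift_term a b q).
Proof. exact: (smooth_drift a0 b0 C0 (ltW e0) se mp pC qE). Qed.

Let Sg x : 0 < x -> smooth true (g x).
Proof. exact: smooth_gamma_density. Qed.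

Let D12 : set (measurableTypeR R * measurableTypeR R) := `]0, +oo[%classic `*` `]0, 1[%classic.

Let measurable_on_fst (f : R -> R) : measurable_fun (`]0, +oo[%classic : set R) f ->
  measurable_fun D12 (fun z => f z.1).
Proof.
move=> mf; apply: (measurable_comp mpos _ mf) => //.
  by move=> _ [z [z1 _] <-].
exact: (measurable_funTS measurable_fst).
Qed.

Let measurable_on_snd (f : R -> R) : measurable_fun (`]0, 1[%classic : set R) f ->
  measurable_fun D12 (fun z => f z.2).
Proof.
move=> mf; apply: (measurable_comp munit _ mf) => //.
  by move=> _ [z [_ z2] <-].
exact: (measurable_funTS measurable_snd).
Qed.

(** On x > 0 the power with variable exponent is the exponential of a product, which is jointly
    measurable in base and exponent. *)
Let measurable_kappa l t : measurable_fun D12 (fun z => kappa l (t * z.2) z.1).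
Proof.
apply: (@eq_measurable_fun _ _ _ _ _ (fun z : R * R =>
    ln z.1 ^+ l * expR ((b * (t * z.2) - 1) * ln z.1) * expR (- (a * z.1)))).
  move=> z; rewrite inE => -[/=]; rewrite in_itv/= andbT => z1 _.
  by rewrite /moment_kernel powR_expRE.
have m1 : measurable_fun D12 (fun z => ln z.1).
  exact: (measurable_on_fst (measurable_funTS (@measurable_ln R))).
have m2 : measurable_fun D12 (fun z => z.2) by exact: (measurable_on_snd (f := id)).
apply: measurable_funM; first apply: measurable_funM.
- exact: measurable_funX.
- apply: (measurableT_comp (@measurable_expR R)) => //; apply: measurable_funM => //.
  by apply: measurable_funB => //; apply: measurable_funM => //; exact: measurable_funM.
- apply: (measurable_on_fst (f := fun x => expR (- (a * x)))).
  apply: (measurableT_comp (@measurable_expR R)) => //.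
  by apply: (measurableT_comp (@oppr_measurable R _)) => //; exact: measurable_funM.
Qed.

(** Fubini in (x, v). By [density_expansion] the integrand is a sum of coefficients bounded on (0,
    t] times moment kernels dominated uniformly on [0, t], so it lies below a function of x times (1
    - v)^(-th). *)
Lemma density_beta_avg_integral (th : R) i t : th < 1 -> 0 < t ->
  mu.-integrable `]0, +oo[ (EFin \o (fun x => p x * ln x * beta_avg th i (g x) t)) /\
  \int[mu]_(x in `]0, +oo[) (p x * ln x * beta_avg th i (g x) t) = beta_avg th i (mix 1) t.
Proof.
move=> th1 t0.
have [c [Sc Hg HM]] := density_expansion a0 b0 C0 (ltW e0) se mp pC i.
pose f (z : measurableTypeR R * measurableTypeR R) : R :=
  p z.1 * ln z.1 * (derive1n i (g z.1) (t * z.2) * beta_weight th i z.2).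
have fE z : D12 z -> f z = \sum_(l < i.+1) c l (t * z.2) *
    (p z.1 * kappa l.+1 (t * z.2) z.1) * beta_weight th i z.2.
  case: z => x v [/=]; rewrite !in_itv/= andbT => x0 /andP[v0 v1].
  rewrite /f/= Hg ?mulr_gt0// mulr_suml mulr_sumr.
  by apply: eq_bigr => l _; rewrite /moment_kernel exprS; ring.
have mf : measurable_fun D12 f.
  apply: (@eq_measurable_fun _ _ _ _ _ (fun z => \sum_(l < i.+1) c l (t * z.2) *
      (p z.1 * kappa l.+1 (t * z.2) z.1) * beta_weight th i z.2)).
    by move=> z /set_mem Dz; rewrite fE.
  apply: measurable_sum => l; apply: measurable_funM; first apply: measurable_funM.
  - apply: (measurable_on_snd (f := fun v => c l (t * v))).
    by apply: measurable_scaled => //; exact: smooth_measurable (Sc l).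
  - by apply: measurable_funM; [exact: (measurable_on_fst mp)|exact: measurable_kappa].
  - apply: (measurable_on_snd (f := fun v => beta_weight th i v)); exact: measurable_beta_weight.
(* The times t v fill (0, t), so the moments must be dominated from L = 0 on, which is possible only
   because eps > 0. *)
have L0 : 0 < eps + b * 0 by rewrite mulr0 addr0.
have [K HK] := choice (fun l => smooth_bound t (Sc l)).
have [D HD] := choice (fun l => moment_dominated a0 b0 C0 pC l L0 (ltW t0)).
have K0 l : 0 <= K l by apply: le_trans (HK l t t0 _); rewrite ?normr_ge0.
pose B x := \sum_(l < i.+1) K l * D l.+1 x.
pose W v := (1 - v) `^ (- th).
have iB : mu.-integrable `]0, +oo[ (EFin \o B).
  have iBl (l : 'I_i.+1) : mu.-integrable `]0, +oo[ (EFin \o (fun x => K l * D l.+1 x)).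
    by apply: RintegrableZl => //; have [] := HD l.+1.
  exact: (Rintegrable_sum (index_enum 'I_i.+1) mpos iBl).
have iW : mu.-integrable `]0, 1[ (EFin \o W) by exact: one_sub_powR_integrable.
have D0 l x : 0 <= D l x by have [_ ->] := HD l.
have B0 x : `]0, +oo[%classic x -> 0 <= B x.
  by move=> _; apply: sumr_ge0 => l _; rewrite mulr_ge0.
have W0 v : `]0, 1[%classic v -> 0 <= W v by move=> _; rewrite powR_ge0.
have fBW x v : `]0, +oo[%classic x -> `]0, 1[%classic v -> `|f (x, v)| <= B x * W v.
  move=> Dx Dv; rewrite fE//; move: Dx Dv => /=.
  rewrite !in_itv/= andbT => x0 /andP[v0 v1].
  have tv0 : 0 < t * v by rewrite mulr_gt0.
  have tvt : t * v <= t by rewrite ler_piMr// ltW.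
  rewrite -mulr_suml normrM; apply: ler_pM => //; last exact: beta_weight_bound.
  apply: (le_trans (ler_norm_sum _ _ _)); apply: ler_sum => l _.
  rewrite normrM; apply: ler_pM => //; first exact: HK.
  by have [_ _] := HD l.+1; apply => //; exact: ltW.
have [H1 H2] := dominated_Fubini mpos munit mf iB iW B0 W0 fBW.
have E1 : {in `]0, +oo[%classic, (fun x => \int[mu]_(v in `]0, 1[) f (x, v)) =1
    (fun x => p x * ln x * beta_avg th i (g x) t)}.
  move=> x; rewrite inE/= in_itv/= andbT => x0.
  have bi := beta_integrable th1 i i (Sg x0) t0.
  by rewrite /beta_avg -(RintegralZl (p x * ln x) munit bi).
have E2 : {in `]0, 1[%classic, (fun v => \int[mu]_(x in `]0, +oo[) f (x, v)) =1
    (fun v => derive1n i (mix 1) (t * v) * beta_weight th i v)}.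
  move=> v; rewrite inE/= in_itv/= => /andP[v0 v1].
  have tv0 : 0 < t * v by rewrite mulr_gt0.
  have [I1 I2] := density_derive1n_integral a0 b0 C0 (ltW e0) se mp pC i tv0.
  rewrite -I2 mulrC -(RintegralZl (beta_weight th i v) mpos I1).
  by apply: eq_Rintegral => x _; rewrite /f/=; ring.
split.
  exact: (@eq_integrable _ _ R mu _ mpos _ _ (fun x xD => congr1 EFin (E1 x xD)) H1).
transitivity (\int[mu]_(x in `]0, +oo[) \int[mu]_(v in `]0, 1[) f (x, v)).
  by symmetry; apply: eq_Rintegral; exact: E1.
by rewrite H2; apply: eq_Rintegral; exact: E2.
Qed.

Section NonIntegerOrder.
Variable gam : R.
Hypotheses (g1 : 1 <= gam) (gN : gam \isn't a Num.nat).
Let g0 : 0 <= gam. Proof. exact: le_trans ler01 g1. Qed.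
Let gB0 : 0 <= gam - 1. Proof. by rewrite subr_ge0. Qed.
Let gBN : gam - 1 \isn't a Num.nat. Proof. by rewrite natB1. Qed.
Local Notation th := (RL_exponent gam).
Let th1 : th < 1. Proof. by have /andP[] := RL_exponent_itv g0 gN. Qed.

Let RL_integralB1 f u : RL_integral (gam - 1) f u = RL_integral gam f u.
Proof.
apply: eq_Rintegral => s _.
by rewrite /RL_kernel -/(RL_exponent (gam - 1)) -/(RL_exponent gam) RL_exponentB1.
Qed.

Lemma RL_integral_eq_pos (f h : R -> R) u : smooth true f -> smooth true h -> 0 < u ->
  (forall s : R, 0 < s -> f s = h s) -> RL_integral gam f u = RL_integral gam h u.
Proof.
move=> Sf Sh u0 fh; rewrite !RL_integralE//; congr (_ * _).
apply: eq_Rintegral => v; rewrite inE/= in_itv/= => /andP[v0 _].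
by rewrite /derive1n/= fh// mulr_gt0.
Qed.

Lemma RL_integral_lin (f h : R -> R) (c : R) u : smooth true f -> smooth true h -> 0 < u ->
  RL_integral gam (fun s => c * f s + c * h s) u =
  c * RL_integral gam f u + c * RL_integral gam h u.
Proof.
move=> Sf Sh u0; have Scf := smoothZ c Sf; have Sch := smoothZ c Sh.
rewrite !RL_integralE//; last exact: smoothD.
rewrite mulrCA [c * (_ * beta_avg _ _ h u)]mulrCA -mulrDr; congr (_ * _).
have i1 := beta_integrable th1 0 0 Sf u0; have i2 := beta_integrable th1 0 0 Sh u0.
rewrite /beta_avg -!RintegralZl// -RintegralD//; [|exact: RintegrableZl|exact: RintegrableZl].
by apply: eq_Rintegral => v _; rewrite /derive1n/=; ring.
Qed.

(** [RL_integral] is u^(1 - th) times a beta average, and the averages form a chain with factor 1.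
    [leibniz_expansion] then gives g x and [mix 1] the same coefficients, and each average is
    exchanged with the integral in x separately. *)
Lemma density_RL_integral N t : 0 < t ->
  mu.-integrable `]0, +oo[ (EFin \o
    (fun x => p x * ln x * derive1n N (RL_integral gam (g x)) t)) /\
  \int[mu]_(x in `]0, +oo[) (p x * ln x * derive1n N (RL_integral gam (g x)) t) =
    derive1n N (RL_integral gam (mix 1)) t.
Proof.
move=> t0; have [c [_ Hc]] := leibniz_expansion 1 N (@smooth_powRx R (1 - th)).
have RLE (f : R -> R) : smooth true f ->
    derive1n N (RL_integral gam f) t = \sum_(i < N.+1) c i t * beta_avg th i f t.
  move=> Sf; rewrite (derive1n_eq_pos N (fun y => RL_integralE g0 gN Sf (u := y)) t0).
  apply: (Hc (fun i => beta_avg th i f)) => //.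
  - by move=> i; exact/smooth_weaken/smooth_beta_avg.
  - by move=> i x x0; rewrite mul1r; exact: is_derive_derive1 (is_derive_beta_avg th1 i Sf x0).
have H i := density_beta_avg_integral i th1 t0.
have mi i : mu.-integrable `]0, +oo[ (EFin \o
    (fun x => c i t * (p x * ln x * beta_avg th i (g x) t))).
  by apply: RintegrableZl => //; have [] := H i.
have E : {in `]0, +oo[%classic,
    (fun x => p x * ln x * derive1n N (RL_integral gam (g x)) t) =1
    (fun x => \sum_(i < N.+1) c i t * (p x * ln x * beta_avg th i (g x) t))}.
  move=> x; rewrite inE/= in_itv/= andbT => x0; rewrite RLE; last exact: Sg.
  by rewrite mulr_sumr; apply: eq_bigr => i _; rewrite mulrCA.
split.
  have := Rintegrable_sum (index_enum 'I_N.+1) mpos (fun i => mi (nat_of_ord i)).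
  by apply: eq_integrable => // x xD /=; rewrite E.
transitivity (\int[mu]_(x in `]0, +oo[) (\sum_(i < N.+1) c i t * (p x * ln x * beta_avg th i
  (g x) t))).
  exact: eq_Rintegral.
rewrite Rintegral_sum// RLE//; apply: eq_bigr => i _.
by have [Hi1 Hi2] := H i; rewrite RintegralZl// Hi2.
Qed.

(** Orders gam and gam - 1 have the same kernel and the same Gamma factor and differ by one outer
    derivative. That derivative passes onto q, where [derive1_q] applies; linearity and the
    remaining N derivatives finish. *)
Lemma equation_nonnat : equation_well_defined a b gam p q /\ solves_equation a b gam p q.
Proof.
have cE : RL_ceil gam = (RL_ceil (gam - 1)).+1 by rewrite /RL_ceil (truncnB1 g1).
have GE : (RL_ceil gam)%:R - gam = (RL_ceil (gam - 1))%:R - (gam - 1).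
  by rewrite cE -natr1; ring.
set N := RL_ceil (gam - 1) in cE GE.
set G := (Gamma ((RL_ceil gam)%:R - gam))^-1.
have RLdE f t : RL_derive (gam - 1) f t = G * derive1n N (RL_integral gam f) t.
  have IE : RL_integral (gam - 1) f = RL_integral gam f.
    by apply/funext => u; exact: RL_integralB1.
  by rewrite /RL_derive (negbTE gBN) -/N -GE -/G IE.
(* The factor t of [norm_constE] gives the linear decay of q at 0 that the integration by parts
   needs. *)
have qK u : 0 < u -> exists K, forall s, 0 < s -> s <= u -> `|q s| <= K * s.
  move=> u0.
  have Sh : smooth true (fun s => b * (norm_constS a b s * M 0 s)).
    apply: smoothZ; apply: smoothM; first exact: smooth_norm_constS.
    exact: (smooth_moment 0 a0 b0 C0 (ltW e0) se mp pC).
  have [K HK] := smooth_bound u Sh; exists K => s s0 su.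
  rewrite qE// /mix (norm_constE a b0 s0).
  have -> : b * (s * norm_constS a b s) * M 0 s = b * (norm_constS a b s * M 0 s) * s by ring.
  by rewrite normrM (gtr0_norm s0) ler_pM2r// HK.
split.
  split.
  - rewrite /RL_derivable (negbTE gN); split; first by move=> u; exact: RL_kernel_integrable.
    by apply: smooth_n_derivable; exact: smooth_RL_integral.
  - rewrite /RL_derivable (negbTE gBN); split; first by move=> u; exact: RL_kernel_integrable.
    by apply: smooth_n_derivable; exact: smooth_RL_integral.
  - move=> x x0; rewrite /RL_derivable (negbTE gBN); split.
      by move=> u; apply: RL_kernel_integrable => //; exact: Sg.
    by apply: smooth_n_derivable; apply: smooth_RL_integral => //; exact: Sg.
  - move=> t t0; have [H _] := density_RL_integral N t0.
    have : mu.-integrable `]0, +oo[ (EFin \o (fun x => G *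
        (p x * ln x * derive1n N (RL_integral gam (g x)) t))) by exact: RintegrableZl.
    apply: eq_integrable => // x _ /=.
    by rewrite /density_integrand RLdE mulrCA.
move=> t t0; have [H1 H2] := density_RL_integral N t0.
have -> : \int[mu]_(x in `]0, +oo[) density_integrand a b gam p t x =
    G * derive1n N (RL_integral gam (mix 1)) t.
  rewrite -H2 -RintegralZl//; apply: eq_Rintegral => x _.
  by rewrite /density_integrand RLdE mulrCA.
rewrite RLdE /RL_derive (negbTE gN) -/G cE derive1Sn.
have E (u : R) : 0 < u -> derive1 (RL_integral gam q) u =
    b * RL_integral gam (drift_term a b q) u + b * RL_integral gam (mix 1) u.
  move=> u0; rewrite (derive1_RL_integral g0 gN Sq u0 (qK u u0)).
  rewrite -RL_integral_lin//; apply: RL_integral_eq_pos => //.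
  - exact: smooth_derive1.
  - by apply: smoothD; exact: smoothZ.
  - by move=> s s0; exact: (derive1_q a0 b0 C0 (ltW e0) se mp pC qE s0).
rewrite (derive1n_eq_pos N E t0).
have S1 := smooth_RL_integral g0 gN Sdrift.
have S2 := smooth_RL_integral g0 gN (Smix 1).
rewrite (smooth_derive1nD N (smoothZ b S1) (smoothZ b S2) t0).
rewrite (smooth_derive1nZ N b S1 t0) (smooth_derive1nZ N b S2 t0).
by rewrite mulrDr; congr (_ + _); exact: mulrCA.
Qed.

End NonIntegerOrder.
End FractionalMixture.

(** * Failure of integrability *)

Section NotWellDefined.
Context {R : realType}.
Local Notation mu := (@lebesgue_measure R).
Implicit Types (u s t x : R).

Lemma inv_not_integrable u : 0 < u -> ~ mu.-integrable `]0, u[ (EFin \o (fun s => s^-1)).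
Proof.
move=> u0 iu; pose J := \int[mu]_(s in `]0, u[) s^-1.
pose v := u / 2; have v0 : 0 < v by rewrite divr_gt0.
have vu : v < u by rewrite /v; lra.
(* Chosen so that the integral of 1/s over [eps, v] equals |J| + 1, more than the supposed total
   J. *)
pose eps := v * expR (- (`|J| + 1)).
have eps0 : 0 < eps by rewrite mulr_gt0 ?expR_gt0.
have epsv : eps < v by rewrite gtr_pMr// expR_lt1 oppr_lt0 ltr_wpDl.
have pos s : `[eps, v]%classic s -> 0 < s.
  by rewrite /= in_itv/= => /andP[es _]; exact: lt_le_trans es.
have dln s : `[eps, v]%classic s -> is_derive s 1 (@ln R) s^-1.
  by move=> /pos s0; exact: is_derive1_ln.
have cV s : `[eps, v]%classic s -> {for s, continuous (fun s : R => s^-1)}.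
  by move=> /pos s0; apply: inv_continuous; rewrite gt_eqF.
have DE : `[eps, v]%classic = \bigcup_(n : nat) `[eps, v]%classic.
  by apply/seteqP; split=> [x xv|x [_ _]//]; exists 0%N.
have ev (n : nat) : (fun=> eps) n < (fun=> v) n by [].
have sub : `[eps, v]%classic `<=` (`]0, u[%classic : set R).
  move=> s es; rewrite /= in_itv/= pos//=; move: es; rewrite /= in_itv/= => /andP[_ sv].
  exact: le_lt_trans sv vu.
have H : \int[mu]_(s in `[eps, v]) s^-1 = ln v - ln eps.
  by rewrite /Rintegral (compact_FTC ev DE dln cV 0%N).
have ie : mu.-integrable `[eps, v] (EFin \o (fun s => s^-1)) by apply: integrableS iu.
have : ln v - ln eps <= J.
  rewrite -H /J /Rintegral fine_le//; try exact: integrable_fin_num.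
  apply: ge0_subset_integral => //.
  - by have /integrableP[] := iu.
  - by move=> s; rewrite /= in_itv/= => /andP[s0 _]; rewrite lee_fin invr_ge0 ltW.
rewrite /eps lnM ?posrE ?expR_gt0// expRK opprD opprK addrA subrr add0r.
by move=> /le_trans/(_ (ler_norm J)); rewrite gerDl ler10.
Qed.

(** Near 0, digamma (b s) is -1 / (b s) up to a bounded term. If q stays above c0, the drift term is
    at least a multiple of 1/s, and integrability of its kernel would make 1/s integrable. *)
Lemma not_well_defined (a b gam c0 delta : R) (p q : R -> R) :
  0 < b -> 1 <= gam -> gam \isn't a Num.nat -> 0 < c0 -> 0 < delta ->
  (forall s, 0 < s -> s < delta -> c0 <= q s) -> ~ equation_well_defined a b gam p q.
Proof.
move=> b0 g1 gN c00 d0 qc [_ + _ _].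
rewrite /RL_derivable natB1// (negbTE gN) => -[+ _].
have gB0 : 0 <= gam - 1 by rewrite subr_ge0.
have gBN : gam - 1 \isn't a Num.nat by rewrite natB1.
have /andP[th0 th1] := RL_exponent_itv gB0 gBN.
set th := RL_exponent (gam - 1) in th0 th1.
have [K HK] := smooth_bound 1 (smooth_digammaS b0).
pose L := `|K| + `|ln a| + 1.
have L0 : 0 < L by rewrite ltr_wpDl// addr_ge0.
(* The bound K on digamma (b s + 1) holds for s <= 1 and q >= c0 below delta. The last entry gives 1
   / (2 b s) >= L, so half of the pole 1 / (b s) absorbs K and ln a. *)
pose u := Num.min (Num.min 1 delta) (2 * b * L)^-1.
have bL : 0 < 2 * b * L by rewrite !mulr_gt0.
have u0 : 0 < u by rewrite !lt_min ltr01 d0 invr_gt0.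
have ub : [/\ u <= 1, u <= delta & u <= (2 * b * L)^-1].
  by rewrite /u; split; rewrite !ge_min lexx ?orbT.
move=> /(_ u u0) iK.
have iK' : mu.-integrable `]0, u[ (EFin \o RL_kernel (gam - 1) (drift_term a b q) u).
  by apply: integrableS iK => //; exact: subset_itv_oo_cc.
apply: (inv_not_integrable u0).
(* On (0, u) the drift term is at least c0 / (2 b s) and (u - s)^(-th) >= u^(-th), so k times the
   kernel dominates 1/s. *)
pose k := (c0 / (2 * b) * u `^ (- th))^-1.
have k0 : 0 < c0 / (2 * b) * u `^ (- th) by rewrite mulr_gt0 ?powR_gt0// divr_gt0// mulr_gt0.
apply: (@le_Rintegrable _ _ R mu _ _
    (fun s => k * RL_kernel (gam - 1) (drift_term a b q) u s)) => //.
- apply: open_continuous_measurable_fun => // s; rewrite inE/= in_itv/= => /andP[s0 _].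
  by apply: inv_continuous; rewrite gt_eqF.
- move=> s /=; rewrite in_itv/= => /andP[s0 su]; have [u1 ud uL] := ub.
  rewrite gtr0_norm ?invr_gt0// /k mulrC ler_pdivlMr//.
  rewrite /RL_kernel -/(RL_exponent (gam - 1)) -/th -powRN.
  have bs : 0 < b * s by rewrite mulr_gt0.
  have dr : (2 * b * s)^-1 <= ln a - digamma (b * s).
    have Ks := HK s s0 (ltW (lt_le_trans su u1)).
    have -> : digamma (b * s) = digamma (b * s + 1) - (b * s)^-1 by rewrite digammaS// addrK.
    have h1 : L <= (2 * b * s)^-1.
      rewrite -[L]invrK lef_pV2 ?posrE ?invr_gt0 ?mulr_gt0//.
      rewrite -ler_pdivlMl ?mulr_gt0//.
      by apply: (le_trans (ltW (lt_le_trans su uL))); rewrite invfM.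
    have h2 : (b * s)^-1 = (2 * b * s)^-1 + (2 * b * s)^-1 by field; rewrite !gt_eqF.
    move: Ks; rewrite ler_norml => /andP[k1 k2].
    have := ler_norm K; have := ler_norm (- ln a); rewrite normrN.
    rewrite h2; rewrite /L in h1; lra.
  have -> : s^-1 * (c0 / (2 * b) * u `^ (- th)) = (2 * b * s)^-1 * c0 * u `^ (- th).
    by field; rewrite !gt_eqF.
  rewrite /drift_term.
  have r0 : 0 <= (2 * b * s)^-1 by rewrite invr_ge0 !mulr_ge0// ltW.
  apply: ler_pM; rewrite ?powR_ge0 ?mulr_ge0 ?(ltW c00)//.
    apply: ler_pM => //; rewrite ?(ltW c00)//.
    by apply: qc => //; exact: lt_le_trans su ud.
  rewrite !powRN lef_pV2 ?posrE ?powR_gt0 ?subr_gt0//.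
  apply: ge0_ler_powR; [exact: ltW| | |by rewrite gerBl ltW].
    by rewrite nnegrE subr_ge0 ltW.
  by rewrite nnegrE ltW.
- exact: RintegrableZl.
Qed.

End NotWellDefined.

(** * The law of the gamma subordinator *)

Section Bernstein.
Context {R : realType}.
Implicit Types (f g : nat -> R) (v : R).

(* Expectation of [f] of a binomial variable with parameters n and v. *)
Fixpoint bernstein (n : nat) f v : R :=
  if n is m.+1 then v * bernstein m (f \o succn) v + (1 - v) * bernstein m f v
  else f 0%N.

Lemma bernstein_lin n f g (c e : R) v :
  bernstein n (fun k => c * f k + e * g k) v = c * bernstein n f v + e * bernstein n g v.
Proof.
elim: n f g => [//|n IH] f g /=.
have -> : (fun k => c * f k + e * g k) \o succn =
  (fun k => c * (f \o succn) k + e * (g \o succn) k) by [].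
by rewrite !IH; ring.
Qed.

Lemma eq_bernstein n f g v : f =1 g -> bernstein n f v = bernstein n g v.
Proof. by move=> /funext ->. Qed.

Lemma bernstein_cst n (c : R) v : bernstein n (fun=> c) v = c.
Proof.
elim: n => [//|n IH] /=.
have -> : (fun=> c) \o succn = (fun=> c) by [].
by rewrite IH; ring.
Qed.

Lemma le_bernstein n f g v : 0 <= v -> v <= 1 -> (forall k, f k <= g k) ->
  bernstein n f v <= bernstein n g v.
Proof.
move=> v0 v1; elim: n f g => [|n IH] f g fg /=; first exact: fg.
by rewrite lerD// ler_wpM2l ?subr_ge0// IH// => k /=; exact: fg.
Qed.

Lemma bernstein_mean n v : bernstein n (fun k => k%:R - n%:R * v) v = 0.
Proof.
elim: n => [|n IH] /=; first by rewrite mul0r subrr.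
rewrite (_ : _ \o succn = fun k => 1 * (k%:R - n%:R * v) + (1 - v) * 1); last first.
  by apply/funext => k /=; rewrite -!natr1; ring.
rewrite (_ : (fun k => k%:R - n.+1%:R * v) = fun k => 1 * (k%:R - n%:R * v) + (- v) * 1);
  last first.
  by apply/funext => k /=; rewrite -!natr1; ring.
by rewrite !(bernstein_lin n _ (fun=> 1)) IH !bernstein_cst; ring.
Qed.

(** One more trial shifts the centred count by 1 - v or by -v; the mean being zero, the cross term
    disappears and variances add. *)
Lemma bernstein_variance n v : bernstein n (fun k => (k%:R - n%:R * v) ^+ 2) v = n%:R * (v *
  (1 - v)).
Proof.
elim: n => [|n IH] /=; first by rewrite !mul0r subrr expr0n.
pose f k : R := k%:R - n%:R * v.
have E (c : R) : bernstein n (fun k => (f k + c) ^+ 2) v = n%:R * (v * (1 - v)) + c ^+ 2.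
  rewrite (@eq_bernstein _ _ (fun k => 1 * f k ^+ 2 + 1 * ((2 * c) * f k + c ^+ 2 * 1)));
    last first.
    by move=> k; ring.
  rewrite bernstein_lin (bernstein_lin n f (fun=> 1)) bernstein_mean bernstein_cst IH.
  by ring.
rewrite (_ : _ \o succn = fun k => (f k + (1 - v)) ^+ 2); last first.
  by apply/funext => k /=; rewrite /f -!natr1; congr (_ ^+ 2); ring.
rewrite (_ : (fun k => (k%:R - n.+1%:R * v) ^+ 2) = fun k => (f k + - v) ^+ 2); last first.
  by apply/funext => k /=; rewrite /f -!natr1; congr (_ ^+ 2); ring.
by rewrite !E -natr1; ring.
Qed.

(** Chebyshev's argument in the form |x| <= eta + x^2 / eta, applied to x = k/(n+1) - v: the
    expectation of the square is v (1 - v) / (n + 1). *)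
Lemma bernstein_approx n (phi : R -> R) (L eta v : R) : 0 <= v -> v <= 1 -> 0 <= L -> 0 < eta ->
  (forall x y, `|phi x - phi y| <= L * `|x - y|) ->
  `|bernstein n.+1 (fun k => phi (k%:R / n.+1%:R)) v - phi v| <= L * (eta + (n.+1%:R * eta)^-1).
Proof.
move=> v0 v1 L0 eta0 Lphi.
pose h k := L * eta + (L / (eta * n.+1%:R ^+ 2)) * (k%:R - n.+1%:R * v) ^+ 2.
have hb k : `|phi (k%:R / n.+1%:R) - phi v| <= h k.
  apply: (le_trans (Lphi _ _)); rewrite /h -mulrA -mulrDr ler_wpM2l//.
  set x := k%:R / n.+1%:R - v.
  have -> : (eta * n.+1%:R ^+ 2)^-1 * (k%:R - n.+1%:R * v) ^+ 2 = `|x| ^+ 2 / eta.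
    rewrite real_normK ?num_real// /x; field.
    by rewrite !gt_eqF.
  have [xe|xe] := leP `|x| eta.
    by apply: (le_trans xe); rewrite lerDl divr_ge0 ?exprn_ge0// ltW.
  rewrite -[leLHS]add0r lerD ?(ltW eta0)// ler_pdivlMr// expr2 ler_wpM2l//.
  exact: ltW.
have bh : bernstein n.+1 h v <= L * (eta + (n.+1%:R * eta)^-1).
  rewrite (@eq_bernstein _ _ (fun k => (L * eta) * 1 + (L / (eta * n.+1%:R ^+ 2)) *
    (k%:R - n.+1%:R * v) ^+ 2)); last by move=> k; rewrite mulr1.
  rewrite bernstein_lin bernstein_cst bernstein_variance mulr1 [leRHS]mulrDr lerD2l.
  have -> : L / (eta * n.+1%:R ^+ 2) * (n.+1%:R * (v * (1 - v))) =
      L * (n.+1%:R * eta)^-1 * (v * (1 - v)) by field; rewrite !gt_eqF.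
  rewrite ler_piMr//; first by rewrite mulr_ge0// invr_ge0 mulr_ge0// ltW.
  by rewrite mulr_ile1// ?subr_ge0// gerBl.
have bE f : bernstein n.+1 (fun k => 1 * f k + (-1) * phi v) v = bernstein n.+1 f v - phi v.
  by rewrite (bernstein_lin _ _ (fun=> phi v)) bernstein_cst mul1r mulN1r.
pose A k := 1 * phi (k%:R / n.+1%:R) + (-1) * phi v.
have AE k : A k = phi (k%:R / n.+1%:R) - phi v by rewrite /A mul1r mulN1r.
have NE : - bernstein n.+1 A v = bernstein n.+1 (fun k => (-1) * A k + 0 * 0) v.
  by rewrite (bernstein_lin _ A (fun=> 0)) mul0r addr0 mulN1r.
rewrite -bE -/A ler_norml; apply/andP; split.
  rewrite lerNl NE; apply: le_trans bh; apply: le_bernstein => // k; apply: le_trans (hb k).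
  rewrite mul0r addr0 mulN1r AE; apply: le_trans (ler_norm _) _.
  by rewrite normrN.
apply: le_trans bh; apply: le_bernstein => // k; apply: le_trans (hb k).
by rewrite AE; exact: ler_norm.
Qed.

End Bernstein.

Section Clamp.
Context {R : realType}.
Implicit Types x y : R.

Lemma norm_min1_lipschitz x y : `|Num.min 1 x - Num.min 1 y| <= `|x - y|.
Proof.
wlog xy : x y / y <= x.
  by move=> H; have [/H//|/ltW/H] := leP y x; rewrite distrC (distrC y).
rewrite !ger0_norm ?subr_ge0// /Num.min; do !case: ltP => ?; lra.
Qed.

Lemma norm_max0_lipschitz x y : `|Num.max 0 x - Num.max 0 y| <= `|x - y|.
Proof.
wlog xy : x y / y <= x.
  by move=> H; have [/H//|/ltW/H] := leP y x; rewrite distrC (distrC y).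
rewrite !ger0_norm ?subr_ge0// /Num.max; do !case: ltP => ?; lra.
Qed.

End Clamp.

(** * Integrals against an image measure on [0, 1] *)

Section WeightedSpace.
Context {d} {T : measurableType d} {R : realType}.
Variables (mu : {measure set T -> \bar R}) (D : set T) (rho U : T -> R).
Hypotheses (mD : measurable D) (irho : mu.-integrable D (EFin \o rho)).
Hypotheses (rho0 : forall x, D x -> 0 <= rho x) (mU : measurable_fun D U).
Hypothesis U01 : forall x, D x -> 0 <= U x <= 1.

(** The integral of f under the image by U of the measure with density rho. This form covers e^(-Z
    t) under P and e^(-x) under the gamma density alike. *)
Definition weighted (f : R -> R) : R := \int[mu]_(x in D) (rho x * f (U x)).

Lemma weighted_bounded_integrable (f : R -> R) (K : R) : measurable_fun setT f ->
  (forall v, 0 <= v -> v <= 1 -> `|f v| <= K) ->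
  mu.-integrable D (EFin \o (fun x => rho x * f (U x))).
Proof.
move=> mf fK; have mrho := measurable_int _ irho.
apply: (@le_Rintegrable _ _ R mu _ _ (fun x => K * rho x)) => //.
- apply: measurable_funM; first exact/measurable_EFinP.
  exact: measurableT_comp.
- move=> x Dx; have /andP[u0 u1] := U01 Dx.
  by rewrite normrM (ger0_norm (rho0 Dx)) mulrC ler_wpM2r// ?rho0// fK.
- exact: RintegrableZl.
Qed.

Lemma measurable_bernstein n f : measurable_fun [set: R] (bernstein n f).
Proof.
elim: n f => [|n IH] f /=; first exact: measurable_cst.
apply: measurable_funD; apply: measurable_funM => //; exact: measurable_funB.
Qed.

Lemma weighted_expr_bernstein_integrable j n f :
  mu.-integrable D (EFin \o (fun x => rho x * (U x ^+ j * bernstein n f (U x)))).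
Proof.
have [K HK] : exists K, forall v, 0 <= v -> v <= 1 -> `|bernstein n f v| <= K.
  elim: n f => [|n IH] f; first by exists `|f 0%N|.
  have [K HK] := IH (f \o succn); have [L HL] := IH f.
  exists (K + L) => v v0 v1 /=; apply: (le_trans (ler_normD _ _)).
  have v10 : 0 <= 1 - v by rewrite subr_ge0.
  rewrite !normrM (ger0_norm v0) (ger0_norm v10); apply: lerD.
    by rewrite (le_trans _ (HK v v0 v1))// ler_piMl.
  by rewrite (le_trans _ (HL v v0 v1))// ler_piMl// gerBl.
apply: (weighted_bounded_integrable (f := fun v => v ^+ j * bernstein n f v) (K := K)).
  by apply: measurable_funM; [exact: measurable_funX|exact: measurable_bernstein].
move=> v v0 v1; rewrite normrM normrX (ger0_norm v0).
by rewrite (le_trans _ (HK v v0 v1))// ler_piMl// exprn_ile1.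
Qed.

(** A Lipschitz approximation, with constant m, of the indicator of v > c, to which it converges
    pointwise. *)
Definition ramp (c : R) (m : nat) (v : R) : R := Num.min 1 (Num.max 0 (m%:R * (v - c))).

Lemma ramp01 c m v : 0 <= ramp c m v <= 1.
Proof. by rewrite /ramp le_min ler01 le_max lexx ge_min lexx. Qed.

Lemma ramp_lipschitz c m x y : `|ramp c m x - ramp c m y| <= m%:R * `|x - y|.
Proof.
have m0 : 0 <= m%:R :> R by [].
rewrite /ramp; apply: le_trans (norm_min1_lipschitz _ _) _.
apply: le_trans (norm_max0_lipschitz _ _) _.
by rewrite -mulrBr opprB addrA subrK normrM (ger0_norm m0).
Qed.

Lemma measurable_ramp c m : measurable_fun [set: R] (ramp c m).
Proof.
apply: measurable_minr => //; apply: measurable_maxr => //.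
by apply: measurable_funM => //; exact: measurable_funB.
Qed.

Lemma weighted_ramp_integrable c m : mu.-integrable D (EFin \o (fun x => rho x * ramp c m (U x))).
Proof.
apply: (weighted_bounded_integrable (f := ramp c m) (K := 1)); first exact: measurable_ramp.
by move=> v _ _; have /andP[h0 h1] := ramp01 c m v; rewrite ger0_norm.
Qed.

Lemma weighted_ramp_cvg c : weighted (ramp c m) @[m --> \oo] --> weighted (fun v => (c < v)%R%:R).
Proof.
suff [] : mu.-integrable D (EFin \o (fun x => rho x * (c < U x)%R%:R)) /\
  \int[mu]_(x in D) (rho x * ramp c m (U x)) @[m --> \oo] -->
  \int[mu]_(x in D) (rho x * (c < U x)%R%:R) by [].
apply: (@Rdominated_cvg _ _ _ mu _ (fun m x => rho x * ramp c m (U x))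
  (fun x => rho x * (c < U x)%R%:R) rho) => //.
- by move=> m; apply/measurable_EFinP; exact: measurable_int (weighted_ramp_integrable c m).
- move=> x Dx; apply: cvgM; first exact: cvg_cst.
  apply: cvg_near_cst; have [cU|cU] := ltP c (U x).
    near=> m; apply/eqP; rewrite /ramp min_l// le_max; apply/orP; right.
    rewrite -ler_pdivrMr ?subr_gt0// div1r.
    by near: m; exact: nbhs_infty_ger.
  apply: nearW => m; apply/eqP; rewrite /ramp max_l ?min_r//.
  by rewrite mulr_ge0_le0// subr_le0.
- move=> m x Dx; have /andP[h0 h1] := ramp01 c m (U x).
  by rewrite normrM (ger0_norm (rho0 Dx)) (ger0_norm h0) ler_piMr// rho0.
Unshelve. all: end_near. Qed.

Lemma weighted_lipschitz n (phi : R -> R) (L eta : R) : 0 <= L -> 0 < eta ->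
  (forall x y, `|phi x - phi y| <= L * `|x - y|) ->
  measurable_fun setT phi -> mu.-integrable D (EFin \o (fun x => rho x * phi (U x))) ->
  `|weighted (bernstein n.+1 (fun k => phi (k%:R / n.+1%:R))) - weighted phi| <=
  L * (eta + (n.+1%:R * eta)^-1) * \int[mu]_(x in D) rho x.
Proof.
move=> L0 eta0 Lphi mphi iphi; set f := fun k : nat => phi (k%:R / n.+1%:R).
have ib : mu.-integrable D (EFin \o (fun x => rho x * bernstein n.+1 f (U x))).
  have := weighted_expr_bernstein_integrable 0 n.+1 f.
  by under eq_fun do rewrite expr0 mul1r.
rewrite /weighted -RintegralB//.
have iB : mu.-integrable D (EFin \o (fun x => rho x * bernstein n.+1 f (U x) + -1 *
  (rho x * phi (U x)))).
  by apply: RintegrableD => //; exact: RintegrableZl.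
have E : {in D, (fun x => rho x * bernstein n.+1 f (U x) - rho x * phi (U x)) =1
    (fun x => rho x * bernstein n.+1 f (U x) + -1 * (rho x * phi (U x)))}.
  by move=> x _; rewrite mulN1r.
rewrite (eq_Rintegral _ E); apply: (le_trans (le_normr_Rintegral mD iB)).
rewrite -RintegralZl//; apply: le_Rintegral => //.
- exact: (integrable_norm iB).
- exact: RintegrableZl.
- move=> x Dx; have /andP[u0 u1] := U01 Dx.
  rewrite mulN1r -mulrBr normrM (ger0_norm (rho0 Dx)) mulrC ler_wpM2r ?rho0//.
  exact: bernstein_approx.
Qed.

Lemma weighted_bernstein0 j f :
  weighted (fun v => v ^+ j * bernstein 0 f v) = f 0%N * weighted (fun v => v ^+ j).
Proof.
have iX : mu.-integrable D (EFin \o (fun x => rho x * U x ^+ j)).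
  apply: (weighted_bounded_integrable (f := fun v => v ^+ j) (K := 1)) => // v v0 v1.
  by rewrite normrX ger0_norm// exprn_ile1.
rewrite /weighted -RintegralZl//; apply: eq_Rintegral => x _ /=.
by rewrite mulrA mulrC.
Qed.

(** Carrying the power v^j turns multiplication by v or by 1 - v into shifts of j, so the recursion
    on n ends in pure moments. *)
Lemma weighted_bernsteinS j n f :
  weighted (fun v => v ^+ j * bernstein n.+1 f v) =
  weighted (fun v => v ^+ j.+1 * bernstein n (f \o succn) v) +
  (weighted (fun v => v ^+ j * bernstein n f v) +
   -1 * weighted (fun v => v ^+ j.+1 * bernstein n f v)).
Proof.
have i1 := weighted_expr_bernstein_integrable j.+1 n (f \o succn).
have i2 := weighted_expr_bernstein_integrable j n f.
have i3 := weighted_expr_bernstein_integrable j.+1 n f.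
have i3' := RintegrableZl (-1) mD i3.
rewrite /weighted -(RintegralZl (-1) mD i3) -RintegralD// -RintegralD//; last exact: RintegrableD.
by apply: eq_Rintegral => x _ /=; rewrite exprS; ring.
Qed.

End WeightedSpace.

(** * A finite measure on [0, 1] is determined by its moments *)

Section MomentUniqueness.
Context {d1 d2} {T1 : measurableType d1} {T2 : measurableType d2} {R : realType}.
Variables (m1 : {measure set T1 -> \bar R}) (D1 : set T1) (rho1 U1 : T1 -> R).
Variables (m2 : {measure set T2 -> \bar R}) (D2 : set T2) (rho2 U2 : T2 -> R).
Hypotheses (mD1 : measurable D1) (irho1 : m1.-integrable D1 (EFin \o rho1)).
Hypotheses (rho10 : forall x, D1 x -> 0 <= rho1 x) (mU1 : measurable_fun D1 U1).
Hypothesis U101 : forall x, D1 x -> 0 <= U1 x <= 1.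
Hypotheses (mD2 : measurable D2) (irho2 : m2.-integrable D2 (EFin \o rho2)).
Hypotheses (rho20 : forall x, D2 x -> 0 <= rho2 x) (mU2 : measurable_fun D2 U2).
Hypothesis U201 : forall x, D2 x -> 0 <= U2 x <= 1.
Hypothesis moments : forall k : nat,
  \int[m1]_(x in D1) (rho1 x * U1 x ^+ k) = \int[m2]_(x in D2) (rho2 x * U2 x ^+ k).

Lemma moments_bernstein j n f :
  weighted m1 D1 rho1 U1 (fun v => v ^+ j * bernstein n f v) =
  weighted m2 D2 rho2 U2 (fun v => v ^+ j * bernstein n f v).
Proof.
elim: n j f => [|n IH] j f.
  by rewrite !weighted_bernstein0// /weighted moments.
by rewrite !weighted_bernsteinS// !IH.
Qed.

Lemma moment_uniqueness (c : R) :
  \int[m1]_(x in D1) (rho1 x * (c < U1 x)%R%:R) = \int[m2]_(x in D2) (rho2 x * (c < U2 x)%R%:R).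
Proof.
have H m : weighted m1 D1 rho1 U1 (ramp c m) = weighted m2 D2 rho2 U2 (ramp c m).
  set W1 := weighted m1 _ _ _ _; set W2 := weighted m2 _ _ _ _.
  have L0 : 0 <= m%:R :> R by [].
  pose I := m%:R * (\int[m1]_(x in D1) rho1 x + \int[m2]_(x in D2) rho2 x).
  have I0 : 0 <= I by rewrite mulr_ge0// addr_ge0//; apply: Rintegral_ge0.
  have B (n : nat) (eta : R) : 0 < eta -> `|W1 - W2| <= I * (eta + (n.+1%:R * eta)^-1).
    move=> eta0; set f := fun k : nat => ramp c m (k%:R / n.+1%:R).
    have Lr := ramp_lipschitz c m.
    have b1 := weighted_lipschitz mD1 irho1 rho10 mU1 U101 n L0 eta0 Lr (measurable_ramp c m)
      (weighted_ramp_integrable mD1 irho1 rho10 mU1 U101 c m).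
    have b2 := weighted_lipschitz mD2 irho2 rho20 mU2 U201 n L0 eta0 Lr (measurable_ramp c m)
      (weighted_ramp_integrable mD2 irho2 rho20 mU2 U201 c m).
    have E : weighted m1 D1 rho1 U1 (bernstein n.+1 f) = weighted m2 D2 rho2 U2 (bernstein n.+1 f).
      by have := moments_bernstein 0 n.+1 f; rewrite /weighted;
        under eq_Rintegral do rewrite expr0 mul1r;
          under [in RHS]eq_Rintegral do rewrite expr0 mul1r.
    rewrite -/W1 -/f in b1; rewrite -/W2 -/f -E in b2.
    rewrite -(subrK (weighted m1 D1 rho1 U1 (bernstein n.+1 f)) W1) -addrA.
    apply: (le_trans (ler_normD _ _)); rewrite distrC.
    apply: (le_trans (lerD b1 b2)); rewrite -mulrDr /I.
    by rewrite mulrAC.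
  apply/eqP; rewrite -subr_eq0 -normr_eq0; apply/negPn/negP => W0.
  have W0' : 0 < `|W1 - W2| by rewrite lt_neqAle eq_sym W0 normr_ge0.
  have I1 : 0 < I + 1 by rewrite ltr_wpDl.
  (* Once n + 1 >= eta^(-2), the bound [B] is at most 2 I eta, strictly less than 4 (I + 1) eta =
     |W1 - W2|. *)
  have [eta eta0 etaE] : exists2 eta : R, 0 < eta & `|W1 - W2| = eta * (4 * (I + 1)).
    exists (`|W1 - W2| / (4 * (I + 1))); first by rewrite divr_gt0// mulr_gt0.
    by rewrite divfK// gt_eqF// mulr_gt0.
  have [n nE] : exists n : nat, (n.+1%:R * eta)^-1 <= eta.
    exists (Num.truncn (eta ^- 2)).
    rewrite -[leLHS]mul1r ler_pdivrMr ?mulr_gt0 ?ltr0n// mulrCA -expr2.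
    by rewrite -ler_pdivrMr ?exprn_gt0// div1r ltW// truncnS_gt.
  have := B n eta eta0; rewrite leNgt => /negP; apply.
  have h : I * (eta + (n.+1%:R * eta)^-1) <= I * (2 * eta).
    by apply: ler_wpM2l => //; rewrite [leRHS](_ : _ = eta + eta) ?lerD2l//; ring.
  apply: (le_lt_trans h).
  rewrite etaE mulrCA mulrA (mulrC eta).
  rewrite (_ : 4 * (I + 1) * eta = 2 * I * eta + (2 * I * eta + 4 * eta)); last by ring.
  by rewrite ltrDl -mulrA; lra.
have c1 := weighted_ramp_cvg (c := c) mD1 irho1 rho10 mU1 U101.
have c2 := weighted_ramp_cvg (c := c) mD2 irho2 rho20 mU2 U201.
rewrite (_ : (fun m => _) = (fun m => weighted m2 D2 rho2 U2 (ramp c m))) in c1; last exact/funext.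
exact: (cvg_unique _ c1 c2).
Qed.

End MomentUniqueness.

(** * Laplace transform and distribution function of the gamma subordinator *)

Section GammaLaw.
Context {R : realType}.
Local Notation mu := (@lebesgue_measure R).

Lemma Gamma_scale (c r : R) : 0 < c -> 0 < r ->
  \int[mu]_(x in `]0, +oo[) (x `^ (r - 1) * expR (- (c * x))) = Gamma r / c `^ r.
Proof.
move=> c0 r0; have gi := gamma_integrand_integrable r0.
have ci := gamma_integrable r0 c0.
have mpos : measurable (`]0, +oo[%classic : set (measurableTypeR R)) by [].
rewrite /Gamma (Rintegral_scale c0 mpos gi).
have -> : (fun v => c * v) @^-1` `]0, +oo[%classic = (`]0, +oo[%classic : set R).
  by apply/seteqP; split=> v /=; rewrite !in_itv/= !andbT pmulr_rgt0.
transitivity (c * \int[mu]_(x in `]0, +oo[) (c `^ (r - 1) * (x `^ (r - 1) * expR (-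
  (c * x)))) / c `^ r); last first.
  congr (c * _ / _); apply: eq_Rintegral => x; rewrite inE/= in_itv/= andbT => x0.
  by rewrite powRM ?(ltW c0) ?(ltW x0)// mulrA.
rewrite (RintegralZl _ mpos ci) mulrA mulr_powRB1 ?(ltW c0)// mulrAC divff ?mul1r//.
by rewrite gt_eqF// powR_gt0.
Qed.

Variables (a b : R).
Hypotheses (a0 : 0 < a) (b0 : 0 < b).

Lemma gamma_density_integrable t : 0 < t ->
  mu.-integrable `]0, +oo[ (EFin \o (fun x => gamma_density a b x t)).
Proof.
move=> t0; have bt : 0 < b * t by rewrite mulr_gt0.
have : mu.-integrable `]0, +oo[ (EFin \o (fun x => norm_const a b t *
    (x `^ (b * t - 1) * expR (- (a * x))))).
  by apply: RintegrableZl => //; exact: gamma_integrable.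
apply: eq_integrable => // x _ /=.
by rewrite /gamma_density mulrA.
Qed.

Lemma gamma_density_ge0 x t : 0 < t -> 0 <= gamma_density a b x t.
Proof.
move=> t0; rewrite /gamma_density !mulr_ge0 ?powR_ge0 ?expR_ge0// invr_ge0 ltW//.
by rewrite Gamma_gt0// mulr_gt0.
Qed.

Lemma gamma_laplace s t : 0 <= s -> 0 < t ->
  \int[mu]_(x in `]0, +oo[) (gamma_density a b x t * expR (- (s * x))) =
  expR (- (t * (b * ln (1 + s / a)))).
Proof.
move=> s0 t0; have bt : 0 < b * t by rewrite mulr_gt0.
have as0 : 0 < a + s by rewrite ltr_pwDl.
have mpos : measurable (`]0, +oo[%classic : set (measurableTypeR R)) by [].
transitivity (\int[mu]_(x in `]0, +oo[) (norm_const a b t *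
    (x `^ (b * t - 1) * expR (- ((a + s) * x))))).
  apply: eq_Rintegral => x _; rewrite /gamma_density -!mulrA; congr (_ * (_ * (_ * _))).
  by rewrite -expRD; congr expR; ring.
rewrite (RintegralZl _ mpos (gamma_integrable bt as0)) Gamma_scale// /norm_const.
have G0 := Gamma_gt0 bt.
rewrite mulrA divfK ?gt_eqF// !powR_expRE// -expRN -expRD; congr expR.
rewrite (_ : 1 + s / a = (a + s) / a); last by field; rewrite gt_eqF.
by rewrite ln_div ?posrE//; ring.
Qed.

Context {d : measure_display} {T : measurableType d}.
Variables (P : probability T R) (Z : R -> T -> R).
Hypothesis hZ : gamma_subordinator P a b Z.

Lemma subordinator_ge0 t w : 0 <= t -> 0 <= Z t w.
Proof.
move=> t0; have [[lZ mono] _] := hZ.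
by rewrite -(levy_start lZ w); exact: mono.
Qed.

Lemma Rintegral_indicator (A : set T) : measurable A ->
  \int[P]_w (w \in A)%:R = fine (P A) :> R.
Proof.
move=> mA; rewrite /Rintegral; congr fine.
by have := integral_indic P measurableT mA; rewrite setIT => <-.
Qed.

(** Z t < y means e^(-y) < e^(-Z t), an upper level set of a [0, 1]-valued variable whose k-th
    moment is the Laplace transform of Z t at k. *)
Lemma gamma_law t y : 0 < t -> fine (P [set w | Z t w < y]) =
  \int[mu]_(x in `]0, +oo[) (gamma_density a b x t * (x < y)%R%:R).
Proof.
move=> t0; have [[lZ mono] LZ] := hZ.
have mZ : measurable_fun [set: T] (Z t) by exact: (levy_measurable lZ (ltW t0)).
have mU1 : measurable_fun [set: T] (fun w => expR (- Z t w)).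
  by apply: (measurableT_comp (@measurable_expR R)) => //; exact: measurableT_comp.
have mU2 : measurable_fun (`]0, +oo[%classic : set R) (fun x : R => expR (- x)).
  by apply: (measurableT_comp (@measurable_expR R)) => //; exact: measurableT_comp.
have mpos : measurable (`]0, +oo[%classic : set (measurableTypeR R)) by [].
have i1 : P.-integrable [set: T] (EFin \o (fun=> 1 : R)).
  exact: finite_measure_integrable_cst.
have i2 := gamma_density_integrable t0.
have U1b w : [set: T] w -> 0 <= expR (- Z t w) <= 1.
  by move=> _; rewrite expR_ge0 expR_le1 oppr_le0 subordinator_ge0// ltW.
have U2b (x : R) : `]0, +oo[%classic x -> 0 <= expR (- x) <= 1.
  by rewrite /= in_itv/= andbT => x0; rewrite expR_ge0 expR_le1 oppr_le0 ltW.
have g0 (x : R) : `]0, +oo[%classic x -> 0 <= gamma_density a b x t.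
  by move=> _; exact: gamma_density_ge0.
have mom k : \int[P]_(w in [set: T]) (1 * expR (- Z t w) ^+ k) =
    \int[mu]_(x in `]0, +oo[) (gamma_density a b x t * expR (- x) ^+ k).
  have k0 : 0 <= k%:R :> R by [].
  transitivity (expR (- (t * (b * ln (1 + k%:R / a))))).
    have := LZ k%:R t k0 (ltW t0); rewrite unlock => H.
    rewrite /Rintegral -[RHS]/(fine (_%:E)) -H; congr fine.
    by apply: eq_integral => w _; rewrite mul1r -expRM_natl mulrN.
  rewrite -(gamma_laplace k0 t0); apply: eq_Rintegral => x _.
  by rewrite -expRM_natl mulrN.
have := @moment_uniqueness _ _ _ _ R P setT (fun=> 1) _ mu _ (fun x => gamma_density a b x t) _
  measurableT i1 (fun _ _ => ler01) mU1 U1b mpos i2 g0 mU2 U2b mom (expR (- y)).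
move=> H.
have mA : measurable [set w | Z t w < y].
  by rewrite -[X in measurable X]setTI; exact: (mZ measurableT `]-oo, y[%classic
    (measurable_itv _)).
rewrite -Rintegral_indicator//.
transitivity (\int[P]_w (1 * (expR (- y) < expR (- Z t w))%R%:R)).
  apply: eq_Rintegral => w _; rewrite mul1r ltr_expR ltrN2.
  by have -> : (w \in [set w | Z t w < y]) = (Z t w < y) by apply/idP/idP; rewrite inE.
rewrite H; apply: eq_Rintegral => x _.
by rewrite ltr_expR ltrN2.
Qed.

End GammaLaw.

(** * Subordination by discretisation *)

Section Grid.
Context {R : realType}.
Implicit Types (x y : R) (m j : nat).

Definition grid m j : R := j.+1%:R / m.+1%:R.
Definition cell m x : nat := Num.truncn (m.+1%:R * x).
(** The right end of the cell of mesh 1/(m+1) containing x. It is strictly above x, so right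
    continuity applies as m grows. *)
Definition disc m x : R := grid m (cell m x).

Lemma grid_gt0 m j : 0 < grid m j.
Proof. by rewrite divr_gt0 ?ltr0n. Qed.

Lemma cellP m j x : 0 <= x -> (cell m x == j) = (j%:R / m.+1%:R <= x) && (x < grid m j).
Proof.
move=> x0; have m0 : 0 < m.+1%:R :> R by rewrite ltr0n.
have mx0 : 0 <= m.+1%:R * x by rewrite mulr_ge0// ltW.
rewrite /grid ler_pdivrMr// ltr_pdivlMr// (mulrC x).
apply/eqP/andP => [<-|]; first by apply/andP; exact: truncn_itv.
by move=> ?; apply: truncn_def; apply/andP.
Qed.

Lemma disc_itv m x : 0 <= x -> x < disc m x <= x + m.+1%:R^-1.
Proof.
move=> x0; have := cellP m (cell m x) x0; rewrite eqxx => /esym/andP[h1 h2].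
rewrite /disc h2/= /grid -natr1 mulrDl mul1r lerD2r//.
Qed.

Lemma disc_cvg_right (f : R -> R) x (l : R) : 0 <= x -> f y @[y --> x^'+] --> l ->
  f (disc m x) @[m --> \oo] --> l.
Proof.
move=> x0 fl; apply: ((cvg_at_rightP _ _ _).1 fl (fun m => disc m x)); split.
  by move=> m; have /andP[] := disc_itv m x0.
apply: (@squeeze_cvgr _ _ _ _ (fun=> x) (fun m => x + m.+1%:R^-1)).
- by apply: nearW => m; have /andP[/ltW -> ->] := disc_itv m x0.
- exact: cvg_cst.
- by rewrite -[X in _ --> X]addr0; apply: cvgD; [exact: cvg_cst|exact: cvg_harmonic].
Qed.

End Grid.

Section CellMeasurable.
Context {d : measure_display} {T : measurableType d} {R : realType}.
Variables (D : set T) (W : T -> R).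
Hypotheses (mD : measurable D) (mW : measurable_fun D W) (W0 : forall w, D w -> 0 <= W w).
Implicit Types (m j : nat).

Definition cell_set m j : set T := D `&` [set w | cell m (W w) = j].

Lemma cell_setE m j : cell_set m j = D `&` W @^-1` `[j%:R / m.+1%:R, grid m j[%classic.
Proof.
apply/seteqP; split=> w /= [Dw].
  by move/eqP; rewrite cellP ?W0// in_itv.
by rewrite in_itv/= -cellP ?W0// => /eqP.
Qed.

Lemma measurable_cell_set m j : measurable (cell_set m j).
Proof. by rewrite cell_setE; exact: mW. Qed.

Lemma cell_setU m : \bigcup_j cell_set m j = D.
Proof.
apply/seteqP; split=> w; first by move=> [j _ []].
by move=> Dw; exists (cell m (W w)).
Qed.

Lemma cell_set_trivIset m : trivIset setT (cell_set m).
Proof. by move=> i j _ _ [w [[_ /= <-] [_ /= <-]]]. Qed.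

Lemma measurable_cell m (F : nat -> T -> R) : (forall j, measurable_fun D (F j)) ->
  measurable_fun D (fun w => F (cell m (W w)) w).
Proof.
move=> mF; rewrite -(cell_setU m).
apply/(measurable_fun_bigcup _ (measurable_cell_set m)) => j.
apply: (@eq_measurable_fun _ _ _ _ _ (F j)).
  by move=> w; rewrite inE => -[_ /= ->].
by apply: measurable_funS (mF j) => // w [].
Qed.

Lemma measurable_fun_Rcvg (f_ : nat -> T -> R) (f : T -> R) :
  (forall m, measurable_fun D (f_ m)) ->
  (forall w, D w -> f_ m w @[m --> \oo] --> f w) -> measurable_fun D f.
Proof.
move=> mf cf; apply/measurable_EFinP.
apply: (emeasurable_fun_cvg (fun m => EFin \o f_ m)) => [m|w Dw].
  exact/measurable_EFinP.
by apply: cvg_EFin; [exact: nearW|exact: cf].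
Qed.

Variable mu : {measure set T -> \bar R}.

(** Stated with a weight so that the same sum over cells describes both an expectation under P and
    an integral against the gamma density. *)
Lemma cell_integral m (h : nat -> R) (rho : T -> R) : (forall j, 0 <= h j) ->
  measurable_fun D rho -> (forall w, D w -> 0 <= rho w) ->
  (\int[mu]_(w in D) (rho w * h (cell m (W w)))%:E =
   \sum_(j <oo) ((h j)%:E * \int[mu]_(w in cell_set m j) (rho w)%:E))%E.
Proof.
move=> h0 mrho rho0.
have mF : measurable_fun (\bigcup_j cell_set m j) (fun w => (rho w * h (cell m (W w)))%:E).
  rewrite cell_setU; apply/measurable_EFinP; apply: measurable_funM => //.
  by apply: (measurable_cell m (F := fun j _ => h j)) => j.
have F0 w : (\bigcup_j cell_set m j) w -> (0 <= (rho w * h (cell m (W w)))%:E)%E.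
  by rewrite cell_setU => Dw; rewrite lee_fin mulr_ge0// rho0.
have mc := measurable_cell_set m.
rewrite -{1}(cell_setU m) (ge0_integral_bigcup mu mc mF F0 (@cell_set_trivIset m)).
apply: eq_eseriesr => j _.
rewrite -ge0_integralZl//.
- apply: eq_integral => w; rewrite inE => -[_ /= ->].
  by rewrite -EFinM mulrC.
- by apply/measurable_EFinP; apply: measurable_funS mrho => // w [].
- by move=> w [Dw _]; rewrite lee_fin rho0.
- by rewrite lee_fin.
Qed.

End CellMeasurable.

(** * A process evaluated at a random time *)

Section Composition.
Context {d : measure_display} {T : measurableType d} {R : realType}.
Variables (P : probability T R) (X : R -> T -> R).
Hypothesis mX : forall t : R, 0 <= t -> measurable_fun setT (X t).
Hypothesis rcX : forall (t : R) w, 0 <= t -> X s w @[s --> t^'+] --> X t w.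
Implicit Types (W : T -> R) (n : int).

Lemma measurable_disc_compose m W : measurable_fun setT W -> (forall w, 0 <= W w) ->
  measurable_fun setT (fun w => X (disc m (W w)) w).
Proof.
move=> mW W0; apply: (measurable_cell measurableT mW (fun w _ => W0 w) m
  (F := fun j w => X (grid m j) w)) => j.
by apply: mX; rewrite ltW// grid_gt0.
Qed.

Lemma measurable_compose W : measurable_fun setT W -> (forall w, 0 <= W w) ->
  measurable_fun setT (fun w => X (W w) w).
Proof.
move=> mW W0; apply: (measurable_fun_Rcvg (f_ := fun m w => X (disc m (W w)) w)).
  by move=> m; exact: measurable_disc_compose.
by move=> w _; apply: (disc_cvg_right (f := fun s => X s w)) => //; exact: rcX.
Qed.

Lemma measurable_eq_int (V : T -> R) n : measurable_fun setT V ->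
  measurable [set w | V w = n%:~R].
Proof.
move=> mV; rewrite (_ : [set w | _] = V @^-1` [set n%:~R])//.
by rewrite -[X in measurable X]setTI; exact: mV.
Qed.

(** On each cell of W the process is read at a deterministic time, so independence of X t and W at
    fixed t factors every term of the partition. *)
Lemma disc_compose_prob m n W : measurable_fun setT W -> (forall w, 0 <= W w) ->
  (forall (t : R) (A B : set R), 0 <= t -> measurable A -> measurable B ->
    P (X t @^-1` A `&` W @^-1` B) = (P (X t @^-1` A) * P (W @^-1` B))%E) ->
  (P [set w | X (disc m (W w)) w = n%:~R] =
   \int[P]_w (state_prob P X n (disc m (W w)))%:E)%E.
Proof.
move=> mW W0 ind.
have W0' w : [set: T] w -> 0 <= W w by [].
have p0 t : 0 <= state_prob P X n t by rewrite fine_ge0.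
have := cell_integral (D := setT) measurableT mW W0' P m (h := fun j => state_prob P X n (grid m j))
  (rho := fun=> 1) (fun j => p0 _) (measurable_cst _) (fun _ _ => ler01).
under eq_integral do rewrite mul1r.
move=> ->.
rewrite (_ : [set w | _] = \bigcup_j (cell_set setT W m j `&` [set w | X (grid m j) w = n%:~R])).
  have mj j : measurable [set w | X (grid m j) w = n%:~R].
    by apply: measurable_eq_int; apply: mX; rewrite ltW// grid_gt0.
  rewrite measure_bigcup//.
  - rewrite (@eq_eseriesl _ _ xpredT); last by move=> j; rewrite in_setT.
    apply: eq_eseriesr => j _.
    rewrite setIC cell_setE// setTI.
    have j0 : 0 <= grid m j :> R by rewrite ltW// grid_gt0.
    rewrite -[LHS]/(P (X (grid m j) @^-1` [set n%:~R] `&`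
      W @^-1` `[j%:R / m.+1%:R, grid m j[%classic)).
    rewrite (ind _ [set n%:~R] `[j%:R / m.+1%:R, grid m j[%classic j0)//.
    have pf := fin_num_measure P _ (mj j).
    rewrite /state_prob (fineK pf); congr (_ * _)%E.
    by rewrite integral_cst// ?mul1e// -[X in measurable X]setTI; exact: mW.
  - by move=> j _; apply: measurableI => //; exact: measurable_cell_set.
  - by move=> i j _ _ [w [[[_ /= <-] _] [[_ /= <-] _]]].
apply/seteqP; split=> w /=.
  by move=> Xn; exists (cell m (W w)) => //; split => //.
by move=> [j _ [[_ /= <-]]].
Qed.

(* Outside [N] the paths take integer values, so by right continuity the event
   [X (disc m (W w)) w = n] is eventually decided by [X (W w) w]. *)
Variable N : set T.
Hypotheses (mN : measurable N) (PN : P N = 0%E).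
Hypothesis intX : forall (t : R) w, 0 <= t -> ~ N w -> X t w \is a Num.int.

Lemma disc_compose_cvg n W : measurable_fun setT W -> (forall w, 0 <= W w) ->
  fine (P [set w | X (disc m (W w)) w = n%:~R]) @[m --> \oo] -->
  fine (P [set w | X (W w) w = n%:~R]).
Proof.
move=> mW W0.
have mCN : measurable (~` N) by exact: measurableC.
have PE (V : T -> R) : measurable_fun setT V -> fine (P [set w | V w = n%:~R]) =
    \int[P]_(w in ~` N) (V w == n%:~R)%:R.
  move=> mV; have mA := measurable_eq_int n mV.
  have -> : P [set w | V w = n%:~R] = P ([set w | V w = n%:~R] `&` ~` N).
    rewrite [LHS](measureDI P mA mN) setDE.
    rewrite [X in (_ + X)%E](_ : _ = 0%E) ?adde0//.
    apply/eqP; rewrite -measure_le0 -PN; apply: le_measure; rewrite ?inE//.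
    exact: measurableI.
  rewrite -(integral_indic P mCN mA) /Rintegral; congr fine; apply: eq_integral => w _.
  rewrite indicE.
  by have -> : (w \in [set w | V w = n%:~R]) = (V w == n%:~R) by apply/idP/eqP; rewrite inE.
rewrite PE; last exact: measurable_compose.
rewrite (_ : (fun m => fine _) =
    (fun m => \int[P]_(w in ~` N) (X (disc m (W w)) w == n%:~R)%:R)); last first.
  by apply/funext => m; rewrite PE//; exact: measurable_disc_compose.
refine (proj2 (@Rdominated_cvg _ _ R P (~` N)
  (fun m w => (X (disc m (W w)) w == n%:~R)%:R)
  (fun w => (X (W w) w == n%:~R)%:R) (fun=> 1) mCN _ _ _ _)).
- move=> m; apply: (@measurable_funS _ _ _ _ setT) => //.
  have mA := measurable_eq_int n (measurable_disc_compose m mW W0).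
  have := measurable_indic (D := setT) (R := R) mA; apply: eq_measurable_fun => w _.
  rewrite indicE; set A := [set w | _].
  by have -> : (w \in A) = (X (disc m (W w)) w == n%:~R) by apply/idP/eqP; rewrite inE.
- move=> w Nw; apply: cvg_near_cst.
  have cX : X (disc m (W w)) w @[m --> \oo] --> X (W w) w.
    by apply: (disc_cvg_right (f := fun s => X s w)) => //; exact: rcX.
  have := cX => /cvgrPdist_lt/(_ 1 ltr01); apply: filterS => m Hm.
  have d0 : 0 <= disc m (W w) :> R by rewrite ltW// grid_gt0.
  suff -> : X (disc m (W w)) w = X (W w) w by [].
  apply/eqP; rewrite eq_sym -subr_eq0; apply/negPn/negP => ne.
  have := norm_intr_ge1 (rpredB (intX (W0 w) Nw) (intX d0 Nw)) ne.
  by rewrite leNgt Hm.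
- exact: finite_measure_integrable_cst.
- by move=> m w _; case: eqP => _; rewrite ?normr1 ?normr0.
Qed.

End Composition.

(** * The generalized fractional Skellam process *)

Section RealProbability.
Context {d : measure_display} {T : measurableType d} {R : realType}.
Variable P : probability T R.
Implicit Types A B : set T.

Lemma fine_prob_ge0 A : 0 <= fine (P A).
Proof. by rewrite fine_ge0. Qed.

Lemma le_fine_prob A B : measurable A -> measurable B -> A `<=` B ->
  fine (P A) <= fine (P B).
Proof. by move=> mA mB AB; rewrite fine_le ?fin_num_measure// le_measure ?inE. Qed.

Lemma fine_prob_le1 A : measurable A -> fine (P A) <= 1.
Proof.
by move=> mA; rewrite -lee_fin fineK ?fin_num_measure//; exact: probability_le1.
Qed.

Lemma fine_probU A B : measurable A -> measurable B ->
  fine (P (A `|` B)) <= fine (P A) + fine (P B).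
Proof.
move=> mA mB; have mAB : measurable (A `|` B) by exact: measurableU.
by rewrite -fineD ?fin_num_measure// fine_le ?fin_numD ?fin_num_measure// measureU2.
Qed.

Lemma fine_prob_bigU (A : nat -> set T) n : (forall i, measurable (A i)) ->
  fine (P (\big[setU/set0]_(i < n) A i)) <= \sum_(i < n) fine (P (A i)).
Proof.
move=> mA; elim: n => [|n IH]; first by rewrite !big_ord0 measure0.
rewrite !big_ord_recr/=; apply: le_trans (fine_probU _ (mA n)) _.
  exact: bigsetU_measurable.
by rewrite lerD2r.
Qed.

End RealProbability.

Section IntegerValued.
Context {R : realType}.

Lemma cvg_int (u : nat -> R) (l : R) : (forall m, u m \is a Num.int) ->
  u @ \oo --> l -> l \is a Num.int.
Proof.
move=> ui ul; have h2 : 0 < (2^-1 : R) by rewrite invr_gt0.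
have [m0 _ Hm] : \forall m \near \oo, `|l - u m| < 2^-1 by move/cvgrPdist_lt : ul; exact.
suff -> : l = u m0 by [].
suff c2 : u @ \oo --> u m0 by exact: (cvg_unique _ ul c2).
apply: cvg_near_cst; exists m0 => // m /= mm.
apply/eqP/negPn/negP => ne; have d0 : u m - u m0 != 0 by rewrite subr_eq0.
have := norm_intr_ge1 (rpredB (ui m) (ui m0)) d0; rewrite leNgt => /negP; apply.
have -> : u m - u m0 = - (l - u m) + (l - u m0) by ring.
apply: (le_lt_trans (ler_normD _ _)); rewrite normrN.
have := Hm m mm; have := Hm m0 (leqnn m0); lra.
Qed.

Lemma measurable_Num_int : measurable [set x : R | x \is a Num.int].
Proof.
have -> : [set x : R | x \is a Num.int] =
    \bigcup_(n : nat) ([set n%:R] `|` [set - n%:R]).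
  apply/seteqP; split=> x /=.
    by rewrite intrE => /orP[/natrP[n xn]|/natrP[n xn]]; exists n => //; [left|right;
      rewrite -xn opprK].
  by move=> [n _ [->|->]]; rewrite ?rpredN natr_int.
by apply: bigcup_measurable => n _; apply: measurableU; exact: measurable_set1.
Qed.

Context {d : measure_display} {T : measurableType d} (P : probability T R).
Variable M : R -> T -> R.
Hypothesis mM : forall t : R, 0 <= t -> measurable_fun setT (M t).
Hypothesis rcM : forall (t : R) w, 0 <= t -> M s w @[s --> t^'+] --> M t w.

Definition nonint t : set T := [set w | M t w \isn't a Num.int].

Lemma measurable_nonint t : 0 <= t -> measurable (nonint t).
Proof.
move=> t0; rewrite (_ : nonint t = M t @^-1` ~` [set x : R | x \is a Num.int]).
  rewrite -[X in measurable X]setTI; apply: mM => //.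
  by apply: measurableC; exact: measurable_Num_int.
by apply/seteqP; split=> w /= /negP.
Qed.

(* Right continuity reduces the exceptional set to countably many times. *)
Lemma int_valued_paths : (forall t, 0 <= t -> P (nonint t) = 0%E) ->
  exists N, [/\ measurable N, P N = 0%E &
    forall (t : R) w, 0 <= t -> ~ N w -> M t w \is a Num.int].
Proof.
move=> P0.
have : P.-negligible (\bigcup_m \bigcup_j nonint (grid m j)).
  apply: negligible_bigcup => m; apply: negligible_bigcup => j.
  have g0 : 0 <= grid m j :> R by rewrite ltW// grid_gt0.
  by apply/negligibleP; [exact: measurable_nonint|exact: P0].
move=> [N [mN PN sub]]; exists N; split => // t w t0 Nw.
apply: (cvg_int (u := fun m => M (disc m t) w)).
  move=> m; apply/negPn/negP => nint; apply: Nw; apply: sub.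
  by exists m => //; exists (cell m t).
by apply: (disc_cvg_right (f := fun s => M s w)) => //; exact: rcM.
Qed.

End IntegerValued.

(** * Counting processes: integer values and short-time behaviour *)

Section CountingProcess.
Context {d : measure_display} {T : measurableType d} {R : realType}.
Variables (P : probability T R) (k : nat) (lam : 'I_k -> R) (M : R -> T -> R).
Hypothesis hM : gcp P lam M.

Let lM : levy_process P M. Proof. by have [] := hM. Qed.

Let mM (t : R) : 0 <= t -> measurable_fun setT (M t).
Proof. exact: (levy_measurable lM). Qed.

Let big_jump h : set T := [set w | forall j : nat, (j <= k)%N -> M h w <> j%:R].

Let meq h (r : R) : 0 <= h -> measurable [set w | M h w = r].
Proof.
move=> h0; rewrite (_ : [set w | _] = M h @^-1` [set r])//.
by rewrite -[X in measurable X]setTI; exact: mM.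
Qed.

Let mbig h : 0 <= h -> measurable (big_jump h).
Proof.
move=> h0; rewrite (_ : big_jump h = \bigcap_(j in [set j | (j <= k)%N]) ~` [set w | M h w = j%:R]).
  by apply: bigcap_measurable => [|j _]; [exists 0%N|exact/measurableC/meq].
by apply/seteqP; split=> w H j jk; exact: H.
Qed.

(** The infinitesimal description only says that leaving {0, ..., k} within time h has probability
    o(h). Since a sum of integers is an integer and increments are stationary, the probability a(t)
    of a non-integer value is subadditive, hence a(t) <= n a(t/n) = n o(1/n). *)
Lemma gcp_nonint t : 0 <= t -> P (nonint M t) = 0%E.
Proof.
pose a h := fine (P (nonint M h)).
have mni h : 0 <= h -> measurable (nonint M h) by exact: measurable_nonint.
have fin h : 0 <= h -> P (nonint M h) \is a fin_num by move=> /mni; exact: fin_num_measure.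
have aD s h : 0 <= s -> 0 <= h -> a (s + h) <= a s + a h.
  move=> s0 h0; have sh0 : 0 <= s + h by rewrite addr_ge0.
  have mZ : measurable (~` [set x : R | x \is a Num.int]) by apply: measurableC;
    exact: measurable_Num_int.
  have st := levy_stationary_increments lM s0 h0 mZ.
  have E1 : [set w | (~` [set x : R | x \is a Num.int]) (M h w)] = nonint M h.
    by apply/seteqP; split=> w /= /negP.
  rewrite E1 in st.
  have mI : measurable [set w | (~` [set x : R | x \is a Num.int]) (M (s + h) w - M s w)].
    have mD : measurable_fun setT (fun w => M (s + h) w - M s w).
      by apply: measurable_funB; exact: mM.
    by have := mD measurableT _ mZ; rewrite setTI.
  rewrite /a -st; apply: le_trans (fine_probU P (mni _ s0) mI).
  apply: le_fine_prob; [exact: mni|by apply: measurableU => //; exact: mni|].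
  move=> w /= nsh; have [si|] := boolP (M s w \is a Num.int); last by left.
  right => di; move/negP : nsh; apply.
  by rewrite -(subrK (M s w) (M (s + h) w)) rpredD.
have aM h n : 0 <= h -> a (n.+1%:R * h) <= n.+1%:R * a h.
  move=> h0; elim: n => [|n IH]; first by rewrite !mul1r.
  rewrite -(natr1 n.+1) !mulrDl !mul1r.
  by apply: (le_trans (aD _ _ _ h0)); rewrite ?lerD2r// mulr_ge0.
have ab h : 0 <= h -> a h <= fine (P (big_jump h)).
  move=> h0; apply: le_fine_prob; [exact: mni|exact: mbig|].
  by move=> w /= /negP ni j _ E; apply: ni; rewrite E natr_int.
rewrite le_eqVlt => /predU1P[<-|t0].
  rewrite (_ : nonint M 0 = set0) ?measure0//.
  by rewrite /nonint; apply/seteqP; split=> w //=; rewrite (levy_start lM w) rpred0.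
suff : a t <= 0.
  rewrite -lee_fin /a fineK; last exact: (fin _ (ltW t0)).
  by rewrite measure_le0 => /eqP.
have [_ _ big0] := hM.
have : t * (fine (P (big_jump (t / n.+1%:R))) / (t / n.+1%:R)) @[n --> \oo] --> t * 0.
  apply: cvgM; first exact: cvg_cst.
  apply: ((cvg_at_rightP _ _ _).1 big0 (fun n => t / n.+1%:R)); split.
    by move=> n; rewrite divr_gt0.
  rewrite -[X in _ --> X](mulr0 t); apply: cvgM; first exact: cvg_cst.
  exact: cvg_harmonic.
rewrite mulr0 => H; rewrite -(cvg_lim _ H)//.
apply: limr_ge; first by apply/cvg_ex; eexists; exact: H.
apply: nearW => n; have N0 : 0 < n.+1%:R :> R by rewrite ltr0n.
have tn0 : 0 <= t / n.+1%:R by rewrite divr_ge0// ltW.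
have tE : n.+1%:R * (t / n.+1%:R) = t by rewrite mulrCA divff ?mulr1// gt_eqF.
rewrite -{1}tE; apply: (le_trans (aM _ n tn0)).
have -> : t * (fine (P (big_jump (t / n.+1%:R))) / (t / n.+1%:R)) =
    n.+1%:R * fine (P (big_jump (t / n.+1%:R))).
  by field; rewrite !gt_eqF.
by rewrite ler_pM2l// ab.
Qed.

Lemma gcp_int_valued : exists N, [/\ measurable N, P N = 0%E &
    forall (t : R) w, 0 <= t -> ~ N w -> M t w \is a Num.int].
Proof.
by apply: int_valued_paths; [exact: mM|exact: (levy_right_continuous lM)|exact: gcp_nonint].
Qed.

(** A nonzero value is a jump of size 1, ..., k or lies outside {0, ..., k}; divided by h these
    probabilities have a finite limit at 0, which bounds them for small h. *)
Lemma gcp_neq0_bound : exists2 C, 0 <= C &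
  forall h : R, 0 <= h -> fine (P [set w | M h w != 0]) <= C * h.
Proof.
have [_ jump big0] := hM.
pose A h i := [set w | M h w = i.+1%:R].
have mA h i : 0 <= h -> measurable (A h i) by move=> h0; exact: meq.
have mne h : 0 <= h -> measurable [set w | M h w != 0].
  move=> h0; rewrite (_ : [set w | _] = ~` [set w | M h w = 0]); first exact/measurableC/meq.
  by apply/seteqP; split=> w /= /eqP.
have split_neq0 h : 0 <= h ->
    fine (P [set w | M h w != 0]) <= \sum_(i < k) fine (P (A h i)) + fine (P (big_jump h)).
  move=> h0; have mU : measurable (\big[setU/set0]_(i < k) A h i).
    by apply: bigsetU_measurable => i _; exact: mA.
  apply: le_trans (lerD (fine_prob_bigU _ _ (fun i => mA h i h0)) (lexx _)).
  apply: le_trans (fine_probU P mU (mbig h0)); apply: le_fine_prob.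
  - exact: mne.
  - by apply: measurableU => //; exact: mbig.
  move=> w /= /eqP Mw; have [[j [jk Mj]]|nj] := pselect (exists j : nat,
    (j <= k)%N /\ M h w = j%:R).
    case: j jk Mj => [|j] jk Mj; first by case: Mw.
    by left; rewrite -bigcup_mkord; exists j.
  by right => j jk Mj; apply: nj; exists j.
pose f h := \sum_(i < k) fine (P (A h i)) / h + fine (P (big_jump h)) / h.
have cf : f h @[h --> 0^'+] --> \sum_(i < k) lam i + 0.
  apply: cvgD; last exact: big0.
  have cs (s : seq 'I_k) : \sum_(i <- s) fine (P (A h i)) / h @[h --> 0^'+] --> \sum_(i <- s) lam i.
    elim: s => [|i s IH].
      by under eq_fun do rewrite big_nil; rewrite big_nil; exact: cvg_cst.
    under eq_fun do rewrite big_cons; rewrite big_cons.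
    by apply: cvgD => //; exact: jump.
  exact: cs.
have /cvgr_le/(_ (\sum_(i < k) lam i + 0 + 1)) := cf.
rewrite ltrDl ltr01 => /(_ isT)[delta /= d0 Hd].
set C0 := \sum_(i < k) lam i + 0 + 1 in Hd.
(* |C0| serves for h < delta; for h >= delta the probability is at most 1 <= h / delta. *)
exists (`|C0| + delta^-1); first by rewrite addr_ge0// invr_ge0 ltW.
move=> h; rewrite le_eqVlt => /predU1P[<-|h0].
  rewrite mulr0 (_ : [set w | _] = set0) ?measure0//.
  by apply/seteqP; split=> w //=; rewrite (levy_start lM w) eqxx.
have [hd|hd] := ltP h delta.
  have : f h <= C0 by apply: Hd => //=; rewrite sub0r normrN gtr0_norm.
  rewrite /f -mulr_suml -mulrDl ler_pdivrMr// => fh.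
  apply: le_trans (split_neq0 _ (ltW h0)) _; apply: (le_trans fh).
  rewrite ler_pM2r//; apply: (le_trans (ler_norm _)).
  by rewrite lerDl invr_ge0 ltW.
apply: (le_trans (fine_prob_le1 P (mne _ (ltW h0)))).
rewrite mulrDl -[leLHS]add0r lerD//; first by rewrite mulr_ge0// ltW.
by rewrite mulrC ler_pdivlMr// mul1r.
Qed.

End CountingProcess.

Section Skellam.
Context {d : measure_display} {T : measurableType d} {R : realType}.
Variables (P : probability T R) (k : nat) (lam mu : 'I_k -> R) (S : R -> T -> R).
Hypothesis hS : gsp P lam mu S.

Lemma gsp_measurable (t : R) : 0 <= t -> measurable_fun setT (S t).
Proof.
move=> t0; have [M1 [M2 [[l1 _ _] [l2 _ _] _ SE]]] := hS.
rewrite (_ : S t = fun w => M1 t w - M2 t w); last by apply/funext => w; exact: SE.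
by apply: measurable_funB; apply: levy_measurable; eauto.
Qed.

Lemma gsp_right_continuous (t : R) w : 0 <= t -> S s w @[s --> t^'+] --> S t w.
Proof.
move=> t0; have [M1 [M2 [[l1 _ _] [l2 _ _] _ SE]]] := hS.
rewrite SE//.
have : (M1 s w - M2 s w) @[s --> t^'+] --> M1 t w - M2 t w.
  apply: cvgB; [exact: (levy_right_continuous l1)|exact: (levy_right_continuous l2)].
apply: cvg_trans; apply: near_eq_cvg; near=> s; apply/esym/SE.
by apply: (le_trans t0); near: s; exact: nbhs_right_ge.
Unshelve. all: by end_near. Qed.

Lemma gsp_int_valued : exists N, [/\ measurable N, P N = 0%E &
  forall (t : R) w, 0 <= t -> ~ N w -> S t w \is a Num.int].
Proof.
have [M1 [M2 [g1 g2 _ SE]]] := hS.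
have [N1 [mN1 PN1 i1]] := gcp_int_valued g1.
have [N2 [mN2 PN2 i2]] := gcp_int_valued g2.
exists (N1 `|` N2); split; first exact: measurableU.
  by rewrite null_set_setU.
move=> t w t0 Nw; rewrite SE// rpredB//; first by apply: i1 => // ?; apply: Nw; left.
by apply: i2 => // ?; apply: Nw; right.
Qed.

Lemma gsp_neq0_bound : exists2 C, 0 <= C &
  forall h : R, 0 <= h -> fine (P [set w | S h w != 0]) <= C * h.
Proof.
have mne (V : T -> R) : measurable_fun setT V -> measurable [set w | V w != 0].
  move=> mV; rewrite (_ : [set w | _] = V @^-1` ~` [set 0]).
    by rewrite -[X in measurable X]setTI; apply: mV => //; exact: measurableC.
  by apply/seteqP; split=> w /= /eqP.
have [M1 [M2 [g1 g2 _ SE]]] := hS.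
have [C1 C10 b1] := gcp_neq0_bound g1.
have [C2 C20 b2] := gcp_neq0_bound g2.
exists (C1 + C2) => [|h h0]; first exact: addr_ge0.
have [l1 _ _] := g1; have [l2 _ _] := g2.
have m1 := mne _ (levy_measurable l1 h0).
have m2 := mne _ (levy_measurable l2 h0).
rewrite mulrDl; apply: le_trans (lerD (b1 _ h0) (b2 _ h0)).
apply: le_trans (fine_probU P m1 m2); apply: le_fine_prob.
- exact: (mne _ (gsp_measurable h0)).
- exact: measurableU.
move=> w /= Sw; have [M10|] := eqVneq (M1 h w) 0; last by left.
by right; apply: contra_neq Sw => M20; rewrite SE// M10 M20 subr0.
Qed.

End Skellam.

(** * Measurability and right continuity of the inverse subordinator *)

Section InverseSubordinator.
Context {d : measure_display} {T : measurableType d} {R : realType}.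
Variables (P : probability T R) (D : R -> T -> R).
Hypothesis sD : subordinator P D.
Implicit Types (t x y : R) (w : T).
Local Notation Y := (inverse_subordinator D).

Let level t w : set R := [set x | 0 <= x /\ t < D x w].

Let level_lb t w : has_lbound (level t w).
Proof. by exists 0 => x []. Qed.

Lemma inverse_ge0 t w : 0 <= Y t w.
Proof.
have [[x Lx]|nL] := pselect (level t w !=set0).
  by apply: lb_le_inf; [exists x|move=> y []].
rewrite /inverse_subordinator (_ : [set x | _] = set0) ?inf0//.
by apply/seteqP; split=> // x Lx; apply: nL; exists x.
Qed.

Lemma inverse_le t w x : 0 <= x -> t < D x w -> Y t w <= x.
Proof. by move=> x0 tx; apply: ge_inf => //; exact: (level_lb t w). Qed.

Lemma inverse_lt_level t w x y : 0 <= x -> t < D x w -> Y t w < y ->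
  exists z, [/\ 0 <= z, z < y & t < D z w].
Proof.
move=> x0 tx Yy; have [|z [z0 tz] zy] := inf_lt _ Yy; first by exists x.
by exists z.
Qed.

Lemma lt_inverse t w y : 0 <= y -> y < Y t w -> D y w <= t.
Proof. by move=> y0 yY; rewrite leNgt; apply/negP => /(inverse_le y0); rewrite leNgt yY. Qed.

(** Monotone paths let grid points detect the crossing of t before y. The second set is the default
    case: if D never exceeds t, the infimum is over the empty set and equals 0. *)
Lemma inverse_lt_set t y : 0 < y -> [set w | Y t w < y] =
  \bigcup_m \bigcup_(j in [set j | grid m j < y]) [set w | t < D (grid m j) w] `|`
  \bigcap_j [set w | D j%:R w <= t].
Proof.
move=> y0; apply/seteqP; split=> w /=.
  move=> Yy; have [[x [x0 tx]]|nL] := pselect (level t w !=set0); last first.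
    by right=> j _ /=; rewrite leNgt; apply/negP => tj; apply: nL; exists j%:R.
  left; have [z [z0 zy tz]] := inverse_lt_level x0 tx Yy.
  have yz : 0 < y - z by rewrite subr_gt0.
  have [m _ Hm] := near_infty_natSinv_lt (PosNum yz).
  have /andP[zd dz] := disc_itv m z0.
  exists m => //; exists (cell m z) => /=.
    by apply: (le_lt_trans dz); rewrite addrC -ltrBrDr; apply: (Hm m) => /=.
  by apply: (lt_le_trans tz); apply: (proj2 sD) => //; exact: ltW.
move=> [[m _ [j /= jy tj]]|].
  by apply: le_lt_trans jy; apply: inverse_le => //; rewrite ltW// grid_gt0.
move=> all; rewrite /inverse_subordinator (_ : [set x | _] = set0) ?inf0//.
apply/seteqP; split=> // x [x0 tx].
have : t < D (Num.truncn x).+1%:R w.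
  by apply: (lt_le_trans tx); apply: (proj2 sD) => //; rewrite ltW// truncnS_gt.
by rewrite ltNge => /negP; apply; exact: all.
Qed.

Lemma measurable_inverse t : measurable_fun setT (Y t).
Proof.
have mD x : 0 <= x -> measurable_fun setT (D x) by exact: (levy_measurable (proj1 sD)).
move=> mT; apply: (measurability _ (RGenInftyO.measurableE R)) => //.
move=> _ [_ [y ->] <-]; rewrite setTI.
have [y0|y0] := leP y 0.
  rewrite (_ : _ @^-1` _ = set0)//; apply/seteqP; split=> w //=.
  by rewrite in_itv/= ltNge (le_trans y0 (inverse_ge0 t w)).
rewrite (_ : _ @^-1` _ = [set w | Y t w < y]); last by apply/seteqP; split=> w /=; rewrite in_itv.
rewrite inverse_lt_set//; apply: measurableU.
  apply: bigcup_measurable => m _; apply: bigcup_measurable => j _.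
  have g0 : 0 <= grid m j :> R by rewrite ltW// grid_gt0.
  have := mD _ g0 measurableT `]t, +oo[%classic (measurable_itv _).
  rewrite setTI; congr (measurable _); apply/seteqP.
  by split=> w /=; rewrite in_itv/= andbT.
apply: bigcap_measurable => [|j _]; first by exists 0%N.
have j0 : 0 <= j%:R :> R by [].
have := mD _ j0 measurableT `]-oo, t]%classic (measurable_itv _).
by rewrite setTI; congr (measurable _); apply/seteqP; split=> w /=; rewrite in_itv/=.
Qed.

Lemma le_inverse t x w z : 0 <= z -> x < D z w -> t <= x -> Y t w <= Y x w.
Proof.
move=> z0 xz tx; apply: lb_le_inf; first by exists z.
by move=> y [y0 xy]; apply: inverse_le => //; exact: le_lt_trans xy.
Qed.

(** A point x just above Y t with t < D x also bounds Y s for t <= s < D x, so Y is right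
    continuous; being nondecreasing it approaches its limit from the right, where f is right
    continuous. If t is never exceeded, Y is 0 from t on by the default value. *)
Lemma inverse_compose_right_continuous (f : R -> R) t w :
  (forall y, 0 <= y -> f s @[s --> y^'+] --> f y) ->
  f (Y s w) @[s --> t^'+] --> f (Y t w).
Proof.
move=> rcf; have [[z [z0 tz]]|nL] := pselect (level t w !=set0); last first.
  apply: cvg_near_cst; near=> s.
  have ts : t <= s by near: s; exact: nbhs_right_ge.
  have E u : t <= u -> Y u w = 0.
    move=> tu; rewrite /inverse_subordinator (_ : [set x | _] = set0) ?inf0//.
    apply/seteqP; split=> // x [x0 ux]; apply: nL; exists x; split => //.
    exact: le_lt_trans ux.
  by rewrite !E.
apply/cvgrPdist_lt => e e0.
have [delta /= d0 Hd] : \forall s \near (Y t w)^'+, `|f (Y t w) - f s| < e.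
  by have /cvgrPdist_lt := rcf _ (inverse_ge0 t w); exact.
have Yd : Y t w < Y t w + delta by rewrite ltrDl.
have [x [x0 xd tx]] := inverse_lt_level z0 tz Yd.
near=> s.
have ts : t <= s by near: s; exact: nbhs_right_ge.
have sx : s < D x w by near: s; exact: nbhs_right_lt.
have := le_inverse x0 sx ts; rewrite le_eqVlt => /predU1P[<-|Yts].
  by rewrite subrr normr0.
apply: Hd => //=; rewrite distrC gtr0_norm ?subr_gt0// ltrBlDl.
by apply: le_lt_trans xd; exact: inverse_le.
Unshelve. all: by end_near. Qed.

End InverseSubordinator.

Section OneDimensional.
Context {d : measure_display} {T : measurableType d} {R : realType}.
Variable P : probability T R.

Lemma independent_processes1 (X Y : R -> T -> R) (s t : R) (A B : set R) :
  independent_processes P X Y -> 0 <= s -> 0 <= t -> measurable A -> measurable B ->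
  P (X s @^-1` A `&` Y t @^-1` B) = (P (X s @^-1` A) * P (Y t @^-1` B))%E.
Proof.
move=> ind s0 t0 mA mB.
have := ind 1%N 1%N (fun=> s) (fun=> t) (fun=> A) (fun=> B) (fun=> s0) (fun=> t0) (fun=> mA)
  (fun=> mB).
have cst (V : set T) : \bigcap_(i in [set: 'I_1]) V = V.
  by apply/seteqP; split=> w; [move=> /(_ ord0 Logic.I)|move=> ? ?].
by rewrite !cst.
Qed.

Lemma measurable_lt_set (V : T -> R) c : measurable_fun setT V -> measurable [set w | V w < c].
Proof.
move=> mV; have := mV measurableT `]-oo, c[%classic (measurable_itv _).
by rewrite setTI; congr (measurable _); apply/seteqP; split=> w /=; rewrite in_itv/=.
Qed.

Lemma measurable_le_set (V : T -> R) c : measurable_fun setT V -> measurable [set w | V w <= c].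
Proof.
move=> mV; have := mV measurableT `]-oo, c]%classic (measurable_itv _).
by rewrite setTI; congr (measurable _); apply/seteqP; split=> w /=; rewrite in_itv/=.
Qed.

Lemma measurable_gt_set (V : T -> R) c : measurable_fun setT V -> measurable [set w | c < V w].
Proof.
move=> mV; have := mV measurableT `]c, +oo[%classic (measurable_itv _).
by rewrite setTI; congr (measurable _); apply/seteqP; split=> w /=; rewrite in_itv/= andbT.
Qed.

Lemma state_prob_ge0 (X : R -> T -> R) n t : 0 <= state_prob P X n t.
Proof. exact: fine_prob_ge0. Qed.

Lemma state_prob_le1 (X : R -> T -> R) n t : measurable_fun setT (X t) ->
  state_prob P X n t <= 1.
Proof. by move=> mX; apply: fine_prob_le1; exact: measurable_eq_int. Qed.

Lemma measurable_disc_state_prob (X : R -> T -> R) n m (W : T -> R) :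
  measurable_fun setT W -> (forall w, 0 <= W w) ->
  measurable_fun setT (fun w => state_prob P X n (disc m (W w))).
Proof.
move=> mW W0; apply: (measurable_cell measurableT mW (fun w _ => W0 w) m
  (F := fun j w => state_prob P X n (grid m j))) => j; exact: measurable_cst.
Qed.

Section StateZero.
Variables (S : R -> T -> R) (C : R).
Hypothesis mS : forall t : R, 0 <= t -> measurable_fun setT (S t).
Hypothesis rcS : forall (t : R) w, 0 <= t -> S s w @[s --> t^'+] --> S t w.
Hypothesis intS : exists N, [/\ measurable N, P N = 0%E &
  forall (t : R) w, 0 <= t -> ~ N w -> S t w \is a Num.int].
Hypotheses (C0 : 0 <= C)
  (bS : forall h : R, 0 <= h -> fine (P [set w | S h w != 0]) <= C * h).

Lemma state_prob0_ge (h : R) : 0 <= h -> 1 - C * h <= state_prob P S 0 h.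
Proof.
move=> h0; have mA := measurable_eq_int 0 (mS h0).
apply: le_trans (_ : 1 - fine (P [set w | S h w != 0]) <= _).
  by rewrite lerD2l lerN2 bS.
rewrite /state_prob lerBlDr addrC.
have := probability_setC P mA.
rewrite (_ : ~` [set w | S h w = 0%:~R] = [set w | S h w != 0]); last first.
  by apply/seteqP; split=> w /= /eqP.
move=> ->; rewrite fineB ?fin_num_measure//=.
by rewrite subrK.
Qed.

(** When W <= delta the chance of having left 0 is at most C delta. Independence is used at grid
    times only, and the overshoot of the grid costs C/(m+1), which vanishes in the limit. *)
Lemma subordinated_state0_ge (W : T -> R) (delta : R) : 0 <= delta ->
  measurable_fun setT W -> (forall w, 0 <= W w) ->
  (forall (t : R) (A B : set R), 0 <= t -> measurable A -> measurable B ->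
    P (S t @^-1` A `&` W @^-1` B) = (P (S t @^-1` A) * P (W @^-1` B))%E) ->
  1 - C * delta - fine (P [set w | delta < W w]) <= fine (P [set w | S (W w) w = 0]).
Proof.
move=> delta0 mW W0 ind; have [N [mN PN iN]] := intS.
have mG := measurable_gt_set delta mW.
set A := [set w | delta < W w] in mG *.
have c1 := @disc_compose_cvg _ _ _ P S mS rcS N mN PN iN 0 W mW W0.
have c2 : 1 - C * delta - fine (P A) - C * m.+1%:R^-1 @[m --> \oo] -->
    1 - C * delta - fine (P A).
  rewrite -[X in _ --> X]subr0; apply: cvgB; first exact: cvg_cst.
  rewrite -[X in _ --> X](mulr0 C); apply: cvgM; first exact: cvg_cst.
  exact: cvg_harmonic.
apply: (ler_cvg_to c2 c1); apply: nearW => m.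
have -> : fine (P [set w | S (disc m (W w)) w = 0%:~R]) =
    \int[P]_w state_prob P S 0 (disc m (W w)).
  by rewrite (disc_compose_prob mS m 0 mW W0 ind).
have d0 w : 0 <= disc m (W w) :> R by rewrite ltW// grid_gt0.
(* c minus the indicator of A is a pointwise lower bound: on A it is nonpositive, and off A the
   discretised time is at most delta + 1/(m+1). *)
pose c := 1 - C * delta - C * m.+1%:R^-1.
have ic : P.-integrable setT (EFin \o (fun=> c)) by exact: finite_measure_integrable_cst.
have iA : P.-integrable setT (EFin \o (fun w => (w \in A)%:R : R)).
  apply: (le_Rintegrable (g := fun=> 1)) => //.
  - by have := measurable_indic (D := setT) (R := R) mG; apply: eq_measurable_fun => w _;
    rewrite indicE.
  - by move=> w _; case: (w \in A); rewrite ?normr1 ?normr0.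
  - exact: finite_measure_integrable_cst.
have -> : 1 - C * delta - fine (P A) - C * m.+1%:R^-1 = \int[P]_w (c - (w \in A)%:R).
  rewrite (RintegralB measurableT ic iA) Rintegral_indicator// Rintegral_cst//.
  have -> : fine (P [set: T]) = 1 by rewrite probability_setT.
  by rewrite /c; ring.
apply: le_Rintegral => //.
- have iA' := RintegrableZl (-1) measurableT iA.
  have := RintegrableD measurableT ic iA'.
  by congr (P.-integrable _ _); apply/funext => w /=; rewrite mulN1r.
- apply: (le_Rintegrable (g := fun=> 1)) => //.
  + exact: measurable_disc_state_prob.
  + move=> w _; rewrite ger0_norm ?state_prob_ge0//; apply: state_prob_le1; exact: mS.
  + exact: finite_measure_integrable_cst.
move=> w _; have [wA|wA] := boolP (w \in A).
  apply: le_trans (state_prob_ge0 _ _ _); rewrite /c.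
  have : 0 <= C * delta + C / m.+1%:R by rewrite addr_ge0// mulr_ge0.
  move=> H; rewrite (_ : true%:R = 1 :> R)// subr_le0 -addrA -opprD lerBlDr lerDl.
  exact: H.
rewrite subr0; apply: le_trans (state_prob0_ge (d0 w)); rewrite /c -addrA lerD2l -opprD lerN2.
rewrite -mulrDr ler_wpM2l//.
have Wd : W w <= delta by rewrite leNgt; apply: contra wA => H; rewrite inE.
by have /andP[_ /le_trans -> //] := disc_itv m (W0 w); rewrite lerD2r.
Qed.

End StateZero.

(* Chernoff's bound with [s = 1 / x] in the Laplace transform of [D y]. *)
Lemma stable_le_prob alpha D (x y : R) : stable_subordinator P alpha D ->
  0 < x -> 0 <= y ->
  fine (P [set w | D y w <= x]) <= expR 1 * expR (- (y * x^-1 `^ alpha)).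
Proof.
move=> [[lD _] LD] x0 y0; have mD : measurable_fun setT (D y) by exact: (levy_measurable lD).
have mA := measurable_le_set x mD.
have xV0 : 0 <= x^-1 by rewrite invr_ge0 ltW.
have LE : \int[P]_w expR (- (x^-1 * D y w)) = expR (- (y * x^-1 `^ alpha)).
  by have := LD _ _ xV0 y0; rewrite unlock /Rintegral => ->.
have mE : measurable_fun setT (fun w => expR (- (x^-1 * D y w))).
  apply: (measurableT_comp (@measurable_expR R)) => //; apply: measurableT_comp => //.
  by apply: measurable_funM => //; exact: measurable_cst.
have iE : P.-integrable setT (EFin \o (fun w => expR (- (x^-1 * D y w)))).
  apply/integrableP; split; first exact/measurable_EFinP.
  under eq_integral do rewrite /= ger0_norm ?expR_ge0//.
  by have := LD _ _ xV0 y0; rewrite unlock => ->; rewrite ltry.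
rewrite -LE -(RintegralZl (expR 1) measurableT iE) -(Rintegral_indicator P mA).
apply: le_Rintegral => //.
- apply: (le_Rintegrable (g := fun=> 1)) => //.
  + by have := measurable_indic (D := setT) (R := R) mA; apply: eq_measurable_fun => w _;
    rewrite indicE.
  + by move=> w _; case: (w \in _); rewrite ?normr1 ?normr0.
  + exact: finite_measure_integrable_cst.
- exact: RintegrableZl.
move=> w _; have [|_] := boolP (w \in _); last by rewrite mulr_ge0// expR_ge0.
rewrite inE/= => Dx; rewrite -expRD; apply: (le_trans _ (expR_ge1Dx _)); rewrite lerDl subr_ge0.
by rewrite mulrC ler_pdivrMr ?mul1r.
Qed.

End OneDimensional.

Section FractionalSkellam.
Context {d : measure_display} {T : measurableType d} {R : realType}.
Variables (P : probability T R) (k : nat) (lam mu : 'I_k -> R) (alpha : R).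
Variable X : R -> T -> R.
Hypotheses (alpha0 : 0 < alpha) (hX : gfsp P lam mu alpha X).

Lemma gfsp_measurable (t : R) : 0 <= t -> measurable_fun setT (X t).
Proof.
move=> t0; have [S gS] := hX.
case: eqVneq => [_ XS|_ [D [[sD _] _ XS]]].
  rewrite (_ : X t = S t); first exact: (gsp_measurable gS).
  by apply/funext => w; exact: XS.
rewrite (_ : X t = fun w => S (inverse_subordinator D t w) w); last first.
  by apply/funext => w; exact: XS.
apply: (measurable_compose (gsp_measurable gS) (gsp_right_continuous gS)).
  exact: (measurable_inverse sD).
by move=> w; exact: inverse_ge0.
Qed.

Lemma gfsp_right_continuous (t : R) w : 0 <= t -> X s w @[s --> t^'+] --> X t w.
Proof.
move=> t0; have [S gS] := hX.
have ext (V : R -> T -> R) : (forall t w, 0 <= t -> X t w = V t w) ->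
    V s w @[s --> t^'+] --> V t w -> X s w @[s --> t^'+] --> X t w.
  move=> XV; rewrite XV//; apply: cvg_trans; apply: near_eq_cvg; near=> s; apply/esym/XV.
  by apply: (le_trans t0); near: s; exact: nbhs_right_ge.
case: eqVneq => [_ XS|_ [D [[sD _] _ XS]]].
  by apply: (ext _ XS); exact: (gsp_right_continuous gS).
apply: (ext _ XS); apply: (inverse_compose_right_continuous (f := fun s => S s w)).
by move=> y y0; exact: (gsp_right_continuous gS).
Unshelve. all: by end_near. Qed.

Lemma gfsp_int_valued : exists N, [/\ measurable N, P N = 0%E &
  forall (t : R) w, 0 <= t -> ~ N w -> X t w \is a Num.int].
Proof.
have [S gS] := hX; have [N [mN PN iN]] := gsp_int_valued gS.
case: eqVneq => [_ XS|_ [D [[sD _] _ XS]]]; exists N; split => // t w t0 Nw.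
  by rewrite XS//; exact: iN.
by rewrite XS//; apply: iN => //; exact: inverse_ge0.
Qed.

Lemma gfsp_state0_ge : exists C eps : R, [/\ 0 <= C, 0 < eps &
  forall x : R, 0 < x -> 1 - C * x `^ eps <= state_prob P X 0 x].
Proof.
have [S gS] := hX; have [C C0 bC] := gsp_neq0_bound gS.
case: eqVneq => [_ XS|_ [D [[sD LD] ind XS]]].
  exists C, 1; split => // x x0; rewrite powRr1 ?(ltW x0)//.
  rewrite /state_prob (_ : [set w | X x w = 0%:~R] = [set w | S x w = 0%:~R]).
    exact: (state_prob0_ge (gsp_measurable gS) bC (ltW x0)).
  by apply/seteqP; split=> w /=; rewrite XS// ltW.
(* With delta = x^(alpha/2), leaving 0 by time delta costs C delta, and Chernoff bounds the
   probability that the inverse subordinator at x exceeds delta by e exp(-delta x^(-alpha)) = e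
   exp(-1/delta) <= e delta. *)
exists (C + expR 1), (alpha / 2); split.
- by rewrite addr_ge0// expR_ge0.
- by rewrite divr_gt0.
move=> x x0; set W := inverse_subordinator D x.
have mW : measurable_fun setT W := measurable_inverse sD x.
have W0 w : 0 <= W w by exact: inverse_ge0.
have indW (t : R) (A B : set R) : 0 <= t -> measurable A -> measurable B ->
    P (S t @^-1` A `&` W @^-1` B) = (P (S t @^-1` A) * P (W @^-1` B))%E.
  by move=> t0; apply: (independent_processes1 ind t0); exact: ltW.
set delta := x `^ (alpha / 2).
have delta0 : 0 < delta by exact: powR_gt0.
have := subordinated_state0_ge (gsp_measurable gS) (gsp_right_continuous gS)
  (gsp_int_valued gS) C0 bC (ltW delta0) mW W0 indW.
rewrite (_ : [set w | S (W w) w = 0] = [set w | X x w = 0%:~R]); last first.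
  by apply/seteqP; split=> w /=; rewrite XS// ltW.
apply: le_trans; rewrite mulrDl opprD addrA lerD2l lerN2.
have mDd : measurable_fun setT (D delta) by apply: (levy_measurable (proj1 sD)); exact: ltW.
apply: le_trans (_ : fine (P [set w | D delta w <= x]) <= _).
  apply: le_fine_prob; [exact: measurable_gt_set|exact: measurable_le_set|].
  by move=> w /=; apply: lt_inverse; exact: ltW.
apply: le_trans (stable_le_prob (conj sD LD) x0 (ltW delta0)) _.
rewrite ler_wpM2l ?expR_ge0//.
have -> : delta * x^-1 `^ alpha = delta^-1.
  rewrite /delta !powR_expRE ?invr_gt0// lnV// -expRN -expRD; congr expR.
  by field.
rewrite expRN -[leRHS]invrK lef_pV2 ?posrE ?expR_gt0 ?invr_gt0//.
by apply: le_trans (expR_ge1Dx _); rewrite lerDr.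
Qed.

(** For n <> 0 the states n and 0 exclude each other, so the lower bound at 0 leaves at most C
    x^eps. *)
Lemma gfsp_state_le : exists C eps : R, [/\ 0 <= C, 0 < eps &
  forall (n : int) (x : R), n <> 0 -> 0 < x -> state_prob P X n x <= C * x `^ eps].
Proof.
have [C [eps [C0 eps0 H]]] := gfsp_state0_ge; exists C, eps; split => // n x n0 x0.
have mX := gfsp_measurable (ltW x0).
have mn := measurable_eq_int n mX; have m0 := measurable_eq_int 0 mX.
have : state_prob P X n x + state_prob P X 0 x <= 1.
  rewrite /state_prob -fineD ?fin_num_measure//.
  rewrite -measureU//.
    by apply: fine_prob_le1; exact: measurableU.
  apply/seteqP; split=> // w [/= -> /eqP]; rewrite eqr_int => /eqP.
  exact: n0.
by have := H x x0; lra.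
Qed.

End FractionalSkellam.

(** * The mixture representation *)

Section Mixture.
Context {d : measure_display} {T : measurableType d} {R : realType}.
Local Notation mu := (@lebesgue_measure R).
Variables (P : probability T R) (a b : R) (X Z : R -> T -> R).
Hypotheses (a0 : 0 < a) (b0 : 0 < b).
Hypothesis hZ : gamma_subordinator P a b Z.

Let mpos : measurable (`]0, +oo[%classic : set (measurableTypeR R)).
Proof. by []. Qed.

Let mZ t : 0 < t -> measurable_fun setT (Z t).
Proof. by move=> t0; apply: (levy_measurable (proj1 (proj1 hZ))); exact: ltW. Qed.

Lemma gamma_law_itv (t y z : R) : 0 < t -> y <= z ->
  fine (P (Z t @^-1` `[y, z[%classic)) =
  \int[mu]_(x in `]0, +oo[ `&` `[y, z[) gamma_density a b x t.
Proof.
move=> t0 yz.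
have ig := gamma_density_integrable a0 b0 t0.
have mA : measurable (Z t @^-1` `[y, z[%classic).
  by rewrite -[X in measurable X]setTI; exact: mZ.
have my := measurable_lt_set y (mZ t0).
have ind (B : pred R) : measurable ([set x | B x] : set (measurableTypeR R)) ->
    mu.-integrable `]0, +oo[ (EFin \o (fun x => gamma_density a b x t * (B x)%:R)).
  move=> mB; apply: (@le_Rintegrable _ _ R mu _ _ (fun x => gamma_density a b x t)) => //.
    apply: measurable_funM; first by apply/measurable_EFinP; exact: (measurable_int _ ig).
    have := measurable_indic (D := (`]0, +oo[%classic : set (measurableTypeR R))) (R := R) mB.
    apply: eq_measurable_fun => x _; rewrite indicE.
    by have -> : (x \in [set x | B x]) = B x by apply/idP/idP; rewrite inE.
  move=> x _; have g0 := gamma_density_ge0 a b0 x t0.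
  by case: (B x); rewrite ?mulr1 ?mulr0 ?normr0// ger0_norm.
have iy := ind (fun x => x < y) (measurable_lt_set (T := measurableTypeR R) (V := idfun) y
  (@measurable_id _ _ _)).
have iyz : mu.-integrable `]0, +oo[ (EFin \o (fun x => gamma_density a b x t * (y <= x < z)%R%:R)).
  apply: (ind (fun x => y <= x < z)).
  by rewrite (_ : [set x | _] = `[y, z[%classic)//; apply/seteqP; split=> x /=; rewrite in_itv.
have E1 : fine (P [set w | Z t w < z]) =
    fine (P [set w | Z t w < y]) + fine (P (Z t @^-1` `[y, z[%classic)).
  rewrite -fineD ?fin_num_measure// -measureU//.
    congr (fine (P _)); apply/seteqP; split=> w /=; rewrite in_itv/=.
      by move=> Zz; have [|yZ] := ltP (Z t w) y; [left|right; rewrite Zz].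
    by move=> [/lt_le_trans ->//|/andP[]].
  by apply/seteqP; split=> // w [/= Zy]; rewrite in_itv/= leNgt Zy.
have E2 : \int[mu]_(x in `]0, +oo[) (gamma_density a b x t * (x < z)%R%:R) =
    \int[mu]_(x in `]0, +oo[) (gamma_density a b x t * (x < y)%R%:R) +
    \int[mu]_(x in `]0, +oo[) (gamma_density a b x t * (y <= x < z)%R%:R).
  rewrite -(RintegralD mpos iy iyz); apply: eq_Rintegral => x _; rewrite -mulrDr; congr (_ * _).
  by have [xy|yx] := ltP x y; rewrite ?(lt_le_trans xy yz)/= ?addr0 ?add0r.
apply: (addrI (fine (P [set w | Z t w < y]))).
rewrite -E1 !(gamma_law a0 b0 hZ)// E2; congr (_ + _).
rewrite /Rintegral integral_mkcondr; congr fine; apply: eq_integral => x _ /=.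
rewrite patchE; have -> : (x \in `[y, z[%classic) = (y <= x < z) by apply/idP/idP;
  rewrite inE/= in_itv.
by case: (y <= x < z); rewrite ?mulr1 ?mulr0.
Qed.

Hypothesis mX : forall t : R, 0 <= t -> measurable_fun setT (X t).
Hypothesis rcX : forall (t : R) w, 0 <= t -> X s w @[s --> t^'+] --> X t w.
Hypothesis intX : exists N, [/\ measurable N, P N = 0%E &
  forall (t : R) w, 0 <= t -> ~ N w -> X t w \is a Num.int].
Variable n : int.
Local Notation p := (state_prob P X n).

Lemma disc_state_prob_cvg (x : R) : 0 <= x -> p (disc m x) @[m --> \oo] --> p x.
Proof.
move=> x0; have [N [mN PN iN]] := intX.
exact: (@disc_compose_cvg _ _ _ P X mX rcX N mN PN iN n (fun=> x)).
Qed.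

Let mid : measurable_fun (`]0, +oo[%classic : set (measurableTypeR R)) (fun x : R => x).
Proof. exact: measurable_id. Qed.

Let pos_ge0 (x : R) : `]0, +oo[%classic x -> 0 <= x.
Proof. by rewrite /= in_itv/= andbT => /ltW. Qed.

Let measurable_disc_p m :
  measurable_fun (`]0, +oo[%classic : set (measurableTypeR R)) (fun x => p (disc m x)).
Proof.
by apply: (measurable_cell mpos mid pos_ge0 m (F := fun j _ => p (grid m j))) => j.
Qed.

Lemma measurable_state_prob : measurable_fun (`]0, +oo[%classic : set R) p.
Proof.
apply: (@measurable_fun_Rcvg _ (measurableTypeR R) R _ (fun m x => p (disc m x))).
  exact: measurable_disc_p.
by move=> x /pos_ge0; exact: disc_state_prob_cvg.
Qed.

Hypothesis ind : independent_processes P X Z.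

(** Both sides split over the same grid cells with the same values of p, and [gamma_law_itv]
    identifies the probability that Z t lies in a cell with the gamma mass of that cell. *)
Lemma disc_subordinated_prob m (t : R) : 0 < t ->
  fine (P [set w | X (disc m (Z t w)) w = n%:~R]) =
  \int[mu]_(x in `]0, +oo[) (gamma_density a b x t * p (disc m x)).
Proof.
move=> t0; have Z0 w : 0 <= Z t w by apply: (subordinator_ge0 hZ); exact: ltW.
have Z0' w : [set: T] w -> 0 <= Z t w by [].
have ig := gamma_density_integrable a0 b0 t0.
have mg : measurable_fun (`]0, +oo[%classic : set (measurableTypeR R))
  (fun x => gamma_density a b x t).
  by apply/measurable_EFinP; exact: (measurable_int _ ig).
have g0 (x : R) : `]0, +oo[%classic x -> 0 <= gamma_density a b x t.
  by move=> _; exact: gamma_density_ge0.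
have p0 j : 0 <= p (grid m j) by exact: state_prob_ge0.
rewrite (disc_compose_prob mX m n (mZ t0) Z0); last first.
  by move=> s A B s0; apply: (independent_processes1 ind s0); exact: ltW.
rewrite /Rintegral; congr fine.
rewrite (cell_integral mpos mid pos_ge0 mu m p0 mg g0).
have := cell_integral measurableT (mZ t0) Z0' P m (rho := fun=> 1) p0 (measurable_cst _)
  (fun _ _ => ler01).
under eq_integral do rewrite mul1r.
move=> ->; apply: eq_eseriesr => j _; congr (_ * _)%E.
rewrite !cell_setE// setTI.
have mj : measurable (Z t @^-1` `[j%:R / m.+1%:R, grid m j[%classic).
  by rewrite -[X in measurable X]setTI; exact: mZ.
rewrite integral_cst// mul1e.
have jj : j%:R / m.+1%:R <= grid m j :> R by rewrite ler_pM2r ?invr_gt0// ler_nat.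
have finP := fin_num_measure P _ mj.
apply: (eq_trans (esym (fineK finP))); apply: (eq_trans (congr1 EFin (gamma_law_itv t0 jj))).
rewrite /Rintegral fineK//; apply: integrable_fin_num; first exact: measurableI.
by apply: integrableS ig => //; exact: measurableI.
Qed.

(** Limit of the discretised identity: the events converge on the left, and on the right p is
    bounded by 1, so the gamma density dominates. *)
Lemma gamma_mixture (t : R) : 0 < t ->
  mu.-integrable `]0, +oo[ (EFin \o (fun x => gamma_density a b x t * p x)) /\
  state_prob P (subordinated X Z) n t =
    \int[mu]_(x in `]0, +oo[) (gamma_density a b x t * p x).
Proof.
move=> t0; have Z0 w : 0 <= Z t w by apply: (subordinator_ge0 hZ); exact: ltW.
have ig := gamma_density_integrable a0 b0 t0.
have mg : measurable_fun (`]0, +oo[%classic : set (measurableTypeR R))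
  (fun x => gamma_density a b x t).
  by apply/measurable_EFinP; exact: (measurable_int _ ig).
have [N [mN PN iN]] := intX.
have c1 := @disc_compose_cvg _ _ _ P X mX rcX N mN PN iN n (Z t) (mZ t0) Z0.
have p01 (x : R) : 0 <= x -> 0 <= p x <= 1.
  by move=> x0; rewrite state_prob_ge0/= state_prob_le1//; exact: mX.
have dom m (x : R) : `|gamma_density a b x t * p (disc m x)| <= gamma_density a b x t.
  have g0 := gamma_density_ge0 a b0 x t0.
  have d0 : 0 <= disc m x by rewrite ltW// grid_gt0.
  have /andP[h0 h1] := p01 _ d0.
  by rewrite (ger0_norm (mulr_ge0 g0 h0)) ler_piMr.
have [ipg c2] : mu.-integrable `]0, +oo[ (EFin \o (fun x => gamma_density a b x t * p x)) /\
    \int[mu]_(x in `]0, +oo[) (gamma_density a b x t * p (disc m x)) @[m --> \oo] -->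
    \int[mu]_(x in `]0, +oo[) (gamma_density a b x t * p x).
  apply: (@Rdominated_cvg _ _ R mu _ _ _ (fun x => gamma_density a b x t) mpos _ _ ig).
  - by move=> m; apply: measurable_funM => //; exact: measurable_disc_p.
  - move=> x /pos_ge0 x0; apply: cvgM; first exact: cvg_cst.
    exact: disc_state_prob_cvg.
  - by move=> m x _; exact: dom.
split=> //.
rewrite (_ : (fun m => \int[mu]_(x in _) _) =
    (fun m => fine (P [set w | X (disc m (Z t w)) w = n%:~R]))) in c2; last first.
  by apply/funext => m; rewrite disc_subordinated_prob.
exact: (cvg_unique _ c1 c2).
Qed.

Lemma subordinated_state_prob (t : R) : 0 < t ->
  state_prob P (subordinated X Z) n t = mix a b p 0 t.
Proof.
move=> t0; have [ipg ->] := gamma_mixture t0.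
rewrite /mix /moment.
have -> : \int[mu]_(x in `]0, +oo[) (gamma_density a b x t * p x) =
    \int[mu]_(x in `]0, +oo[) (norm_const a b t * (p x * moment_kernel a b 0 t x)).
  by apply: eq_Rintegral => x _; rewrite gamma_densityE; ring.
have := RintegralZl (norm_const a b t) mpos; apply.
have G0 : norm_const a b t != 0.
  by rewrite gt_eqF// divr_gt0 ?powR_gt0// Gamma_gt0// mulr_gt0.
have := RintegrableZl (norm_const a b t)^-1 mpos ipg.
apply: eq_integrable => // x _ /=; rewrite gamma_densityE; congr EFin.
by field.
Qed.

End Mixture.

(* The Laplace transform of the mixing density at [1] tends to [1] as [t] tends
   to [0], and it controls the mass away from [0]. *)
Lemma gamma_mixture_lower {R : realType} (a b C eps : R) (p q : R -> R) :
  0 < a -> 0 < b -> 0 <= C -> 0 < eps ->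
  (forall x : R, 0 < x -> 0 <= p x) ->
  (forall x : R, 0 < x -> 1 - C * x `^ eps <= p x) ->
  (forall t : R, 0 < t ->
    (@lebesgue_measure R).-integrable `]0, +oo[ (EFin \o (fun x => gamma_density a b x t * p x)) /\
    q t = \int[@lebesgue_measure R]_(x in `]0, +oo[) (gamma_density a b x t * p x)) ->
  exists2 delta : R, 0 < delta & forall s : R, 0 < s -> s < delta -> 2^-1 <= q s.
Proof.
move=> a0 b0 C0 e0 p0 pC qE.
(* Makes C x0^eps <= 1/4, hence p >= 3/4 on (0, x0]. *)
pose x0 : R := (4 * (C + 1))^-1 `^ eps^-1.
have x00 : 0 < x0 by rewrite powR_gt0// invr_gt0 mulr_gt0// ltr_wpDl.
have Cx0 : C * x0 `^ eps <= 4^-1.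
  rewrite /x0 -powRrM mulVf ?gt_eqF// powRr1; last by rewrite invr_ge0 mulr_ge0// addr_ge0.
  rewrite invfM mulrCA -[leRHS]mulr1 ler_wpM2l ?invr_ge0//.
  by rewrite ler_pdivrMr ?mul1r ?lerDl// ltr_wpDl.
have ex0 : 0 < 1 - expR (- x0) by rewrite subr_gt0 expR_lt1 oppr_lt0.
pose K := (1 - expR (- x0))^-1.
have K0 : 0 < K by rewrite invr_gt0.
(* K is such that this exponential minorant is at most 3/4 everywhere and at most 3/4 - 1 < 0 beyond
   x0; its gamma integral is explicit. *)
have lb (x : R) : 0 < x -> 3 / 4 - K + K * expR (- (1 * x)) <= p x.
  move=> xp; rewrite mul1r; have [xx|xx] := leP x x0.
    apply: le_trans (pC x xp).
    have : C * x `^ eps <= C * x0 `^ eps by rewrite ler_wpM2l// ge0_ler_powR ?nnegrE// ltW.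
    have : K * expR (- x) <= K * 1 by rewrite ler_pM2l// expR_le1 oppr_le0 ltW.
    by move: Cx0; lra.
  apply: le_trans (p0 x xp).
  have : K * expR (- x) <= K * expR (- x0) by rewrite ler_pM2l// ler_expR lerN2 ltW.
  have : K * (1 - expR (- x0)) = 1 by rewrite /K mulVf// gt_eqF.
  by rewrite mulrBr mulr1; lra.
have L0 : 0 <= b * ln (1 + 1 / a) by rewrite mulr_ge0 ?(ltW b0)// ln_ge0// lerDl divr_ge0// ltW.
set L := b * ln _ in L0.
have KL : 0 < K * L + 1 by rewrite ltr_wpDl// mulr_ge0// ltW.
(* The integrated minorant is at least 3/4 - K L s, and this delta makes K L s <= 1/4. *)
exists (4 * (K * L + 1))^-1; first by rewrite invr_gt0 mulr_gt0.
move=> s s0 sd; have [ipg ->] := qE s s0.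
have mpos : measurable (`]0, +oo[%classic : set (measurableTypeR R)) by [].
have ig := gamma_density_integrable a0 b0 s0.
have mexp : measurable_fun (`]0, +oo[%classic : set (measurableTypeR R)) (fun x : R => expR (-
  (1 * x))).
  apply: (@eq_measurable_fun _ _ _ _ _ (fun x : R => expR (- x))) => [x _|]; first by rewrite mul1r.
  by apply: (measurableT_comp (@measurable_expR R)) => //; exact: measurableT_comp.
have mg : measurable_fun (`]0, +oo[%classic : set (measurableTypeR R))
  (fun x => gamma_density a b x s).
  by apply/measurable_EFinP; exact: (measurable_int _ ig).
have ie : (@lebesgue_measure R).-integrable `]0, +oo[
    (EFin \o (fun x => gamma_density a b x s * expR (- (1 * x)))).
  apply: (@le_Rintegrable _ _ R (@lebesgue_measure R) _ _ (fun x => gamma_density a b x s)) => //.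
    exact: measurable_funM.
  move=> x; rewrite /= in_itv/= andbT => xp; have g0 := gamma_density_ge0 a b0 x s0.
  rewrite (ger0_norm (mulr_ge0 g0 (expR_ge0 _))) -[leRHS]mulr1 ler_wpM2l// expR_le1.
  by rewrite mul1r oppr_le0 ltW.
have I0 : \int[@lebesgue_measure R]_(x in `]0, +oo[) gamma_density a b x s = 1.
  have := gamma_laplace a0 b0 (lexx 0) s0.
  rewrite mul0r addr0 ln1 !mulr0 oppr0 expR0 => <-; apply: eq_Rintegral => x _.
  by rewrite mul0r oppr0 expR0 mulr1.
have I1 := gamma_laplace a0 b0 ler01 s0; rewrite -/L in I1.
apply: (@le_trans _ _ ((3 / 4 - K) * 1 + K * expR (- (s * L)))).
  have : K * (1 - s * L) <= K * expR (- (s * L)).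
    by rewrite ler_pM2l//; exact: expR_ge1Dx.
  have : s * (K * L + 1) <= 4^-1.
    by rewrite -ler_pdivlMr// -invfM ltW.
  have : 0 <= s by exact: ltW.
  by move: (expR _) => E; nra.
have i1 := RintegrableZl (3 / 4 - K) mpos ig; have i2 := RintegrableZl K mpos ie.
have -> : (3 / 4 - K) * 1 + K * expR (- (s * L)) = \int[@lebesgue_measure R]_(x in `]0, +oo[)
    ((3 / 4 - K) * gamma_density a b x s + K * (gamma_density a b x s * expR (- (1 * x)))).
  rewrite (RintegralD mpos i1 i2) (RintegralZl _ mpos ig) (RintegralZl _ mpos ie).
  by rewrite I0 I1.
apply: le_Rintegral => //.
  exact: (RintegrableD mpos i1 i2).
move=> x; rewrite /= in_itv/= andbT => xp; have g0 := gamma_density_ge0 a b0 x s0.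
rewrite mulrC mulrCA -mulrDr; exact: (ler_wpM2l g0 (lb x xp)).
Qed.

Theorem proposition3p2 (d : measure_display) (T : measurableType d)
    (R : realType) (P : probability T R)
    (k : nat) (lam mu : 'I_k -> R) (alpha a b gam : R)
    (X Z : R -> T -> R)
    (hk : (1 <= k)%N)
    (hlam : forall i, 0 < lam i) (hmu : forall i, 0 < mu i)
    (halpha0 : 0 < alpha) (halpha1 : alpha <= 1)
    (ha : 0 < a) (hb : 0 < b) (hgam : 1 <= gam)
    (hX : gfsp P lam mu alpha X)
    (hZ : gamma_subordinator P a b Z)
    (hXZ : independent_processes P X Z)
    (n : int) :
  let p := state_prob P X n in
  let q := state_prob P (subordinated X Z) n in
  (gam \is a Num.nat \/ n <> 0 -> equation_well_defined a b gam p q) /\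
  (equation_well_defined a b gam p q -> solves_equation a b gam p q).
Proof.
move=> p q.
have mX := gfsp_measurable hX.
have rcX := gfsp_right_continuous hX.
have intX := gfsp_int_valued hX.
have mp : measurable_fun (`]0, +oo[%classic : set R) p := measurable_state_prob mX rcX intX n.
have p0 (x : R) : 0 < x -> 0 <= p x by move=> _; exact: state_prob_ge0.
have p1 (x : R) : 0 < x -> `|p x| <= 1 * x `^ 0.
  move=> x0; rewrite powRr0 mulr1 ger0_norm ?p0// state_prob_le1//; apply: mX; exact: ltW.
have mixE (t : R) : 0 < t -> q t = mix a b p 0 t.
  exact: (subordinated_state_prob ha hb hZ mX rcX intX n hXZ).
have nat_case (gN : gam \is a Num.nat) :
    equation_well_defined a b gam p q /\ solves_equation a b gam p q.
  (* Integer orders are local in t: the bound p <= 1, that is C = 1 and eps = 0, suffices, and n = 0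
     is included. *)
  by apply: (@equation_nat R a b 1 0 p q false) => //.
have nonnat_case (gN : gam \isn't a Num.nat) (n0 : n <> 0) :
    equation_well_defined a b gam p q /\ solves_equation a b gam p q.
  have [C [eps [C0 eps0 pC]]] := gfsp_state_le halpha0 hX.
  apply: (@equation_nonnat R a b C eps p q) => // x x0.
  by rewrite ger0_norm ?p0//; exact: pC.
have [gN|gN] := boolP (gam \is a Num.nat); first by have [] := nat_case gN.
have [n0|/eqP n0] := eqVneq n 0; last by have [] := nonnat_case gN n0.
(* What remains is n = 0 at a non-integer order: the premise of the first claim fails, and the
   premise of the second is refuted because q >= 1/2 near 0. *)
split=> [[//|/(_ n0)//]|].
have [C [eps [C0 eps0 pC]]] := gfsp_state0_ge halpha0 hX.
have pC' (x : R) : 0 < x -> 1 - C * x `^ eps <= p x by rewrite /p n0; exact: pC.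
have [delta d0 qd] := gamma_mixture_lower ha hb C0 eps0 p0 pC'
  (gamma_mixture ha hb hZ mX rcX intX n hXZ).
have h0 : 0 < 2^-1 :> R by rewrite invr_gt0.
by move=> /(not_well_defined hb hgam gN h0 d0 qd).
Qed.
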